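(* Let $\mathcal M:=\{g:[0,1)\to\mathbb R\mid g\text{ is increasing (not necessarily strictly) and left-continuous}\}$ and let $w\in L^2([0,1])$ with $\operatorname{supp}(w)\subset[0,1)$. In the Poisson point process model with intensity $\lambda_g(x,y)=n\mathbf 1(y\ge g(x))$ on $[0,1]\times\mathbb R$, the estimator $$\hat\vartheta^{Mon}:=\int_0^1\hat g^{Mon}(x)w(x)\,dx-\frac1n\sum_{j\ge1}\mathbf 1\big(\hat g^{Mon}(X_j)=Y_j\big)w(X_j),\qquad\hat g^{Mon}(x)=\min_{i:X_i\ge x}Y_i,$$ of $\theta=\int_0^1g(x)w(x)\,dx$ is, for each finite sample size $n$, UMVU (uniformly of minimum variance among all unbiased estimators) over the class $g\in\mathcal M$, with $$\operatorname{Var}(\hat\vartheta^{Mon})=\frac1n\int_0^1\mathbb E[\hat g^{Mon}(x)-g(x)]\,w(x)^2\,dx .$$ For bounded $w$ it satisfies, as $n\to\infty$, $$\operatorname{Var}(\hat\vartheta^{Mon})\le\Big(\tfrac{3\pi(g(1)-g(0))}2\Big)^{1/2}\|w\|_\infty^2\,n^{-3/2}+O(n^{-2}).$$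
   Context: Under $P_g$ one observes the points $(X_j,Y_j)_{j\ge1}$ of a Poisson point process with intensity $\lambda_g$; expectation and variance are under $P_g$. $\operatorname{supp}(w)$ is the closed support, so the assumption means that $w$ vanishes on $(1-\epsilon,1]$ for some $\epsilon>0$. For $g\in\mathcal M$, $g(1):=\lim_{x\uparrow1}g(x)$. $\|w\|_\infty$ is the supremum norm. UMVU over $\mathcal M$ means: unbiased for $\theta$ under $P_g$ for every $g\in\mathcal M$, and for every $g\in\mathcal M$ of minimal variance under $P_g$ among all estimators that are unbiased for all $g\in\mathcal M$. *)

(* Defs.v *)
From HB Require Import structures.
From mathcomp Require Import all_boot all_order all_algebra.
From mathcomp Require Import all_classical all_reals all_analysis.
From mathcomp Require Import measurable_realfun.

Set Implicit Arguments.
Unset Strict Implicit.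
Unset Printing Implicit Defensive.

Import Order.TTheory GRing.Theory Num.Theory.
Import numFieldNormedType.Exports.

Local Open Scope classical_set_scope.
Local Open Scope ring_scope.

(* A function on [0,1) (resp. [0,1]) is a function R -> R of which only the
   restriction to [0,1) (resp. [0,1]) is used. *)

Section BoundaryModel.
Context {R : realType}.
Implicit Types (g w : R -> R) (B : set (R * R)).

Definition monotone_class : set (R -> R) :=
  [set g | {in `[0, 1[ &, {homo g : x y / x <= y}} /\
           (forall x, 0 < x < 1 -> g y @[y --> x^'-] --> g x)].

(* Zero-extension in L^2(R). *)
Definition L2_unit_interval w :=
  w \_ `[0, 1] \in Lfun (@lebesgue_measure R) 2%:E.

Definition support_unit_interval w : set R :=
  closure [set x | x \in `[0, 1] /\ w x != 0].

Definition sup_norm w : R := sup [set `|w x| | x in `[0, 1]].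

Definition intensity (n : nat) g (z : R * R) : R :=
  n%:R * (g z.1 <= z.2)%R%:R.

Definition intensity_measure (n : nat) g B : \bar R :=
  (\int[lebesgue_measure \x lebesgue_measure]_(z in B `&` (`[0%R, 1%R] `*` setT))
     (intensity n g z)%:E)%E.

Definition theta w g : R :=
  \int[lebesgue_measure]_(x in `[0, 1]) (g x * w x).

Section Observation.
Context {d : measure_display} {Omega : measurableType d}.
Implicit Types (Z : nat -> Omega -> R * R) (T : Omega -> R).

Definition point_count Z B (om : Omega) : \bar R :=
  counting [set j | B (Z j om)].

(* The intensity measures considered here have infinite total mass, so the
   points form an infinite sequence.  The natural number argument
   of [poisson_prob] is a dummy. *)
Definition poisson_point_process (P : probability Omega R) Z
    (Lambda : set (R * R) -> \bar R) : Prop :=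
  [/\ (forall j, measurable_fun setT (Z j)),
      (forall B (k : nat), measurable B -> (Lambda B < +oo)%E ->
         P [set om | point_count Z B om = k%:R%:E] =
         poisson_prob (fine (Lambda B)) 0 [set k]),
      (forall B, measurable B -> Lambda B = +oo%E ->
         P [set om | point_count Z B om = +oo%E] = 1%E) &
      (forall (m : nat) (B : 'I_m -> set (R * R)) (C : 'I_m -> set (\bar R)),
         (forall i, measurable (B i)) -> trivIset setT B ->
         (forall i, measurable (C i)) ->
         P (\bigcap_i (point_count Z (B i) @^-1` C i)) =
         (\prod_(i < m) P (point_count Z (B i) @^-1` C i))%E)].

Definition boundary_model (n : nat) Z (P : (R -> R) -> probability Omega R)
    : Prop :=
  (forall j om, (Z j om).1 \in `[0, 1]) /\
  (forall g, monotone_class g ->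
     poisson_point_process (P g) Z (intensity_measure n g)).

(* The sigma-algebra of the observed point configuration; the labels j of the
   points are not part of the observation. *)
Definition observation_sigma_algebra Z : set (set Omega) :=
  <<s [set A | exists B (C : set (\bar R)),
         [/\ measurable B, measurable C & A = point_count Z B @^-1` C]] >>.

(* Statistics are only required to be determined by the observation up to
   events that are null under every P g with g in M. *)
Definition estimator (M : set (R -> R)) Z (P : (R -> R) -> probability Omega R)
    T : Prop :=
  exists S : Omega -> R,
    (forall C : set R, measurable C ->
       observation_sigma_algebra Z (S @^-1` C)) /\
    (forall g, M g -> {ae P g, forall om, T om = S om}).

Definition unbiased (M : set (R -> R)) (P : (R -> R) -> probability Omega R)
    (vartheta : (R -> R) -> R) T : Prop :=
  forall g, M g -> (P g).-integrable setT (EFin \o T) /\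
                   ('E_(P g)[T] = (vartheta g)%:E)%E.

(* 'V takes the value +oo on integrable variables that are not square
   integrable. *)
Definition UMVU (M : set (R -> R)) Z (P : (R -> R) -> probability Omega R)
    (vartheta : (R -> R) -> R) T : Prop :=
  [/\ estimator M Z P T, unbiased M P vartheta T &
      forall T', estimator M Z P T' -> unbiased M P vartheta T' ->
        forall g, M g -> ('V_(P g)[T] <= 'V_(P g)[T'])%E].

(* For x < 1 the minimum exists almost surely; the default value 0 is used
   where it does not exist. *)
Definition g_hat Z (om : Omega) (x : R) : R :=
  let A := [set (Z i om).2 | i in [set i | x <= (Z i om).1]] in
  xget 0 [set y | A y /\ lbound A y].

(* If w vanishes near 1, then almost surely only finitely many terms of the
   series are nonzero. *)
Definition theta_hat (n : nat) Z w (om : Omega) : R :=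
  \int[lebesgue_measure]_(x in `[0, 1]) (g_hat Z om x * w x) -
  n%:R^-1 * limn (fun N => \sum_(0 <= j < N)
    (g_hat Z om (Z j om).1 == (Z j om).2)%R%:R * w (Z j om).1).

End Observation.
End BoundaryModel.

(* Main.v *)
Require Import Defs.
From HB Require Import structures.
From mathcomp Require Import all_boot all_order all_algebra.
From mathcomp Require Import finmap.
From mathcomp Require Import all_classical all_reals all_analysis.
From mathcomp Require Import measurable_realfun.
From mathcomp Require Import lra.

Set Implicit Arguments.
Unset Strict Implicit.
Unset Printing Implicit Defensive.

Import Order.TTheory GRing.Theory Num.Theory.
Import numFieldNormedType.Exports.

Local Open Scope classical_set_scope.
Local Open Scope ring_scope.

(** Pathwise identity. Call staircase the graph of [g_hat]. The variable [corner Z om z] indicates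
    that no point lies weakly to the right of [z] and strictly below it, that is, that [z] is on or
    under the staircase. At an observed point it is the indicator in the correction sum of the
    estimator; and over each [x] the segment between [g] and the staircase has length
    [g_hat x - g x]. Hence the error of [theta_hat] is [-1/n] times the integral of [w(x)] over the
    region on or under the staircase, taken against the point process minus its intensity
    ([theta_hat_innovation]).

    Mean and variance. Whether [z] is on or under the staircase is decided by points strictly lower
    than [z], so this integral behaves like a martingale in the height: it has mean zero, and its
    second moment is the mean of the integral of [w^2] over the same region against the intensity
    ([innovation_isometry]). Unbiasedness and the variance formula follow. The isometry is proved on
    finite grids, where it reduces to independence of counts in disjoint cells ([grid_isometry]),
    and is then passed to the limit, first in the mesh ([box_isometry]) and then in a truncation of
    the integrand.

    Optimality is a Lehmann-Scheffe argument. Given that the quadrant [ahead z] contains no point,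
    the observation under [P g] has the law of the model with boundary [tilt g z], which is [g]
    raised to the level [z.2] to the right of [z.1] and is again in the class ([tilt_observation]).
    So an observable with mean zero under every boundary has mean zero on each finite intersection
    of such void events ([mean_voids]), and then on the sigma-algebra which they generate
    ([mean_voids_events]). This sigma-algebra determines the staircase, and [theta_hat] agrees
    almost surely with a variable measurable for it ([front_theta_hatE]). The difference between an
    unbiased competitor and [theta_hat] is therefore orthogonal to the error of [theta_hat] and can
    only add variance ([UMVU_theta_hat]).

    Rate. By monotonicity a rectangle of width [de] above level [g (x + de)] lies in the epigraph,
    so the mean error at [x] is at most [g (x + de) - g x + 1/(n de)] ([risk_le]). Integrated over
    [x], the increment telescopes to at most [de (g(1) - g(0))]; the choice
    [de = (n (g(1) - g(0)))^(-1/2)] gives the constant 2, and [2 <= sqrt (3 pi / 2)] because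
    [pi >= 8/3] ([variance_asymptotics]). *)

(** * Means of functions known up to null sets, and limit theorems for them *)

Section HasMean.
Context d (T : measurableType d) (R : realType) (mu : {measure set T -> \bar R}).
Implicit Types (f g h : T -> R) (m : R).

(* [f] need not be measurable itself, so that almost everywhere limits can be
   used without checking their measurability. *)
Definition has_mean f m : Prop :=
  exists2 f', {ae mu, forall x, f x = f' x} &
    mu.-integrable setT (EFin \o f') /\ (\int[mu]_x (f' x)%:E = m%:E)%E.

Lemma integrable_has_mean f : mu.-integrable setT (EFin \o f) ->
  has_mean f (fine (\int[mu]_x (f x)%:E)).
Proof.
move=> fi; exists f; first exact: aeW.
by split => //; rewrite fineK// integrable_fin_num.
Qed.

Lemma ge0_has_mean f m : measurable_fun setT f -> (forall x, 0 <= f x) ->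
  (\int[mu]_x (f x)%:E = m%:E)%E -> has_mean f m.
Proof.
move=> mf f0 fm; exists f; first exact: aeW.
split => //; apply/integrableP; split; first exact/measurable_EFinP.
under eq_integral do rewrite /= ger0_norm//.
by rewrite fm ltry.
Qed.

Lemma has_mean_ae f g m : {ae mu, forall x, f x = g x} ->
  has_mean f m -> has_mean g m.
Proof.
move=> fg [f' ff' H]; exists f' => //.
by apply: filterS2 fg ff' => x <- ->.
Qed.

Lemma eq_has_mean f g m : f =1 g -> has_mean f m -> has_mean g m.
Proof. by move=> /funext ->. Qed.

Lemma has_mean_integral f m : measurable_fun setT f -> has_mean f m ->
  mu.-integrable setT (EFin \o f) /\ (\int[mu]_x (f x)%:E = m%:E)%E.
Proof.
move=> mf [f' ff' [if' <-]].
have e : ae_eq mu setT (EFin \o f') (EFin \o f).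
  by apply: filterS ff' => x /= ->.
split; last by apply/esym/ae_eq_integral => //; [case/integrableP: if'|exact/measurable_EFinP].
have mef : measurable_fun setT (EFin \o f) by exact/measurable_EFinP.
case/integrableP: if' => mf' if'; apply/integrableP; split => //.
rewrite (_ : integral _ _ _ = \int[mu]_x `|(EFin \o f') x|)%E//.
apply: ge0_ae_eq_integral => //; try by apply: measurableT_comp.
by apply: filterS e => x /(_ Logic.I) ->.
Qed.

Lemma has_mean_unique f m1 m2 : has_mean f m1 -> has_mean f m2 -> m1 = m2.
Proof.
move=> h1 [f' ff' [if' e]].
have [||_] := @has_mean_integral f' m1.
- by case/integrableP: if' => /measurable_EFinP.
- exact: has_mean_ae h1.
by rewrite e => -[].
Qed.

Lemma has_meanD f g m1 m2 : has_mean f m1 -> has_mean g m2 ->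
  has_mean (fun x => f x + g x) (m1 + m2).
Proof.
move=> [f' ff' [if' ef]] [g' gg' [ig' eg]]; exists (fun x => f' x + g' x).
  by apply: filterS2 ff' gg' => x -> ->.
split; last first.
  by under eq_integral do rewrite EFinD; rewrite integralD// ef eg.
have := integrableD measurableT if' ig'.
by apply: eq_integrable => // x _.
Qed.

Lemma has_meanZ f m c : has_mean f m -> has_mean (fun x => c * f x) (c * m).
Proof.
move=> [f' ff' [if' ef]]; exists (fun x => c * f' x).
  by apply: filterS ff' => x ->.
split; last first.
  by under eq_integral do rewrite EFinM; rewrite integralZl// ef.
have := integrableZl measurableT c if'.
by apply: eq_integrable => // x _.
Qed.

Lemma has_meanB f g m1 m2 : has_mean f m1 -> has_mean g m2 ->
  has_mean (fun x => f x - g x) (m1 - m2).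
Proof.
move=> hf hg; have := has_meanD hf (has_meanZ (-1) hg).
by rewrite mulN1r; apply: eq_has_mean => x; rewrite mulN1r.
Qed.

Lemma has_mean0 : has_mean (fun=> 0) 0.
Proof.
by apply: ge0_has_mean => //; rewrite integral0.
Qed.

Lemma has_mean_sum (I : Type) (s : seq I) (f : I -> T -> R) (m : I -> R) :
  (forall i, has_mean (f i) (m i)) ->
  has_mean (fun x => \sum_(i <- s) f i x) (\sum_(i <- s) m i).
Proof.
move=> H; elim: s => [|i s IH].
  by rewrite big_nil; apply: eq_has_mean has_mean0 => x; rewrite big_nil.
rewrite big_cons; have := has_meanD (H i) IH.
by apply: eq_has_mean => x; rewrite big_cons.
Qed.

Lemma has_mean_ge0 f m : {ae mu, forall x, 0 <= f x} -> has_mean f m -> 0 <= m.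
Proof.
move=> f0 [f' ff' [if' ef]]; rewrite -lee_fin -ef.
have mf' : measurable_fun setT f' by case/integrableP: if' => /measurable_EFinP.
rewrite (@ae_eq_integral _ _ _ mu setT (fun x => (Num.max (f' x) 0)%:E))//.
- by apply: integral_ge0 => x _; rewrite lee_fin le_max lexx orbT.
- exact/measurable_EFinP.
- by apply/measurable_EFinP; exact: measurable_maxr.
by apply: filterS2 f0 ff' => x h0 h1 _; rewrite max_l// -h1.
Qed.

Lemma has_mean_le f g m1 m2 : {ae mu, forall x, f x <= g x} ->
  has_mean f m1 -> has_mean g m2 -> m1 <= m2.
Proof.
move=> fg hf hg; rewrite -subr_ge0.
apply: has_mean_ge0 (has_meanB hg hf).
by apply: filterS fg => x; rewrite subr_ge0.
Qed.

Lemma has_mean_dominated (f : nat -> T -> R) f0 h (m : nat -> R) mh :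
  (forall k, has_mean (f k) (m k)) ->
  {ae mu, forall x, (fun k => f k x) @ \oo --> f0 x} ->
  has_mean h mh -> {ae mu, forall x, forall k, `|f k x| <= h x} ->
  exists2 m0, has_mean f0 m0 & m @ \oo --> m0.
Proof.
move=> hf cf [h' hh' [ih' eh]] fh.
have /choice [f' Hf'] : forall k, exists f' : T -> R,
    {ae mu, forall x, f k x = f' x} /\
    (mu.-integrable setT (EFin \o f') /\ (\int[mu]_x (f' x)%:E = (m k)%:E)%E).
  by move=> k; have [f' ? ?] := hf k; exists f'.
have mf' k : measurable_fun setT (f' k).
  by case: (Hf' k) => _ [/integrableP[/measurable_EFinP]].
(* A measurable version of the limit: the limsup of measurable representatives is measurable
   everywhere and equals [f0] almost everywhere. *)
pose F x := fine (limn_esup (fun k => (f' k x)%:E)).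
have mF : measurable_fun setT F.
  apply: measurableT_comp => //; apply: measurable_fun_limn_esup => k.
  exact/measurable_EFinP.
have aef : {ae mu, forall x, forall k, f k x = f' k x}.
  by apply: ae_foralln => k; case: (Hf' k).
have cF : {ae mu, forall x, (fun k => f' k x) @ \oo --> F x /\ f0 x = F x}.
  apply: filterS2 cf aef => x cx ex.
  have cx' : (fun k => f' k x) @ \oo --> f0 x.
    by apply: cvg_trans cx; apply: near_eq_cvg; apply: nearW => k; rewrite ex.
  have -> : F x = f0 x.
    rewrite /F; have c0 : (fun k => (f' k x)%:E) @ \oo --> (f0 x)%:E.
      by apply: cvg_EFin => //; exact: nearW.
    rewrite is_cvg_limn_esupE; last by apply/cvg_ex; exists (f0 x)%:E.
    by rewrite (cvg_lim _ c0).
  by [].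
have [| | | | |iF _ cI] := @dominated_convergence _ T R mu setT measurableT
  (fun k x => (f' k x)%:E) (fun x => (F x)%:E) (EFin \o h').
- by move=> k; exact/measurable_EFinP.
- exact/measurable_EFinP.
- apply: filterS cF => x [cx _] _.
  by apply: cvg_EFin => //; exact: nearW.
- by [].
- apply: filterS3 fh aef hh' => x h1 h2 h3 k _.
  by rewrite /= lee_fin -h2 -h3.
exists (fine (\int[mu]_x (F x)%:E)).
  exists F; first by apply: filterS cF => x [].
  by split => //; rewrite fineK// integrable_fin_num.
have /fine_cvgP[_] : (fun k => \int[mu]_x (f' k x)%:E)%E @ \oo -->
    (fine (\int[mu]_x (F x)%:E))%:E.
  by rewrite fineK// integrable_fin_num.
apply: cvg_trans; apply: near_eq_cvg; apply: nearW => k /=.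
by case: (Hf' k) => _ [_ ->].
Qed.

End HasMean.

Section HasMeanLimits.
Context d (T : measurableType d) (R : realType) (mu : {measure set T -> \bar R}).
Implicit Types (f g h : T -> R) (m : R).

Definition ae_measurable f : Prop :=
  exists2 f', measurable_fun setT f' & {ae mu, forall x, f x = f' x}.

Lemma has_mean_measurable f m : has_mean mu f m -> ae_measurable f.
Proof.
by move=> [f' ? [/integrableP[/measurable_EFinP mf' _] _]]; exists f'.
Qed.

Lemma ae_measurable_comp2 (F : R -> R -> R) f g :
  measurable_fun setT (fun z : R * R => F z.1 z.2) ->
  ae_measurable f -> ae_measurable g -> ae_measurable (fun x => F (f x) (g x)).
Proof.
move=> mF [f' mf' ff'] [g' mg' gg']; exists (fun x => F (f' x) (g' x)).
  exact: (measurableT_comp mF (measurable_fun_pair mf' mg')).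
by apply: filterS2 ff' gg' => x -> ->.
Qed.

Lemma ae_measurable_lim (f : nat -> T -> R) f0 :
  (forall k, ae_measurable (f k)) ->
  {ae mu, forall x, (fun k => f k x) @ \oo --> f0 x} -> ae_measurable f0.
Proof.
move=> hf cf.
have /choice [f' Hf'] : forall k, exists f' : T -> R,
    measurable_fun setT f' /\ {ae mu, forall x, f k x = f' x}.
  by move=> k; have [f' ? ?] := hf k; exists f'.
exists (fun x => fine (limn_esup (fun k => (f' k x)%:E))).
  apply: measurableT_comp => //; apply: measurable_fun_limn_esup => k.
  by apply/measurable_EFinP; case: (Hf' k).
have aef : {ae mu, forall x, forall k, f k x = f' k x}.
  by apply: ae_foralln => k; case: (Hf' k).
apply: filterS2 cf aef => x cx ex.
have c0 : (fun k => (f' k x)%:E) @ \oo --> (f0 x)%:E.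
  apply: cvg_EFin => //; first exact: nearW.
  by apply: cvg_trans cx; apply: near_eq_cvg; apply: nearW => k; rewrite /= ex.
rewrite is_cvg_limn_esupE; last by apply/cvg_ex; exists (f0 x)%:E.
by rewrite (cvg_lim _ c0).
Qed.

Lemma has_mean_bounded f h mh : ae_measurable f ->
  {ae mu, forall x, `|f x| <= h x} -> has_mean mu h mh ->
  exists m, has_mean mu f m.
Proof.
move=> [f' mf' ff'] fh [h' hh' [ih' _]].
have if' : mu.-integrable setT (EFin \o f').
  apply/integrableP; split; first exact/measurable_EFinP.
  case/integrableP: (ih') => /[dup] mh' /measurable_EFinP mh1 H; apply: le_lt_trans H.
  apply: ae_ge0_le_integral => //.
  - by apply: measurableT_comp => //; exact/measurable_EFinP.
  - by apply: measurableT_comp.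
  apply: filterS3 ff' fh hh' => x -> h1 h2 _ /=.
  by rewrite lee_fin (le_trans h1)// h2 ler_norm.
by exists (fine (\int[mu]_x (f' x)%:E)); apply: has_mean_ae (integrable_has_mean if'); apply: filterS ff'.
Qed.

(** Fatou's lemma in the form used for second moments: the uniform bound [C] supplies the
    integrability of the limit as well as the bound on its mean. *)
Lemma has_mean_fatou (h : nat -> T -> R) h0 (a : nat -> R) C :
  (forall k, has_mean mu (h k) (a k)) -> (forall k x, 0 <= h k x) ->
  {ae mu, forall x, (fun k => h k x) @ \oo --> h0 x} ->
  (forall k, a k <= C) -> exists2 a0, has_mean mu h0 a0 & a0 <= C.
Proof.
move=> hh h_ge0 ch aC.
have [h0' mh0' hh0'] : ae_measurable h0.
  by apply: ae_measurable_lim ch => k; apply: has_mean_measurable (hh k).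
have /choice [h' Hh'] : forall k, exists h' : T -> R,
    [/\ measurable_fun setT h', {ae mu, forall x, h k x = h' x}, (forall x, 0 <= h' x)
      & (\int[mu]_x (h' x)%:E = (a k)%:E)%E].
  move=> k; have [h' mh' ae'] := has_mean_measurable (hh k).
  have mm : measurable_fun setT (fun x => Num.max (h' x) 0) by exact: measurable_maxr.
  have aem : {ae mu, forall x, h k x = Num.max (h' x) 0}.
    by apply: filterS ae' => x <-; rewrite max_l.
  exists (fun x => Num.max (h' x) 0); split => //.
    by move=> x; rewrite le_max lexx orbT.
  by have [] := has_mean_integral mm (has_mean_ae aem (hh k)).
pose F x : \bar R := limn_einf (fun k => (h' k x)%:E).
have FE : {ae mu, forall x, F x = (h0' x)%:E}.
  have aef : {ae mu, forall x, forall k, h k x = h' k x}.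
    by apply: ae_foralln => k; case: (Hh' k).
  apply: filterS3 ch aef hh0' => x cx ex <-.
  have c0 : (fun k => (h' k x)%:E) @ \oo --> (h0 x)%:E.
    apply: cvg_EFin => //; first exact: nearW.
    by apply: cvg_trans cx; apply: near_eq_cvg; apply: nearW => k; rewrite /= ex.
  rewrite /F is_cvg_limn_einfE; last by apply/cvg_ex; exists (h0 x)%:E.
  by rewrite (cvg_lim _ c0).
have F0 x : (0 <= F x)%E.
  rewrite /F limn_einf_lim; apply: lime_ge; first exact: is_cvg_einfs.
  apply: nearW => n; apply: le_ereal_inf_tmp => _ [k _ <-].
  by rewrite lee_fin; case: (Hh' k).
have mF : measurable_fun setT F.
  rewrite /F /limn_einf; apply: measurableT_comp => //.
  apply: measurable_fun_limn_esup => k; apply: measurableT_comp => //.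
  by apply/measurable_EFinP; case: (Hh' k).
have mm : measurable_fun setT (fun x => Num.max (h0' x) 0) by exact: measurable_maxr.
have IE : (\int[mu]_x F x = \int[mu]_x (Num.max (h0' x) 0)%:E)%E.
  apply: ae_eq_integral => //; first exact/measurable_EFinP.
  apply: filterS FE => x Fx _; rewrite Fx.
  by congr EFin; rewrite max_l// -lee_fin -Fx.
have IC : (\int[mu]_x F x <= C%:E)%E.
  apply: le_trans (fatou _ _ _ _) _ => //.
  - by move=> k; apply/measurable_EFinP; case: (Hh' k).
  - by move=> k x _; rewrite lee_fin; case: (Hh' k).
  rewrite limn_einf_lim; apply: lime_le; first exact: is_cvg_einfs.
  apply: nearW => n; apply: ereal_inf_le; exists (a n)%:E.
    exists n => //=.
    by case: (Hh' n).
  by rewrite lee_fin.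
have I0 : (0 <= \int[mu]_x F x)%E by apply: integral_ge0.
have If : (\int[mu]_x F x)%E \is a fin_num.
  by rewrite ge0_fin_numE//; apply: le_lt_trans IC (ltry _).
exists (fine (\int[mu]_x F x)%E); last by rewrite -lee_fin fineK.
apply: (@has_mean_ae _ _ _ _ (fun x => Num.max (h0' x) 0)); last first.
  apply: ge0_has_mean => //; first by move=> x; rewrite le_max lexx orbT.
  by rewrite fineK// IE.
apply: filterS2 FE hh0' => x Fx ->.
by rewrite max_l// -lee_fin -Fx.
Qed.

(** Fatou turns the Cauchy estimate into a bound [e k] on the second moment of [f0 - f k]. Means and
    second moments then converge through the inequality [|x y| <= x^2 / t + t y^2] with a small
    fixed [t], which takes the place of Cauchy-Schwarz. *)
Lemma has_mean_L2_limit f0 (f : nat -> T -> R) (s e : nat -> R) c :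
  has_mean mu (fun=> 1) c ->
  (forall k, has_mean mu (f k) 0) ->
  (forall k, has_mean mu (fun x => f k x ^+ 2) (s k)) ->
  {ae mu, forall x, (fun k => f k x) @ \oo --> f0 x} ->
  (forall k l, (k <= l)%N -> exists2 a,
     has_mean mu (fun x => (f l x - f k x) ^+ 2) a & a <= e k) ->
  e @ \oo --> 0 ->
  has_mean mu f0 0 /\ exists2 s0, has_mean mu (fun x => f0 x ^+ 2) s0 & s @ \oo --> s0.
Proof.
move=> h1 hf hs cf he e0.
have hd k : exists2 a, has_mean mu (fun x => (f0 x - f k x) ^+ 2) a & a <= e k.
  have /choice [a Ha] : forall l, exists a,
      has_mean mu (fun x => (f (l + k)%N x - f k x) ^+ 2) a /\ a <= e k.
    by move=> l; have [a] := he k (l + k)%N (leq_addl _ _); exists a.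
  apply: (@has_mean_fatou (fun l x => (f (l + k)%N x - f k x) ^+ 2) _ a).
  - by move=> l; case: (Ha l).
  - by move=> l x; exact: sqr_ge0.
  - apply: filterS cf => x cx.
    have c1 : (fun l => f (l + k)%N x) @ \oo --> f0 x by rewrite (cvg_shiftn k (f ^~ x)).
    rewrite expr2; under eq_fun do rewrite expr2.
    by apply: cvgM; (apply: cvgB; [exact: c1|exact: cvg_cst]).
  - by move=> l; case: (Ha l).
have mf0 : ae_measurable f0.
  by apply: ae_measurable_lim cf => k; exact: has_mean_measurable (hf k).
have e_ge0 k : 0 <= e k.
  have [a ha ae] := hd k; apply: le_trans ae.
  by apply: has_mean_ge0 ha; apply: aeW => x; exact: sqr_ge0.
(* The order of choices: first [t] makes [t * b] at most [eps / 2], and only then [k] makes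
   [2 * e k / t] at most [eps / 2]. *)
have small (u : nat -> R) b : 0 <= b ->
    (forall t k, 0 < t -> t <= 1 -> u k <= 2 * e k / t + t * b) ->
    forall eps, 0 < eps -> \forall k \near \oo, u k <= eps.
  move=> b0 Hu eps eps0.
  pose t := Num.min 1 (eps / 2 / (b + 1)).
  have t0 : 0 < t by rewrite /t lt_min ltr01/= !divr_gt0//; lra.
  have t1 : t <= 1 by rewrite /t ge_min lexx.
  have tb : t * b <= eps / 2.
    have : t <= eps / 2 / (b + 1) by rewrite /t ge_min lexx orbT.
    rewrite ler_pdivlMr; last lra.
    nra.
  have : \forall k \near \oo, `|0 - e k| < t * (eps / 4).
    by apply: cvgr_dist_lt => //; rewrite mulr_gt0// divr_gt0.
  apply: filterS => k; rewrite sub0r normrN ger0_norm// => ek.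
  apply: le_trans (Hu t k t0 t1) _.
  have : 2 * e k / t <= eps / 2 by rewrite ler_pdivrMr// mulrC; move: ek; rewrite mulrCA; nra.
  by move: tb; lra.
have [m hm] : exists m, has_mean mu f0 m.
  have [a ha ae] := hd 0%N.
  have hmm : has_mean mu (fun x => 2 * (f0 x - f 0%N x) ^+ 2 + 2 * (f 0%N x) ^+ 2 + 1) (2 * a + 2 * s 0%N + c).
    by apply: has_meanD => //; apply: has_meanD; apply: has_meanZ.
  apply: has_mean_bounded hmm => //; apply: aeW => x.
  have := sqr_ge0 (f0 x - 2 * f 0%N x).
  have := sqr_ge0 (f0 x - 1); have := sqr_ge0 (f0 x + 1).
  have := sqr_ge0 (f0 x).
  rewrite ler_norml => *; apply/andP; split; nra.
have [s0 hs0] : exists s0, has_mean mu (fun x => f0 x ^+ 2) s0.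
  have [a ha ae] := hd 0%N.
  have hmm : has_mean mu (fun x => 2 * (f0 x - f 0%N x) ^+ 2 + 2 * (f 0%N x) ^+ 2) (2 * a + 2 * s 0%N).
    by apply: has_meanD => //; apply: has_meanZ.
  apply: has_mean_bounded hmm; last first.
    apply: aeW => x; rewrite ger0_norm ?sqr_ge0//.
    by have := sqr_ge0 (f0 x - 2 * f 0%N x); nra.
  apply: (@ae_measurable_comp2 (fun a b => a ^+ 2) f0 f0) => //.
  by apply: measurable_funX; exact: measurable_fst.
have amgm t (x y : R) : 0 < t -> `|x * y| <= x ^+ 2 / t + t * y ^+ 2.
  move=> t0; have : `|x * y| * t <= x ^+ 2 + (t * y) ^+ 2.
    rewrite -[t in X in X <= _]gtr0_norm// -normrM ler_norml; apply/andP; split.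
      by have := sqr_ge0 (x + t * y); have := sqr_ge0 (x - t * y); have := sqr_ge0 x; have := sqr_ge0 (t * y); lra.
    by have := sqr_ge0 (x - t * y); have := sqr_ge0 x; have := sqr_ge0 (t * y); lra.
  rewrite -ler_pdivlMr// mulrDl => H; apply: le_trans H _.
  by rewrite lerD2l exprMn (expr2 t) mulrAC mulfK ?gt_eqF.
have mean_le g1 g2 m1 m2 : has_mean mu g1 m1 -> has_mean mu g2 m2 ->
    (forall x, `|g1 x| <= g2 x) -> `|m1| <= m2.
  move=> hg1 hg2 g12; rewrite ler_norml; apply/andP; split.
    rewrite -subr_ge0 opprK addrC; apply: has_mean_ge0 (has_meanD hg2 hg1).
    by apply: aeW => x; have := g12 x; rewrite ler_norml => /andP[]; lra.
  rewrite -subr_ge0; apply: has_mean_ge0 (has_meanB hg2 hg1).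
  by apply: aeW => x; have := g12 x; rewrite ler_norml => /andP[]; lra.
have c0 : 0 <= c by apply: has_mean_ge0 h1; apply: aeW => x; exact: ler01.
have hdt t k : 0 < t -> exists2 a, has_mean mu (fun x => (f0 x - f k x) ^+ 2 / t) a & a <= e k / t.
  move=> t0; have [a ha ak] := hd k; exists (a / t); last by rewrite ler_pM2r ?invr_gt0.
  rewrite mulrC; apply: eq_has_mean (has_meanZ t^-1 ha).
  by move=> x; rewrite mulrC.
have mE : m = 0.
  apply/normr0_eq0/le_anti; rewrite normr_ge0 andbT.
  apply/ler_addgt0Pl => eps eps0; rewrite addr0.
  have Hu t k : 0 < t -> t <= 1 -> `|m| <= 2 * e k / t + t * c.
    move=> t0 _; have [a ha ak] := hdt t k t0.
    have hR := has_meanD ha (has_meanZ t h1).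
    have hL := has_meanB hm (hf k); rewrite subr0 in hL.
    apply: le_trans (mean_le _ _ _ _ hL hR _) _.
      by move=> x; have := amgm t (f0 x - f k x) 1 t0; rewrite expr1n !mulr1.
    have : 0 <= e k / t by rewrite divr_ge0// ltW.
    lra.
  have [k _ /(_ k (leqnn k))] := small (fun=> `|m|) c c0 Hu _ eps0.
  by [].
split; first by rewrite -mE.
exists s0 => //; apply/cvgrPdist_le => eps eps0.
have s00 : 0 <= s0 by apply: has_mean_ge0 hs0; apply: aeW => x; exact: sqr_ge0.
apply: (small (fun k => `|s0 - s k|) (4 * s0)) => //; first lra.
move=> t k t0 t1; have [a ha ak] := hd k.
have [b hb bk] := hdt t k t0.
have hR := has_meanD (has_meanD ha hb) (has_meanZ (4 * t) hs0).
have hL := has_meanB hs0 (hs k).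
apply: le_trans (mean_le _ _ _ _ hL hR _) _.
  (* The product estimated here is [(f0 - f k) (2 f0)], which equals
     [f0^2 - f k^2 + (f0 - f k)^2]. *)
  move=> x; have := amgm t (f0 x - f k x) (2 * f0 x) t0.
  rewrite -[X in `|X| <= _ -> _](_ : f0 x ^+ 2 - f k x ^+ 2 + (f0 x - f k x) ^+ 2 = _); last lra.
  rewrite exprMn => H.
  have := ler_normB (f0 x ^+ 2 - f k x ^+ 2 + (f0 x - f k x) ^+ 2) ((f0 x - f k x) ^+ 2).
  rewrite addrK [X in _ <= _ + X]ger0_norm ?sqr_ge0// => H2.
  apply: le_trans H2 _.
  apply: le_trans (lerD H (lexx _)) _; lra.
have : e k <= e k / t by rewrite ler_pdivlMr// -[leRHS]mulr1 ler_wpM2l.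
lra.
Qed.
End HasMeanLimits.

(** * Poisson moments, point counts and void events *)

Section PoissonMoments.
Context {R : realType}.
Implicit Types (l : R) (k : nat).

(** The mass function of [poisson_prob] at every rate: at rate 0, which occurs for regions of zero
    intensity, that law is the Dirac mass at 0. *)
Definition poisson_weight l k : R :=
  if 0 < l then poisson_pmf l k else (k == 0%N)%:R.

Lemma poisson_weight_ge0 l k : 0 <= poisson_weight l k.
Proof. by rewrite /poisson_weight; case: ifP => // _; exact: poisson_pmf_ge0. Qed.

Lemma poisson_weight0 l : 0 <= l -> poisson_weight l 0 = expR (- l).
Proof.
rewrite /poisson_weight/poisson_pmf le_eqVlt => /orP[/eqP <-|->].
  by rewrite ltxx eqxx oppr0 expR0.
by rewrite expr0 fact0 invr1 !mul1r.
Qed.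

Lemma poisson_prob_set1 l k :
  poisson_prob l 0 [set k] = (poisson_weight l k)%:E.
Proof.
rewrite /poisson_prob/poisson_weight; case: ifPn => l0.
  by rewrite esum_set1// lee_fin poisson_pmf_ge0.
by rewrite diracE in_set1 eq_sym.
Qed.

(** This recursion gives the first two moments by a shift of the index. *)
Lemma poisson_weightS l k : 0 <= l ->
  k.+1%:R * poisson_weight l k.+1 = l * poisson_weight l k.
Proof.
rewrite /poisson_weight le_eqVlt => /orP[/eqP <-|l0]; first by rewrite ltxx mulr0 mul0r.
rewrite l0 /poisson_pmf l0 factS natrM exprS invfM.
have k0 : k.+1%:R != 0 :> R by rewrite pnatr_eq0.
move: (expR _) (_ ^+ k) ((k`!)%:R^-1) => E L c.
transitivity ((k.+1%:R * k.+1%:R^-1) * (l * (L * c * E))); last by rewrite mulfV// mul1r.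
move: (k.+1%:R) (k.+1%:R^-1) => a b; lra.
Qed.

Lemma sum_poisson_weight l :
  (\sum_(k <oo) (poisson_weight l k)%:E = 1)%E.
Proof.
have e : setT = \bigcup_(k in setT) [set k : nat].
  by apply/seteqP; split => // k _; exists k.
rewrite -(probability_setT (poisson_prob l 0)) e measure_bigcup//; last first.
  by move=> i j _ _ [x [-> ->]].
rewrite [RHS](@eq_eseriesl _ _ xpredT); last by move=> k; rewrite in_setT.
by apply: eq_eseriesr => k _; rewrite -poisson_prob_set1.
Qed.

Lemma sum_shift (f : nat -> \bar R) : (forall k, (0 <= f k)%E) -> f 0%N = 0%E ->
  (\sum_(k <oo) f k = \sum_(k <oo) f k.+1)%E.
Proof.
move=> f0 f00; rewrite (nneseries_split 0 1)// add0n big_nat1 f00 add0e.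
by rewrite -nneseries_addn//; apply: eq_eseriesr => i _; rewrite addn1.
Qed.

Lemma poisson_weight_mean l : 0 <= l ->
  (\sum_(k <oo) (k%:R * poisson_weight l k)%:E = l%:E)%E.
Proof.
move=> l0; rewrite sum_shift ?mul0r//; last first.
  by move=> k; rewrite lee_fin mulr_ge0// poisson_weight_ge0.
under eq_eseriesr do rewrite poisson_weightS// EFinM.
rewrite nneseriesZl; last by move=> k _; rewrite lee_fin poisson_weight_ge0.
by rewrite sum_poisson_weight mule1.
Qed.

Lemma poisson_weight_mean_sq l : 0 <= l ->
  (\sum_(k <oo) (k%:R ^+ 2 * poisson_weight l k)%:E = (l ^+ 2 + l)%:E)%E.
Proof.
move=> l0; rewrite sum_shift ?expr0n ?mul0r//; last first.
  by move=> k; rewrite lee_fin mulr_ge0// ?exprn_ge0// poisson_weight_ge0.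
under eq_eseriesr => k _.
  rewrite expr2 -mulrA poisson_weightS// mulrCA -addn1 natrD mulrDl mul1r mulrDr EFinD.
  over.
rewrite nneseriesD; last 2 first.
- by move=> k _; rewrite lee_fin !mulr_ge0// poisson_weight_ge0.
- by move=> k _; rewrite lee_fin !mulr_ge0// poisson_weight_ge0.
under eq_eseriesr do rewrite EFinM.
rewrite nneseriesZl; last by move=> k _; rewrite lee_fin mulr_ge0// poisson_weight_ge0.
under [X in (_ + X)%E]eq_eseriesr do rewrite EFinM.
rewrite nneseriesZl; last by move=> k _; rewrite lee_fin poisson_weight_ge0.
by rewrite poisson_weight_mean// sum_poisson_weight mule1 expr2 EFinD EFinM.
Qed.

End PoissonMoments.

Section Counts.
Context {R : realType} {d : measure_display} {Omega : measurableType d}.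
Variable Z : nat -> Omega -> R * R.
Hypothesis mZ : forall j, measurable_fun setT (Z j).
Implicit Types (A B : set (R * R)) (om : Omega).

Definition void B : set Omega := [set om | forall j, ~ B (Z j om)].

Definition count B om : R := fine (point_count Z B om).

(** The configuration as a random measure, so that sums over the points become integrals and share
    their lemmas with integrals against the intensity. *)
Definition point_measure om : set (R * R) -> \bar R :=
  mseries (fun j => \d_(Z j om)) 0.
HB.instance Definition _ om := Measure.on (point_measure om).

Lemma point_countE B om : point_count Z B om = point_measure om B.
Proof.
rewrite /point_count counting_dirac /point_measure /mseries.
by apply: eq_eseriesr => j _; rewrite !diracE.
Qed.

Lemma measurable_point_count B : measurable B ->
  measurable_fun setT (point_count Z B).
Proof.
move=> mB; rewrite (_ : point_count Z B = point_measure^~ B); last first.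
  by apply/funext => om; rewrite point_countE.
rewrite /point_measure/mseries; apply: ge0_emeasurable_sum => // j _.
rewrite (_ : (fun om => _) = (fun om => (\1_B (Z j om))%:E)).
  by apply/measurable_EFinP; apply: measurableT_comp (mZ j).
by apply/funext => om; rewrite /= diracE indicE.
Qed.

Lemma measurable_point_count_preimage B (C : set (\bar R)) :
  measurable B -> measurable C -> measurable (point_count Z B @^-1` C).
Proof. by move=> mB mC; rewrite -[X in measurable X]setTI; exact: measurable_point_count. Qed.

Lemma measurable_count B : measurable B -> measurable_fun setT (count B).
Proof. by move=> mB; apply: measurableT_comp => //; exact: measurable_point_count. Qed.

Lemma voidE B : void B = point_count Z B @^-1` [set 0%E].
Proof.
apply/seteqP; split => om /= H.
  rewrite /point_count (_ : [set _ | _] = set0) ?measure0//.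
  by apply/seteqP; split => // j /H.
move=> j Bj; move: H; rewrite /point_count/counting; case: ifPn => // /asboolP fs [] /eqP.
rewrite pnatr_eq0 cardfs_eq0 => /eqP/fset_set_set0 => /(_ fs) e.
by have : [set j | B (Z j om)] j by []; rewrite e.
Qed.

Lemma measurable_void B : measurable B -> measurable (void B).
Proof.
move=> mB; rewrite voidE -[X in measurable X]setTI.
by apply: measurable_point_count.
Qed.

Lemma voidU A B : void (A `|` B) = void A `&` void B.
Proof.
apply/seteqP; split => [om H|om [H1 H2] j [/H1|/H2]//].
by split => j Aj; apply: (H j); [left|right].
Qed.

Lemma subset_void A B : A `<=` B -> void B `<=` void A.
Proof. by move=> AB om H j /AB; exact: H. Qed.

Lemma void_count B om : void B om -> count B om = 0.
Proof. by rewrite /count voidE => ->. Qed.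

Lemma point_count_cases B om : point_count Z B om = +oo%E \/
  exists k : nat, point_count Z B om = k%:R%:E.
Proof.
by rewrite /point_count/counting; case: ifPn => _; [right; eexists|left].
Qed.

Lemma count_ge0 B om : 0 <= count B om.
Proof. by apply: fine_ge0; rewrite point_countE. Qed.

Lemma countU A B om : measurable A -> measurable B -> A `&` B = set0 ->
  (point_count Z A om < +oo)%E -> (point_count Z B om < +oo)%E ->
  count (A `|` B) om = count A om + count B om.
Proof.
move=> mA mB AB; rewrite /count !point_countE => fA fB.
by rewrite measureU// fineD// ge0_fin_numE.
Qed.

End Counts.

Section PoissonCounts.
Context {R : realType} {d : measure_display} {Omega : measurableType d}.
Variables (P : probability Omega R) (Z : nat -> Omega -> R * R).
Variable Lambda : {measure set (R * R) -> \bar R}.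
Hypothesis ppp : poisson_point_process P Z Lambda.
Implicit Types (A B : set (R * R)).

Local Notation void := (void Z).
Local Notation count := (count Z).

Lemma ppp_measurable j : measurable_fun setT (Z j).
Proof. by case: ppp. Qed.
Local Notation mZ := ppp_measurable.

Lemma prob_void B : measurable B -> P (void B) = expeR (- Lambda B).
Proof.
move=> mB; rewrite voidE; case: ppp => _ hfin hinf _.
have [LB|] := ltP (Lambda B) +oo%E.
  rewrite [LHS](hfin B 0%N mB LB) poisson_prob_set1 poisson_weight0 ?fine_ge0//.
  by rewrite -[in RHS](fineK (x := Lambda B)) ?ge0_fin_numE.
rewrite leye_eq => /eqP LB; rewrite LB/=.
have moo : measurable [set om | point_count Z B om = +oo%E].
  exact: (measurable_point_count_preimage mZ mB (emeasurable_set1 _)).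
have P0 : P (~` [set om | point_count Z B om = +oo%E]) = 0%E.
  by rewrite probability_setC// hinf// subee.
apply: (subset_measure0 _ _ _ P0).
- by rewrite -voidE; exact: (measurable_void mZ).
- exact: measurableC.
- by move=> om /= ->.
Qed.

Lemma point_count_lty B : measurable B -> (Lambda B < +oo)%E ->
  {ae P, forall om, (point_count Z B om < +oo)%E}.
Proof.
move=> mB LB; have mE k : measurable [set om | point_count Z B om = k%:R%:E].
  exact: (measurable_point_count_preimage mZ mB (emeasurable_set1 _)).
have mU : measurable (\bigcup_k [set om | point_count Z B om = k%:R%:E]).
  exact: bigcupT_measurable.
have PU : P (\bigcup_k [set om | point_count Z B om = k%:R%:E]) = 1%E.
  rewrite measure_bigcup//; last first.
    move=> i j _ _ [om [/= -> []] /eqP]; rewrite eqr_nat => /eqP ->//.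
  rewrite -(sum_poisson_weight (fine (Lambda B))).
  rewrite [LHS](@eq_eseriesl _ _ xpredT); last by move=> k; rewrite in_setT.
  by apply: eq_eseriesr => k _; case: ppp => _ hfin _ _; rewrite -poisson_prob_set1 -hfin.
exists (~` \bigcup_k [set om | point_count Z B om = k%:R%:E]); split.
- exact: measurableC.
- by rewrite probability_setC// PU subee.
move=> om /=; apply: contra_not => -[k _ ->]; exact: ltry.
Qed.

Lemma indep_counts A B (C1 C2 : set (\bar R)) : measurable A -> measurable B ->
  A `&` B = set0 -> measurable C1 -> measurable C2 ->
  P (point_count Z A @^-1` C1 `&` point_count Z B @^-1` C2) =
  (P (point_count Z A @^-1` C1) * P (point_count Z B @^-1` C2))%E.
Proof.
move=> mA mB AB mC1 mC2; case: ppp => _ _ _ ind.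
have := ind 2%N (fun i => if i == ord0 then A else B)
  (fun i => if i == ord0 then C1 else C2).
rewrite !big_ord_recl big_ord0/= mule1 => <-.
- congr (P _); apply/seteqP; split => om /=.
    by move=> [H1 H2] i _; case: ifP.
  move=> H; split; first exact: (H ord0 Logic.I).
  exact: (H (lift ord0 ord0) Logic.I).
- by move=> i; case: ifP.
- apply/trivIsetP => i j _ _; case: i => -[|[|//]] hi; case: j => -[|[|//]] hj //= _ //.
  by rewrite setIC.
- by move=> i; case: ifP.
Qed.

(** The count on [A] is almost surely a natural number; on each event where it equals [k],
    independence of the counts on [A] and [B] factors the probability. The function [F] extends [f]
    to the reals because [count] is real-valued. *)
Lemma void_weighted_count A B (f : nat -> R) (s : R) :
  measurable A -> measurable B -> A `&` B = set0 -> (Lambda A < +oo)%E ->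
  (forall k, 0 <= f k) ->
  (\sum_(k <oo) (f k * poisson_weight (fine (Lambda A)) k)%:E = s%:E)%E ->
  forall F : R -> R, measurable_fun setT F -> (forall k : nat, F k%:R = f k) ->
  (forall x, 0 <= F x) ->
  has_mean P (fun om => F (count A om) * \1_(void B) om)
    (s * fine (P (void B))).
Proof.
move=> mA mB AB LA f0 fs F mF Ff F0.
have mvB : measurable (void B) by exact: (measurable_void mZ).
pose E k := [set om | point_count Z A om = k%:R%:E].
have mE k : measurable (E k).
  exact: (measurable_point_count_preimage mZ mA (emeasurable_set1 _)).
have tE : trivIset setT E.
  by move=> i j _ _ [om []]; rewrite /E/= => -> [] /eqP; rewrite eqr_nat => /eqP.
have mFA : measurable_fun setT (fun om => F (count A om) * \1_(void B) om).
  apply: measurable_funM => //; apply: measurableT_comp => //.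
  exact: (measurable_count mZ).
apply: ge0_has_mean => //; first by move=> om; rewrite mulr_ge0.
have aeU : {ae P, forall om, (\bigcup_k E k) om}.
  apply: filterS (point_count_lty mA LA) => om.
  by rewrite /E/=; case: (point_count_cases Z A om) => [->//|[k kE] _]; exists k.
rewrite (_ : (\int[P]_om _)%E =
    \int[P]_(om in \bigcup_k E k) (F (count A om) * \1_(void B) om)%:E)%E; last first.
  rewrite [RHS]integral_mkcond; apply: ge0_ae_eq_integral => //.
  - exact/measurable_EFinP.
  - apply/(measurable_restrictT _ _).1; first exact: bigcupT_measurable.
    by apply: measurable_funTS; exact/measurable_EFinP.
  - by move=> om _; rewrite lee_fin mulr_ge0.
  - by move=> om _; rewrite patchE; case: ifP => // _; rewrite lee_fin mulr_ge0.
  - by apply: filterS aeU => om Uom _; rewrite patchE mem_set.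
rewrite ge0_integral_bigcup//; last 2 first.
- by apply: measurable_funTS; exact/measurable_EFinP.
- by move=> om _; rewrite lee_fin mulr_ge0.
have Pv : P (void B) = (fine (P (void B)))%:E by rewrite fineK// fin_num_measure.
rewrite EFinM -fs muleC -nneseriesZl; last first.
  by move=> k _; rewrite lee_fin mulr_ge0// poisson_weight_ge0.
apply: eq_eseriesr => k _.
rewrite (eq_integral (fun om => (f k)%:E * (\1_(void B) om)%:E)%E); last first.
  by move=> om /set_mem; rewrite /E/= => Ek; rewrite /count Ek/= Ff EFinM.
rewrite ge0_integralZl_EFin//; last first.
  by apply/measurable_EFinP; apply: measurable_funTS.
rewrite integral_indic// setIC.
have PE : P (E k `&` void B) = ((poisson_weight (fine (Lambda A)) k)%:E * P (void B))%E.
  have := indep_counts mA mB AB (emeasurable_set1 k%:R%:E) (emeasurable_set1 0%E).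
  rewrite -voidE => ->; congr (_ * _)%E.
  by case: ppp => _ hfin _ _; rewrite -poisson_prob_set1 -hfin.
rewrite -[X in (_ * X)%E = _]/(P (E k `&` void B)) PE Pv -!EFinM; congr EFin; lra.
Qed.

Section Moments.
Variables A B : set (R * R).
Hypotheses (mA : measurable A) (mB : measurable B) (AB : A `&` B = set0).
Hypothesis LA : (Lambda A < +oo)%E.
Let l := fine (Lambda A).
Let v := fine (P (void B)).

Lemma void_has_mean : has_mean P (fun om => \1_(void B) om) v.
Proof.
apply: ge0_has_mean => //; first exact/measurable_indicP/(measurable_void mZ).
by rewrite integral_indic// ?setIT ?fineK ?fin_num_measure//; exact: (measurable_void mZ).
Qed.

Lemma void_count_mean :
  has_mean P (fun om => count A om * \1_(void B) om) (l * v).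
Proof.
apply: (eq_has_mean (f := fun om => `|count A om| * \1_(void B) om)).
  by move=> om; rewrite ger0_norm// count_ge0.
(* The extension of [k] to the reals has to be nonnegative everywhere, hence the absolute value. *)
apply: (@void_weighted_count A B (fun k => k%:R) l _ _ _ _ _ _ (@Num.norm R R)) => //.
- by rewrite -poisson_weight_mean// /l fine_ge0.
- by move=> k; rewrite normr_nat.
Qed.

Lemma void_count_sq_mean :
  has_mean P (fun om => count A om ^+ 2 * \1_(void B) om) ((l ^+ 2 + l) * v).
Proof.
apply: (@void_weighted_count A B (fun k => k%:R ^+ 2) _ _ _ _ _ _ _ (fun x => x ^+ 2)) => //.
- by rewrite -poisson_weight_mean_sq// /l fine_ge0.
- by move=> x; exact: sqr_ge0.
Qed.

End Moments.

(** Polarization: the product of the two counts is half of [N(A U A')^2 - N(A)^2 - N(A')^2], so the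
    second moments on single sets suffice. *)
Lemma void_count_mul_mean A A' B : measurable A -> measurable A' -> measurable B ->
  A `&` A' = set0 -> A `&` B = set0 -> A' `&` B = set0 ->
  (Lambda A < +oo)%E -> (Lambda A' < +oo)%E ->
  has_mean P (fun om => count A om * count A' om * \1_(void B) om)
    (fine (Lambda A) * fine (Lambda A') * fine (P (void B))).
Proof.
move=> mA mA' mB AA' AB A'B LA LA'.
have mU : measurable (A `|` A') by exact: measurableU.
have UB : (A `|` A') `&` B = set0 by rewrite setIUl AB A'B setU0.
have LU : Lambda (A `|` A') = (Lambda A + Lambda A')%E by rewrite measureU.
have LUf : (Lambda (A `|` A') < +oo)%E by rewrite LU lte_add_pinfty.
have h := void_count_sq_mean mU mB UB LUf.
have h1 := void_count_sq_mean mA mB AB LA.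
have h2 := void_count_sq_mean mA' mB A'B LA'.
have H := has_meanZ 2^-1 (has_meanB (has_meanB h h1) h2).
move: H; rewrite LU fineD ?ge0_fin_numE//.
set x := fine (Lambda A); set y := fine (Lambda A'); set v := fine _.
rewrite (_ : 2^-1 * _ = x * y * v); last lra.
apply: has_mean_ae.
apply: filterS2 (point_count_lty mA LA) (point_count_lty mA' LA') => om f1 f2.
rewrite countU//; lra.
Qed.

End PoissonCounts.

(** * The isometry on a finite grid *)

Section GridIsometry.
Context {R : realType} {d : measure_display} {Omega : measurableType d}.
Variables (P : probability Omega R) (Z : nat -> Omega -> R * R).
Variable Lambda : {measure set (R * R) -> \bar R}.
Hypothesis ppp : poisson_point_process P Z Lambda.
Variables (I : finType) (Q : I -> set (R * R)) (kills : rel I).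
Hypothesis mQ : forall i, measurable (Q i).
Hypothesis tQ : forall i j, i != j -> Q i `&` Q j = set0.
Hypothesis LQ : forall i, (Lambda (Q i) < +oo)%E.
Hypothesis kills_asym : forall i j, kills i j -> ~~ kills j i.

(** Cell [i] contributes only while all its killers are empty. No cell kills itself, so this switch
    is independent of the count in cell [i]. *)
Definition killers i : set (R * R) := \bigcup_(j in [set j | kills j i]) Q j.

Let V i om : R := \1_(void Z (killers i)) om.
Let X i om : R := count Z (Q i) om - fine (Lambda (Q i)).

Lemma measurable_killers i : measurable (killers i).
Proof. by apply: fin_bigcup_measurable => //; exact: finite_finset. Qed.

Let disjK i j : ~~ kills j i -> Q j `&` killers i = set0.
Proof.
move=> nk; apply/seteqP; split => // z [Qj [k /= kk Qk]].
have jk : j != k by apply: contraNneq nk => ->.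
by have : (Q j `&` Q k) z by []; rewrite tQ.
Qed.

Let kills_irr i : ~~ kills i i.
Proof. by apply/negP => /[dup] /kills_asym /negP. Qed.

Let VX i B : measurable B -> Q i `&` B = set0 ->
  has_mean P (fun om => X i om * \1_(void Z B) om) 0.
Proof.
move=> mB QB; have := has_meanB (void_count_mean ppp (mQ i) mB QB (LQ i))
  (has_meanZ (fine (Lambda (Q i))) (void_has_mean ppp mB)).
by rewrite subrr; apply: eq_has_mean => om; rewrite -mulrBl.
Qed.

Let diag i : has_mean P (fun om => (V i om * X i om) * (V i om * X i om))
  (fine (Lambda (Q i)) * fine (P (void Z (killers i)))).
Proof.
have mB := measurable_killers i; have QB := disjK (kills_irr i).
have h2 := void_count_sq_mean ppp (mQ i) mB QB (LQ i).
have h1 := void_count_mean ppp (mQ i) mB QB (LQ i).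
have h0 := void_has_mean ppp mB.
set l := fine _ in h1 h2 *; set v := fine _ in h0 h1 h2 *.
have := has_meanD (has_meanB h2 (has_meanZ (2 * l) h1)) (has_meanZ (l ^+ 2) h0).
rewrite [X in has_mean _ _ X](_ : _ = l * v); last lra.
apply: eq_has_mean => om; rewrite /V /X -/l indicE.
case: (om \in _) => /=; lra.
Qed.

(** If [j] kills [i], the switch [V i] forces cell [j] to be empty, so [X j] becomes a constant, and
    the centred count [X i] is independent of the remaining void event. If neither kills the other,
    both cells are disjoint from all killers, and the two centred counts are independent of each
    other and of the void event. *)
Let off i j : i != j -> ~~ kills i j ->
  has_mean P (fun om => (V i om * X i om) * (V j om * X j om)) 0.
Proof.
move=> ij nk; pose B := killers i `|` killers j.
have mB : measurable B by apply: measurableU; exact: measurable_killers.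
have QiB : Q i `&` B = set0 by rewrite setIUr !disjK ?setU0 ?kills_irr.
have VB om : V i om * V j om = \1_(void Z B) om.
  by rewrite /V /B voidU indicI.
have [kji|nkji] := boolP (kills j i).
  have := has_meanZ (- fine (Lambda (Q j))) (VX mB QiB).
  rewrite mulr0; apply: eq_has_mean => om.
  transitivity (X i om * (\1_(void Z B) om * X j om)); last by rewrite -VB; lra.
  rewrite indicE; have [/set_mem vB|_] := boolP (om \in _); last by rewrite /=; lra.
  rewrite [X j om]/X void_count/=; first lra.
  by apply: subset_void vB => z Qz; left; exists j.
have QjB : Q j `&` B = set0 by rewrite setIUr !disjK ?setU0 ?kills_irr.
have H := void_count_mul_mean ppp (mQ i) (mQ j) mB (tQ ij) QiB QjB (LQ i) (LQ j).
have := has_meanB H (has_meanD (has_meanZ (fine (Lambda (Q i))) (void_count_mean ppp (mQ j) mB QjB (LQ j)))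
  (has_meanZ (fine (Lambda (Q j))) (VX mB QiB))).
rewrite [X in has_mean _ _ X](_ : _ = 0); last lra.
apply: eq_has_mean => om.
transitivity (X i om * X j om * (V i om * V j om)); last lra.
rewrite VB /X; lra.
Qed.

Lemma grid_mean (c : I -> R) :
  has_mean P (fun om => \sum_i c i * (V i om * X i om)) 0.
Proof.
rewrite [X in has_mean _ _ X](_ : 0 = \sum_(i : I) 0); last by rewrite big1.
apply: (@has_mean_sum _ _ _ P I _ (fun i om => c i * (V i om * X i om)) (fun=> 0)) => i.
rewrite -(mulr0 (c i)); apply: has_meanZ.
apply: eq_has_mean (VX (measurable_killers i) (disjK (kills_irr i))) => om.
by rewrite mulrC.
Qed.

(** Only the diagonal of the double sum survives: of two distinct cells at most one kills the other,
    so [off] applies in at least one of the two orders. *)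
Lemma grid_isometry (c : I -> R) :
  has_mean P (fun om => (\sum_i c i * (V i om * X i om)) ^+ 2)
    (\sum_i c i ^+ 2 * (fine (Lambda (Q i)) * fine (P (void Z (killers i))))).
Proof.
rewrite [X in has_mean _ _ X](_ : _ = \sum_i \sum_j (if i == j then
   c i ^+ 2 * (fine (Lambda (Q i)) * fine (P (void Z (killers i)))) else 0)).
  apply: (@eq_has_mean _ _ _ _ (fun om => \sum_i \sum_j
      (c i * (V i om * X i om)) * (c j * (V j om * X j om)))).
    by move=> om; rewrite expr2 big_distrlr.
  apply: (@has_mean_sum _ _ _ P I _ (fun i om => \sum_j
    (c i * (V i om * X i om)) * (c j * (V j om * X j om)))) => i.
  apply: (@has_mean_sum _ _ _ P I _ (fun j om =>
    (c i * (V i om * X i om)) * (c j * (V j om * X j om)))) => j.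
  case: eqVneq => [<-|ij].
    apply: eq_has_mean (has_meanZ (c i ^+ 2) (diag i)) => om; lra.
  have [kij|nkij] := boolP (kills i j); last first.
    rewrite -(mulr0 (c i * c j)).
    apply: eq_has_mean (has_meanZ _ (off ij nkij)) => om; lra.
  rewrite -(mulr0 (c i * c j)).
  have ji : j != i by rewrite eq_sym.
  apply: eq_has_mean (has_meanZ _ (off ji (kills_asym kij))) => om; lra.
by apply: eq_bigr => i _; rewrite -big_mkcond/= (big_pred1 i)// => j; rewrite eq_sym.
Qed.

End GridIsometry.

(** * Almost surely, no two points have the same height *)

Section Ties.
Context {R : realType} {d : measure_display} {Omega : measurableType d}.

Lemma point_count_finite (Z : nat -> Omega -> R * R) (B : set (R * R)) om :
  (point_count Z B om < +oo)%E -> finite_set [set j | B (Z j om)].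
Proof. by rewrite /point_count/counting; case: ifPn => // /asboolP. Qed.

Lemma point_count_ge2 (Z : nat -> Omega -> R * R) (B : set (R * R)) om i j :
  i != j -> B (Z i om) -> B (Z j om) -> (2%:E <= point_count Z B om)%E.
Proof.
move=> ij Bi Bj; have c1 k : counting [set k : nat] = 1%:E :> \bar R.
  by rewrite /counting asboolT// fset_set1 cardfs1.
apply: (@le_trans _ _ (counting ([set i] `|` [set j]))).
  have dis : [set i] `&` [set j] = set0.
    by apply/seteqP; split => // k [/= -> /eqP]; rewrite (negbTE ij).
  have e : counting ([set i] `|` [set j]) = (1%:E + 1%:E)%E :> \bar R.
    by rewrite measureU//; congr (_ + _)%E; exact: c1.
  by rewrite e.
by apply: le_measure; [exact/mem_set|exact/mem_set|move=> k [->|->]].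
Qed.

Variables (P : probability Omega R) (Z : nat -> Omega -> R * R).
Variable Lambda : {measure set (R * R) -> \bar R}.
Hypothesis ppp : poisson_point_process P Z Lambda.
Variable K : R.
Hypothesis strip_le : forall a b, a <= b ->
  (Lambda [set z | (a <= z.2 < b)%R] <= (K * (b - a))%:E)%E.

Lemma measurable_strip (a b : R) : measurable [set z : R * R | a <= z.2 < b].
Proof.
rewrite (_ : [set _ | _] = setT `&` snd @^-1` `[a, b[%classic).
  exact: measurable_snd.
by rewrite setTI; apply/seteqP; split => z /=; rewrite in_itv.
Qed.

Lemma count_nat (B : set (R * R)) om : exists k : nat, count Z B om = k%:R.
Proof.
rewrite /count; case: (point_count_cases Z B om) => [->|[k ->]]; last by exists k.
by exists 0%N.
Qed.

(** Cut the heights from [-M] to [M] into [2M(m+1)] strips of height [1/(m+1)]. Two points at the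
    same height fall into one strip, where the indicator of the tie is at most [N^2 - N]; this has
    mean [Lambda(S)^2 <= (K/(m+1))^2]. Summing over the strips gives a bound of order [1/m]. *)
Lemma ae_tie_bounded (i j M : nat) : i != j ->
  {ae P, forall om, (Z i om).2 = (Z j om).2 ->
    - M%:R <= (Z i om).2 -> (Z i om).2 < M%:R -> False}.
Proof.
move=> ij; pose T := [set om | [/\ (Z i om).2 = (Z j om).2,
  - M%:R <= (Z i om).2 & (Z i om).2 < M%:R]].
have mZ2 k : measurable_fun setT (fun om => (Z k om).2).
  by apply: measurableT_comp => //; exact: (ppp_measurable ppp).
have mT : measurable T.
  rewrite (_ : T = [set om | (Z i om).2 = (Z j om).2] `&`
    [set om | - M%:R <= (Z i om).2 < M%:R]); last first.
    apply/seteqP; split => om /=; first by move=> [-> -> ->].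
    by move=> [? /andP[]]; split.
  apply: measurableI.
    rewrite (_ : [set _ | _] = (fun om => (Z i om).2 - (Z j om).2) @^-1` [set 0]).
      rewrite -[X in measurable X]setTI.
      exact: (measurable_funB (mZ2 i) (mZ2 j) measurableT (measurable_set1 0)).
    by apply/seteqP; split => om /= => [->|/eqP]; rewrite ?subrr// subr_eq0 => /eqP.
  rewrite (_ : [set _ | _] = Z i @^-1` [set z | - M%:R <= z.2 < M%:R])//.
  rewrite -[X in measurable X]setTI.
  exact: (ppp_measurable ppp i measurableT (measurable_strip _ _)).
suff PT : P T = 0%E.
  exists T; split => // om /= H; apply: contrapT => nT; apply: H => h1 h2 h3.
  by apply: nT; split.
have hT : has_mean P (fun om => \1_T om) (fine (P T)).
  apply: ge0_has_mean => //; first exact/measurable_indicP.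
  by rewrite integral_indic// ?setIT ?fineK ?fin_num_measure.
have le0 m : fine (P T) <= (2 * M%:R * K ^+ 2) / m.+1%:R.
  pose S (k : nat) := [set z : R * R | (k%:R / m.+1%:R - M%:R <= z.2 < k.+1%:R / m.+1%:R - M%:R)].
  have mS k : measurable (S k) by exact: measurable_strip.
  have m0 : 0 < m.+1%:R :> R by rewrite ltr0n.
  have LS k : (Lambda (S k) <= (K / m.+1%:R)%:E)%E.
    apply: le_trans (strip_le _) _; first by rewrite lerB// ler_pM2r ?invr_gt0// ler_nat.
    rewrite lee_fin -(natr1 k); move: (m.+1%:R^-1) => q; lra.
  have LSf k : (Lambda (S k) < +oo)%E by apply: le_lt_trans (LS k) (ltry _).
  have h k : has_mean P (fun om => count Z (S k) om ^+ 2 - count Z (S k) om) (fine (Lambda (S k)) ^+ 2).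
    have Sv : S k `&` set0 = set0 by rewrite setI0.
    have := has_meanB (void_count_sq_mean ppp (mS k) measurable0 Sv (LSf k))
      (void_count_mean ppp (mS k) measurable0 Sv (LSf k)).
    have -> : void Z set0 = setT by apply/seteqP; split => // om _ l.
    rewrite probability_setT/= !mulr1 addrK.
    by apply: eq_has_mean => om; rewrite indicT !mulr1.
  have hs := has_mean_sum (iota 0 (2 * M * m.+1)) h.
  have : fine (P T) <= \sum_(k <- iota 0 (2 * M * m.+1)) fine (Lambda (S k)) ^+ 2.
    apply: has_mean_le hT hs.
    have ae : {ae P, forall om, forall k, (point_count Z (S k) om < +oo)%E}.
      by apply: ae_foralln => k; exact: (point_count_lty ppp (mS k) (LSf k)).
    apply: filterS ae => om fin.
    have nn k : 0 <= count Z (S k) om ^+ 2 - count Z (S k) om.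
      have [l ->] := count_nat (S k) om.
      by rewrite subr_ge0 -natrX ler_nat; case: l => // l; rewrite expnS leq_pmulr.
    rewrite indicE; have [/set_mem[e h1 h2]|_] := boolP (om \in T); last first.
      by apply: sumr_ge0.
    pose y := m.+1%:R * ((Z i om).2 + M%:R).
    have y0 : 0 <= y by rewrite mulr_ge0//; lra.
    pose k := Num.truncn y.
    have /andP[k1 k2] : k%:R <= y < k.+1%:R by rewrite /k truncn_itv.
    have kin : k \in iota 0 (2 * M * m.+1).
      rewrite mem_iota/= add0n -(ltr_nat R) (le_lt_trans k1)// /y mulrC !natrM ltr_pM2r//.
      lra.
    have Sk z : m.+1%:R * (z.2 + M%:R) = y -> S k z.
      move=> zy; rewrite /S/= lerBlDr ltrBrDr ler_pdivrMr// ltr_pdivlMr//.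
      by rewrite mulrC zy k1.
    have ge2 := point_count_ge2 ij (Sk _ erefl) (Sk (Z j om) _).
    have {ge2} : (2%:E <= point_count Z (S k) om)%E by apply: ge2; rewrite -e.
    case: (point_count_cases Z (S k) om) => [pc|[l pc]]; first by have := fin k; rewrite pc.
    rewrite pc lee_fin => l2.
    rewrite (big_rem k)//= -[X in X <= _]addr0 lerD ?sumr_ge0//.
    by rewrite /count pc/= (_ : true%:R = 1)//; nra.
  move=> H; apply: le_trans H _.
  have K0 : 0 <= K / m.+1%:R by rewrite -lee_fin (le_trans _ (LS 0%N)).
  apply: (@le_trans _ _ (\sum_(k <- iota 0 (2 * M * m.+1)) (K / m.+1%:R) ^+ 2)).
    apply: ler_sum => k _; rewrite lerXn2r ?nnegrE ?fine_ge0//.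
    by rewrite -lee_fin fineK ?ge0_fin_numE.
  rewrite big_const_seq count_predT size_iota iter_addr_0 -(mulr_natl _ (2 * M * m.+1)) !natrM expr2.
  rewrite le_eqVlt; apply/orP; left; apply/eqP.
  transitivity (2 * M%:R * K ^+ 2 / m.+1%:R * (m.+1%:R / m.+1%:R)).
    move: (m.+1%:R) (m.+1%:R^-1) => p q; lra.
  by rewrite mulfV ?gt_eqF// mulr1.
have : fine (P T) <= 0.
  have c0 : (fun m : nat => (2 * M%:R * K ^+ 2) / m.+1%:R) @ \oo --> (0 : R).
    rewrite -(mulr0 (2 * M%:R * K ^+ 2)); apply: cvgM; first exact: cvg_cst.
    exact: cvg_harmonic.
  apply: (ler_cvg_to (cvg_cst _) c0); exact: nearW.
move=> H; have e0 : fine (P T) = 0 by apply/le_anti; rewrite H fine_ge0.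
by rewrite -(fineK (x := P T)) ?fin_num_measure// e0.
Qed.

Lemma ae_no_ties :
  {ae P, forall om, forall i j, (Z i om).2 = (Z j om).2 -> i = j}.
Proof.
have H : {ae P, forall om, forall i j M : nat, i != j -> (Z i om).2 = (Z j om).2 ->
    - M%:R <= (Z i om).2 -> (Z i om).2 < M%:R -> False}.
  apply: ae_foralln => i; apply: ae_foralln => j; apply: ae_foralln => M.
  have [->|ij] := eqVneq i j; first by apply: aeW.
  by apply: filterS (ae_tie_bounded M ij) => om H _; exact: H.
apply: filterS H => om H i j e; apply/eqP/negPn/negP => ij.
pose M := (Num.truncn `|(Z i om).2|).+1.
have : `|(Z i om).2| < M%:R by rewrite /M truncnS_gt.
by rewrite ltr_norml => /andP[h1 h2]; apply: (H i j M ij e) => //; exact: ltW.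
Qed.

End Ties.

(** * Finite index sets and integrals of bounded functions *)

Section NearFinite.

Lemma finite_nat_bounded (J : set nat) : finite_set J ->
  exists N, forall j, J j -> (j < N)%N.
Proof.
move=> fJ; exists (\max_(j <- fset_set J) j).+1 => j Jj; rewrite ltnS.
have jJ : j \in enum_fset (fset_set J) by rewrite in_fset_set// mem_set.
exact: (leq_bigmax_seq (F := fun i => i) j jJ).
Qed.

Lemma near_all_lt (p : nat -> nat -> Prop) (N : nat) :
  (forall j, \forall m \near \oo, p j m) ->
  \forall m \near \oo, forall j, (j < N)%N -> p j m.
Proof.
move=> H; elim: N => [|N IH]; first exact: nearW.
apply: filterS2 IH (H N) => m IH HN j; rewrite ltnS leq_eqVlt => /orP[/eqP ->//|].
exact: IH.
Qed.

Lemma near_natr_mul_ge {R : realType} (a : R) : 0 < a ->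
  \forall m \near \oo, 1 <= m.+1%:R * a.
Proof.
move=> a0; have : \forall m \near \oo, `|0 - m.+1%:R^-1| < a.
  by apply: cvgr_dist_lt => //; exact: cvg_harmonic.
apply: filterS => m; rewrite sub0r normrN gtr0_norm ?invr_gt0// => H.
have m0 : (0 : R) < m.+1%:R by rewrite ltr0n.
by rewrite -ler_pdivrMl// mulr1 ltW.
Qed.

End NearFinite.

Section BoundedRintegral.
Context d (T : measurableType d) (R : realType) (mu : {measure set T -> \bar R}).
Variables (D : set T) (mD : measurable D).
Hypothesis muD : (mu D < +oo)%E.

Lemma bounded_integrable (f : T -> R) C : measurable_fun D f ->
  (forall z, D z -> `|f z| <= C) -> mu.-integrable D (EFin \o f).
Proof.
move=> mf fC; apply: measurable_bounded_integrable => //.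
by exists C; split; [exact: num_real|move=> y Cy z Dz; exact: le_trans (fC z Dz) (ltW Cy)].
Qed.

Lemma cst_integrable C : mu.-integrable D (EFin \o cst C).
Proof. by apply: (@bounded_integrable _ `|C|). Qed.

Lemma norm_Rintegral_le (f : T -> R) C : measurable_fun D f ->
  (forall z, D z -> `|f z| <= C) ->
  `|\int[mu]_(z in D) f z| <= C * fine (mu D).
Proof.
move=> mf fC; have if_ := bounded_integrable mf fC.
apply: le_trans (le_normr_Rintegral mD if_) _.
rewrite -Rintegral_cst//; apply: le_Rintegral => //.
- exact: integrable_norm.
- exact: cst_integrable.
Qed.

Lemma Rintegral_dominated (f_ : nat -> T -> R) (f : T -> R) C :
  (forall n, measurable_fun D (f_ n)) -> measurable_fun D f ->
  (forall z, D z -> (fun n => f_ n z) @ \oo --> f z) ->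
  (forall n z, D z -> `|f_ n z| <= C) ->
  (fun n => \int[mu]_(z in D) f_ n z) @ \oo --> \int[mu]_(z in D) f z.
Proof.
move=> mf_ mf cf fC.
have [| | | | |if_ _ cI] := @dominated_convergence _ T R mu D mD
  (fun n z => (f_ n z)%:E) (fun z => (f z)%:E) (cst C%:E).
- by move=> n; exact/measurable_EFinP.
- exact/measurable_EFinP.
- by apply: aeW => z Dz; apply: cvg_EFin; [exact: nearW|exact: cf].
- exact: cst_integrable.
- by apply: aeW => z n Dz; rewrite lee_fin fC.
suff /fine_cvgP[_] : (fun n => \int[mu]_(z in D) (f_ n z)%:E)%E @ \oo -->
  (fine (\int[mu]_(z in D) (f z)%:E))%:E by [].
by rewrite fineK// integrable_fin_num.
Qed.

End BoundedRintegral.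

(** * The region on or under the staircase *)

Section Corner.
Context {R : realType} {d : measure_display} {Omega : measurableType d}.
Variable Z : nat -> Omega -> R * R.
Hypothesis mZ : forall j, measurable_fun setT (Z j).

Definition below (z : R * R) : set (R * R) := [set z' | z.1 <= z'.1 /\ z'.2 < z.2].

(** For a regular configuration and [z.1 < 1] this indicates [z.2 <= g_hat Z om z.1] ([cornerE]).
    Written as a void event it needs no minimum to exist, and it visibly depends only on points
    strictly lower than [z]. *)
Definition corner om (z : R * R) : R := \1_(void Z (below z)) om.

Lemma corner01 om z : corner om z = 0 \/ corner om z = 1.
Proof. by rewrite /corner indicE; case: (_ \in _); [right|left]. Qed.

Lemma corner_ge0 om z : 0 <= corner om z.
Proof. by case: (corner01 om z) => ->. Qed.

Lemma corner_le1 om z : corner om z <= 1.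
Proof. by case: (corner01 om z) => ->. Qed.

Lemma corner_sq om z : corner om z ^+ 2 = corner om z.
Proof. by case: (corner01 om z) => ->; rewrite ?expr0n ?expr1n. Qed.

Lemma measurable_corner :
  measurable_fun setT (fun p : Omega * (R * R) => corner p.1 p.2).
Proof.
pose b j (p : Omega * (R * R)) : bool :=
  (p.2.1 <= (Z j p.1).1) && ((Z j p.1).2 < p.2.2).
have mb j : measurable_fun setT (b j).
  apply: measurable_and.
    apply: measurable_fun_ler; first exact: (measurableT_comp measurable_fst measurable_snd).
    exact: (measurableT_comp measurable_fst (measurableT_comp (mZ j) measurable_fst)).
  apply: measurable_fun_ltr; last exact: (measurableT_comp measurable_snd measurable_snd).
  exact: (measurableT_comp measurable_snd (measurableT_comp (mZ j) measurable_fst)).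
rewrite (_ : (fun _ => _) = \1_(\bigcap_j [set p | ~~ b j p])).
  apply/measurable_indicP; apply: bigcapT_measurable => j.
  rewrite (_ : [set _ | _] = b j @^-1` [set false]); last first.
    by apply/seteqP; split => p /= => [/negbTE|->].
  by rewrite -[X in measurable X]setTI; apply: mb.
apply/funext => p; rewrite /corner !indicE; congr (_%:R); congr nat_of_bool.
apply/idP/idP => /set_mem H; apply/mem_set.
  by move=> j _ /=; apply/negP => /andP[h1 h2]; exact: (H j).
by move=> j [h1 h2]; have /negP := H j Logic.I; apply; rewrite /b h1.
Qed.

Lemma measurable_cornerr om : measurable_fun setT (corner om).
Proof. exact: (measurableT_comp measurable_corner (pair1_measurable om)). Qed.

Lemma measurable_cornerl z : measurable_fun setT (corner ^~ z).
Proof. exact: (measurableT_comp measurable_corner (pair2_measurable z)). Qed.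

End Corner.

Section Box.
Context {R : realType}.

Definition box (M : nat) : set (R * R) :=
  [set z | 0 <= z.1 <= 1 /\ - M%:R <= z.2 < M%:R].

Lemma measurable_box M : measurable (box M).
Proof.
rewrite (_ : box M = `[0, 1]%classic `*` `[- M%:R, M%:R[%classic).
  by apply: measurableX.
by apply/seteqP; split => z; rewrite /box/= !in_itv.
Qed.

End Box.

(** * The isometry over a box, by refinement of grids *)

Section BoxIsometry.
Context {R : realType} {d : measure_display} {Omega : measurableType d}.
Variables (P : probability Omega R) (Z : nat -> Omega -> R * R).
Variable Lambda : {measure set (R * R) -> \bar R}.
Hypothesis ppp : poisson_point_process P Z Lambda.
Variable M : nat.
Local Notation G := (box M : set (R * R)).
Hypothesis LG : (Lambda G < +oo)%E.
Hypothesis aeG : {ae P, forall om, forall j,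
  0 <= (Z j om).1 <= 1 /\ - M%:R <= (Z j om).2}.
Variables (phi : R * R -> R) (c : R).
Hypothesis mphi : measurable_fun setT phi.
Hypothesis phic : forall z, `|phi z| <= c.

Let c0 : 0 <= c. Proof. exact: le_trans (phic (0, 0)). Qed.

Let p (m : nat) : R := m.+1%:R.
Let p0 m : 0 < p m. Proof. by rewrite /p ltr0n. Qed.

(** A cell is given by its column, its row and the level of [phi] on it. Slicing by the values of
    [phi] makes the integrand nearly constant on each cell although it is merely measurable. *)
Let I (m : nat) : finType :=
  ('I_(m.+2) * 'I_(2 * M * m.+1).+1 * 'I_((Num.truncn (p m * (2 * c))).+1))%type.

Let Q m (i : I m) : set (R * R) := [set z | [/\ G z,
  (i.1.1 : nat)%:R <= p m * z.1 < (i.1.1 : nat).+1%:R,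
  (i.1.2 : nat)%:R <= p m * (z.2 + M%:R) < (i.1.2 : nat).+1%:R &
  (i.2 : nat)%:R <= p m * (phi z + c) < (i.2 : nat).+1%:R]].

(** The discrete form of [below]: a cell kills those in its own or earlier columns and in strictly
    higher rows, whatever their levels. The strict comparison of rows makes the relation
    asymmetric. *)
Let kills m : rel (I m) := fun j i => (i.1.1 <= j.1.1)%N && (j.1.2 < i.1.2)%N.

Let coef m (i : I m) : R := (i.2 : nat)%:R / p m - c.

Let mQ m (i : I m) : measurable (Q i).
Proof.
pose f1 (z : R * R) := p m * z.1; pose f2 (z : R * R) := p m * (z.2 + M%:R).
pose f3 z := p m * (phi z + c).
have m1 : measurable_fun setT f1 by apply: measurable_funM => //; exact: measurable_fst.
have m2 : measurable_fun setT f2.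
  by apply: measurable_funM => //; apply: measurable_funD => //; exact: measurable_snd.
have m3 : measurable_fun setT f3.
  by apply: measurable_funM => //; apply: measurable_funD.
have H (f : R * R -> R) (k : nat) : measurable_fun setT f ->
    measurable (f @^-1` `[k%:R, k.+1%:R[%classic).
  by move=> mf; rewrite -[X in measurable X]setTI; apply: mf.
rewrite (_ : Q i = G `&` (f1 @^-1` `[(i.1.1 : nat)%:R, (i.1.1 : nat).+1%:R[%classic) `&`
  (f2 @^-1` `[(i.1.2 : nat)%:R, (i.1.2 : nat).+1%:R[%classic) `&`
  (f3 @^-1` `[(i.2 : nat)%:R, (i.2 : nat).+1%:R[%classic)).
  by do 3 (apply: measurableI; last exact: H); exact: measurable_box.
apply/seteqP; split => z; rewrite /Q/= !in_itv/=.
  by move=> [h1 h2 h3 h4]; do 3 (split => //).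
by move=> [[[? ?] ?] ?]; split.
Qed.

Let nat_uniq (k l : nat) (x : R) : k%:R <= x < k.+1%:R -> l%:R <= x < l.+1%:R -> k = l.
Proof.
move=> /andP[h1 h2] /andP[h3 h4]; apply/eqP; rewrite eqn_leq.
rewrite -[(k <= l)%N]ltnS -[(l <= k)%N]ltnS -!(ltr_nat R).
by rewrite (le_lt_trans h1 h4) (le_lt_trans h3 h2).
Qed.

Let Q_uniq m (i j : I m) z : Q i z -> Q j z -> i = j.
Proof.
case: i => [[i1 i2] i3]; case: j => [[j1 j2] j3] [_ /= h1 h2 h3] [_ /= k1 k2 k3].
by rewrite (ord_inj (nat_uniq h1 k1)) (ord_inj (nat_uniq h2 k2)) (ord_inj (nat_uniq h3 k3)).
Qed.

Let tQ m (i j : I m) : i != j -> Q i `&` Q j = set0.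
Proof.
move=> ij; apply/seteqP; split => // z [Qi Qj].
by move: ij; rewrite (Q_uniq Qi Qj) eqxx.
Qed.

Let Q_ex m z : G z -> exists i : I m, Q i z.
Proof.
move=> [/andP[x0 x1] /andP[y0 y1]]; have := phic z; rewrite ler_norml => /andP[f0 f1].
have T (x : R) : 0 <= x -> (Num.truncn x)%:R <= x < (Num.truncn x).+1%:R by move=> x0'; rewrite truncn_itv.
have a0 : 0 <= p m * z.1 by rewrite mulr_ge0// ltW.
have b0 : 0 <= p m * (z.2 + M%:R) by rewrite pmulr_rge0//; lra.
have d0 : 0 <= p m * (phi z + c) by rewrite pmulr_rge0//; lra.
have ha : (Num.truncn (p m * z.1) < m.+2)%N.
  rewrite -(ltr_nat R) (le_lt_trans (andP (T _ a0)).1)// -(natr1 m.+1) -/(p m).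
  by have := p0 m; nra.
have hb : (Num.truncn (p m * (z.2 + M%:R)) < (2 * M * m.+1).+1)%N.
  rewrite -(ltr_nat R) (le_lt_trans (andP (T _ b0)).1)// -(natr1 (2 * M * m.+1)) !natrM -/(p m).
  by have := p0 m; nra.
have hd : (Num.truncn (p m * (phi z + c)) < (Num.truncn (p m * (2 * c))).+1)%N.
  by rewrite ltnS le_truncn// ler_pM2l//; lra.
by exists ((Ordinal ha, Ordinal hb), Ordinal hd); split => //=; try exact: T; split; apply/andP.
Qed.

Let LQ m (i : I m) : (Lambda (Q i) < +oo)%E.
Proof.
apply: le_lt_trans LG; apply: le_measure; [by apply/mem_set; exact: mQ| |by move=> z []].
by apply/mem_set; exact: measurable_box.
Qed.

Let kills_asym m (i j : I m) : kills i j -> ~~ kills j i.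
Proof.
by rewrite /kills => /andP[_ h]; rewrite negb_and -leqNgt (ltnW h) orbT.
Qed.

Let V m (i : I m) om : R := \1_(void Z (killers (@Q m) (@kills m) i)) om.

Let F m om z : R := \sum_(i : I m) coef i * V i om * \1_(Q i) z.

Let F_cell m om (i : I m) z : Q i z -> F m om z = coef i * V i om.
Proof.
move=> Qi; rewrite /F (bigD1 i)//= big1 ?addr0; first by rewrite indicE mem_set// mulr1.
move=> j ji; rewrite indicE memNset ?mulr0// => Qj.
by move: ji; rewrite (Q_uniq Qj Qi) eqxx.
Qed.

Let cell_scale (q x : R) (v : nat) : 0 < q -> v%:R <= q * x -> q * x < v.+1%:R ->
  v%:R / q <= x /\ x < v%:R / q + q^-1.
Proof.
move=> q0 h1 h2; rewrite ler_pdivrMr// mulrC h1; split => //.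
by rewrite -[X in _ + X]mul1r -mulrDl ltr_pdivlMr// mulrC natr1.
Qed.

Let coef_near m (i : I m) z : Q i z -> `|phi z - coef i| <= (p m)^-1.
Proof.
move=> [_ _ _ /andP[h1 h2]].
have [k1 k2] := cell_scale (p0 m) h1 h2.
have ip0 : 0 < (p m)^-1 by rewrite invr_gt0.
rewrite /coef ler_norml; move: ((i.2 : nat)%:R / p m) k1 k2 => v.
by move: (p m)^-1 ip0 => q ip0 k1 k2; apply/andP; split; lra.
Qed.

Let invp1 m : (p m)^-1 <= 1.
Proof. by rewrite invf_le1// /p ler1n. Qed.

Let coef_le m (i : I m) z : Q i z -> `|coef i| <= c + 1.
Proof.
move=> Qi; have := coef_near Qi; have := invp1 m; have := phic z.
rewrite !ler_norml; move: (coef i) (p m)^-1 (phi z) => x y t.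
by move=> /andP[? ?] ? /andP[? ?]; apply/andP; split; lra.
Qed.

Let V01 m (i : I m) om : V i om = 0 \/ V i om = 1.
Proof. by rewrite /V indicE; case: (_ \in _); [right|left]. Qed.

Let F_le m om z : G z -> `|F m om z| <= c + 1.
Proof.
move=> /(Q_ex m)[i Qi]; rewrite (F_cell om Qi).
by case: (V01 i om) => ->; rewrite ?mulr1 ?mulr0 ?normr0 ?(coef_le Qi)//; have := c0; lra.
Qed.

Let mF m om : measurable_fun setT (F m om).
Proof.
by apply: measurable_sum => i; apply: measurable_funM.
Qed.

Let killersE m (i : I m) z : killers (@Q m) (@kills m) i z <->
  [/\ G z, (i.1.1 : nat)%:R <= p m * z.1 & p m * (z.2 + M%:R) < (i.1.2 : nat)%:R].
Proof.
split=> [[j /= /andP[k1 k2] [Gz /andP[h1 h2] /andP[h3 h4] _]]|[Gz h1 h2]].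
  split => //; first by rewrite (le_trans _ h1)// ler_nat.
  by rewrite (lt_le_trans h4)// ler_nat.
have [j Qj] := Q_ex m Gz; exists j => //=; case: Qj => _ /andP[_ k1] /andP[k2 _] _.
rewrite /kills -ltnS -!(ltr_nat R) (le_lt_trans h1 k1)/=.
exact: le_lt_trans k2 h2.
Qed.

Definition good_box om : Prop :=
  (forall j, 0 <= (Z j om).1 <= 1 /\ - M%:R <= (Z j om).2) /\
  (point_count Z G om < +oo)%E.

Lemma ae_good_box : {ae P, forall om, good_box om}.
Proof.
apply: filterS2 aeG (point_count_lty ppp (measurable_box M) LG) => om h1 h2.
by split.
Qed.

(** Only finitely many points lie in the box. Once the mesh is smaller than their positive distances
    to [z], no point strictly below [z] shares its row and no point strictly to the left shares its
    column, so the discrete and the exact void events coincide. *)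
Let V_corner om z : good_box om -> G z ->
  \forall m \near \oo, forall i : I m, Q i z -> V i om = corner Z om z.
Proof.
move=> [inB fin] Gz.
have [N HN] := finite_nat_bounded (point_count_finite fin).
have : \forall m \near \oo, forall j, (j < N)%N ->
    ((Z j om).2 < z.2 -> 1 <= p m * (z.2 - (Z j om).2)) /\
    ((Z j om).1 < z.1 -> 1 <= p m * (z.1 - (Z j om).1)).
  apply: near_all_lt => j.
  have near_imp (a : R) (b : bool) : (b -> 0 < a) -> \forall m \near \oo, b -> 1 <= p m * a.
    case: b => [/(_ isT)/near_natr_mul_ge|_]; last exact: nearW.
    by apply: filterS.
  apply: filterS2 (near_imp (z.2 - (Z j om).2) ((Z j om).2 < z.2) _)
    (near_imp (z.1 - (Z j om).1) ((Z j om).1 < z.1) _) => [m h1 h2|h|h].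
  - by split.
  - by rewrite subr_gt0.
  - by rewrite subr_gt0.
apply: filterS => m H i [_ /andP[a1 a2] /andP[b1 b2] _].
rewrite /V /corner !indicE; congr (_%:R); congr nat_of_bool.
have GZ j : (Z j om).2 < z.2 -> G (Z j om).
  move=> h; have [hx hy] := inB j; split => //; rewrite hy/=.
  by case: Gz => _ /andP[_]; exact: lt_trans.
have pm := p0 m.
apply/idP/idP => /set_mem vd; apply/mem_set => j.
  move=> [h1 h2]; apply: (vd j); apply/killersE.
  have Gj := GZ j h2; have [h3 _] := H j (HN j Gj).
  split => //; first by rewrite (le_trans a1)// ler_pM2l.
  have := h3 h2; rewrite -natr1 in b2; nra.
move=> /killersE[Gj h1 h2]; apply: (vd j).
have [_ h3] := H j (HN j Gj).
split; last by rewrite -(ltrD2r M%:R) -(ltr_pM2l pm); exact: lt_le_trans h2 b1.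
rewrite leNgt; apply/negP => /h3 h4; move: a2 h4 h1; rewrite -natr1 mulrBr.
by move: (p m * z.1) (p m * (Z j om).1) (_%:R) => x y t; clear fin; lra.
Qed.

Let F_cvg om z : good_box om -> G z ->
  (fun m => F m om z) @ \oo --> phi z * corner Z om z.
Proof.
move=> gom Gz; apply/cvgrPdist_le => e e0.
have near_e : \forall m \near \oo, `|0 - (p m)^-1| < e.
  by apply: cvgr_dist_lt => //; exact: cvg_harmonic.
apply: filterS2 near_e (V_corner gom Gz) => m; rewrite sub0r normrN gtr0_norm ?invr_gt0// => pe HV.
have [i Qi] := Q_ex m Gz; rewrite (F_cell om Qi) (HV i Qi) -mulrBl normrM.
rewrite (ger0_norm (corner_ge0 _ _ _)).
apply: le_trans (ltW pe); apply: le_trans (coef_near Qi).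
by rewrite ler_piMr// corner_le1.
Qed.

Let mG := @measurable_box R M.

Let meas := {measure set (R * R) -> \bar R}.

(** Stated for any measure finite on the box because it serves twice: for the intensity and for the
    random point measure. *)
Let F_integral (nu : meas) (nuG : (nu G < +oo)%E) m (f : I m -> R) (h : R * R -> R) : measurable_fun setT h ->
  (forall (i : I m) z, Q i z -> h z = f i) ->
  \int[nu]_(z in G) h z = \sum_(i : I m) f i * fine (nu (Q i)).
Proof.
move=> mh hE.
have nuQ (i : I m) : (nu (Q i) < +oo)%E.
  apply: le_lt_trans nuG; apply: le_measure; [by apply/mem_set; exact: mQ| |by move=> z []].
  by apply/mem_set; exact: measurable_box.
rewrite /Rintegral (eq_integral (fun z => \sum_(i : I m) (f i)%:E * (\1_(Q i) z)%:E)%E); last first.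
  move=> z /set_mem Gz; have [i Qi] := Q_ex m Gz.
  rewrite (bigD1 i)//= big1 ?adde0; first by rewrite indicE mem_set// mule1 (hE _ _ Qi).
  move=> j ji; rewrite indicE memNset ?mule0// => Qj.
  by move: ji; rewrite (Q_uniq Qj Qi) eqxx.
have int1 (i : I m) : nu.-integrable G (fun z => (\1_(Q i) z)%:E).
  apply: (bounded_integrable mG nuG (C := 1)); first by apply: measurable_funTS; exact/measurable_indicP.
  by move=> z _; rewrite indicE; case: (_ \in _); rewrite ?normr1 ?normr0.
rewrite (integral_sum mG); last first.
  by move=> i; apply: integrableZl => //; exact: int1.
transitivity (fine (\sum_(i : I m) (f i * fine (nu (Q i)))%:E)%E); last by rewrite sumEFin.
congr fine; apply: eq_bigr => i _.
rewrite (integralZl mG (int1 i)) (integral_indic _ mG (mQ i)).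
have -> : Q i `&` G = Q i by apply/seteqP; split => [z []//|z Qz]; split => //; case: Qz.
by rewrite EFinM fineK// ge0_fin_numE// nuQ.
Qed.


Let F_integralE (nu : meas) (nuG : (nu G < +oo)%E) m om : \int[nu]_(z in G) F m om z =
  \sum_(i : I m) coef i * V i om * fine (nu (Q i)).
Proof. by apply: F_integral => // i z; exact: F_cell. Qed.

Let F_sq_integralE (nu : meas) (nuG : (nu G < +oo)%E) m om : \int[nu]_(z in G) (F m om z) ^+ 2 =
  \sum_(i : I m) coef i ^+ 2 * V i om * fine (nu (Q i)).
Proof.
apply: (F_integral nuG (f := fun i => coef i ^+ 2 * V i om)) => [|i z Qi].
  by apply: measurable_funX; exact: mF.
by rewrite (F_cell om Qi) exprMn; case: (V01 i om) => ->; rewrite ?expr0n ?expr1n.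
Qed.

Let F_integral_le (nu : meas) (nuG : (nu G < +oo)%E) m om : `|\int[nu]_(z in G) F m om z| <= (c + 1) * fine (nu G).
Proof.
apply: norm_Rintegral_le => //; first by apply: measurable_funTS; exact: mF.
by move=> z Gz; exact: F_le.
Qed.

Let mphicorner om : measurable_fun G (fun z => phi z * corner Z om z).
Proof.
apply: measurable_funTS; apply: measurable_funM => //.
exact: (measurable_cornerr (ppp_measurable ppp)).
Qed.

Let F_integral_cvg (nu : meas) (nuG : (nu G < +oo)%E) om : good_box om ->
  (fun m => \int[nu]_(z in G) F m om z) @ \oo -->
  \int[nu]_(z in G) (phi z * corner Z om z).
Proof.
move=> gom; apply: (Rintegral_dominated mG nuG (C := c + 1)) => //.
- by move=> m; apply: measurable_funTS; exact: mF.
- by move=> z Gz; exact: F_cvg.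
- by move=> m z Gz; exact: F_le.
Qed.

Let F_sq_integral_cvg (nu : meas) (nuG : (nu G < +oo)%E) om : good_box om ->
  (fun m => \int[nu]_(z in G) (F m om z) ^+ 2) @ \oo -->
  \int[nu]_(z in G) (phi z ^+ 2 * corner Z om z).
Proof.
move=> gom; rewrite (_ : (fun z => _) = (fun z => (phi z * corner Z om z) ^+ 2)); last first.
  by apply/funext => z; rewrite exprMn corner_sq.
apply: (Rintegral_dominated mG nuG (C := (c + 1) ^+ 2)) => //.
- by move=> m; apply: measurable_funX; apply: measurable_funTS; exact: mF.
- by apply: measurable_funX.
- move=> z Gz; rewrite expr2; under eq_fun do rewrite expr2.
  by apply: cvgM; exact: F_cvg.
- move=> m z Gz; rewrite normrX lerXn2r ?nnegrE//; last exact: F_le.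
  by have := c0; lra.
Qed.

Let D m om : R := \sum_(i : I m) coef i *
  (V i om * (count Z (Q i) om - fine (Lambda (Q i)))).

Let innov om : R := \int[point_measure Z om]_(z in G) (phi z * corner Z om z) -
  \int[Lambda]_(z in G) (phi z * corner Z om z).

Let good_lty om : good_box om -> (point_measure Z om G < +oo)%E.
Proof. by move=> [_]; rewrite point_countE. Qed.

Let DE m om : good_box om ->
  D m om = \int[point_measure Z om]_(z in G) F m om z - \int[Lambda]_(z in G) F m om z.
Proof.
move=> gom; rewrite !F_integralE//; last exact: good_lty.
rewrite /D -sumrB; apply: eq_bigr => i _.
by rewrite mulrBr mulrBr !mulrA /count point_countE.
Qed.

Let D_cvg om : good_box om -> (fun m => D m om) @ \oo --> innov om.
Proof.
move=> gom; under eq_fun do rewrite DE//.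
by apply: cvgB; apply: F_integral_cvg => //; exact: good_lty.
Qed.

Let H om : R := (c + 1) * (count Z G om + fine (Lambda G)).

Let D_le m om : good_box om -> `|D m om| <= H om.
Proof.
move=> gom; rewrite DE// /H mulrDr (le_trans (ler_normB _ _))// lerD//.
  by rewrite /count point_countE; apply: F_integral_le; exact: good_lty.
exact: F_integral_le.
Qed.

Let void0 : void Z set0 = setT.
Proof. by apply/seteqP; split => // om _ l. Qed.

Let count_mean : has_mean P (count Z G) (fine (Lambda G)).
Proof.
have := void_count_mean ppp mG measurable0 (setI0 _) LG.
rewrite void0 probability_setT/= mulr1; apply: eq_has_mean => om.
by rewrite indicT mulr1.
Qed.

Let count_sq_mean : has_mean P (fun om => count Z G om ^+ 2)
  (fine (Lambda G) ^+ 2 + fine (Lambda G)).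
Proof.
have := void_count_sq_mean ppp mG measurable0 (setI0 _) LG.
rewrite void0 probability_setT/= mulr1; apply: eq_has_mean => om.
by rewrite indicT mulr1.
Qed.

Let one_mean : has_mean P (fun=> 1) 1.
Proof.
have := void_has_mean ppp measurable0.
by rewrite void0 probability_setT/=; apply: eq_has_mean => om; rewrite indicT.
Qed.

Let H_mean : exists h, has_mean P H h.
Proof.
have := has_meanZ (c + 1) (has_meanD count_mean (has_meanZ (fine (Lambda G)) one_mean)).
move=> h; eexists; apply: eq_has_mean h => om; rewrite /H mulr1//.
Qed.

Let Hsq_mean : exists h, has_mean P (fun om => H om ^+ 2) h.
Proof.
have h := has_meanZ ((c + 1) ^+ 2) (has_meanD (has_meanD count_sq_mean
  (has_meanZ (2 * fine (Lambda G)) count_mean)) (has_meanZ (fine (Lambda G) ^+ 2) one_mean)).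
eexists; apply: eq_has_mean h => om; rewrite /H; move: (count _ _ _) (fine _) => x y.
lra.
Qed.

Let Dsum m om : \sum_(i : I m) coef i ^+ 2 * V i om * fine (Lambda (Q i)) =
  \int[Lambda]_(z in G) (F m om z) ^+ 2.
Proof. by rewrite F_sq_integralE. Qed.

(** Under refinement the compensated grid sums [D m] converge to [innov], dominated by the square
    integrable variable [H], and the integrals of the squared step functions converge boundedly. The
    grid identities for mean and second moment survive both limits. *)
Lemma box_isometry : has_mean P innov 0 /\
  exists2 s, has_mean P (fun om => \int[Lambda]_(z in G) (phi z ^+ 2 * corner Z om z)) s &
    has_mean P (fun om => innov om ^+ 2) s.
Proof.
have ae_cvg : {ae P, forall om, (fun m => D m om) @ \oo --> innov om}.
  by apply: filterS ae_good_box; exact: D_cvg.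
have [h hH] := H_mean; have [h2 hH2] := Hsq_mean.
split.
  have [m0 hm0] : exists2 m0, has_mean P innov m0 & (fun _ : nat => 0 : R) @ \oo --> m0.
    apply: has_mean_dominated ae_cvg hH _.
      by move=> m; apply: (grid_mean ppp); [exact: mQ|exact: tQ|exact: LQ|exact: kills_asym].
    by apply: filterS ae_good_box => om gom m; exact: D_le.
  move=> c00; have -> // : 0 = m0 by exact: (cvg_unique _ (cvg_cst 0) c00).
(* The same numbers are the second moments of [D m] and the means of the discrete compensators, so
   the two limits obtained below coincide. *)
pose s m := \sum_(i : I m) coef i ^+ 2 *
  (fine (Lambda (Q i)) * fine (P (void Z (killers (@Q m) (@kills m) i)))).
have [s0 hs0 cs0] : exists2 s0, has_mean P (fun om => innov om ^+ 2) s0 & s @ \oo --> s0.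
  apply: (@has_mean_dominated _ _ _ _ (fun m om => D m om ^+ 2) _ _ _ _ _ _ hH2).
  - by move=> m; apply: (grid_isometry ppp); [exact: mQ|exact: tQ|exact: LQ|exact: kills_asym].
  - apply: filterS ae_cvg => om co; rewrite expr2; under eq_fun do rewrite expr2.
    exact: cvgM.
  - apply: filterS ae_good_box => om gom m; rewrite normrX lerXn2r ?nnegrE//; last exact: D_le.
    by apply: le_trans (D_le m gom).
have [s1 hs1 cs1] : exists2 s1, has_mean P
    (fun om => \int[Lambda]_(z in G) (phi z ^+ 2 * corner Z om z)) s1 & s @ \oo --> s1.
  apply: (@has_mean_dominated _ _ _ _ (fun m om => \int[Lambda]_(z in G) (F m om z) ^+ 2)
    _ (fun=> (c + 1) ^+ 2 * fine (Lambda G) * 1) _ _ _ _ (has_meanZ _ one_mean)).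
  - move=> m; apply: (eq_has_mean (Dsum m)).
    apply: (@has_mean_sum _ _ _ P _ _ (fun i om => coef i ^+ 2 * V i om * fine (Lambda (Q i)))) => i.
    apply: eq_has_mean (has_meanZ (coef i ^+ 2) (has_meanZ (fine (Lambda (Q i)))
      (void_has_mean ppp (measurable_killers (@kills m) (@mQ m) i)))) => om.
    by rewrite /V mulrA mulrAC.
  - by apply: filterS ae_good_box => om gom; exact: F_sq_integral_cvg.
  - apply: aeW => om m; rewrite mulr1; apply: norm_Rintegral_le => //.
      by apply: measurable_funX; apply: measurable_funTS; exact: mF.
    move=> z Gz; rewrite normrX lerXn2r ?nnegrE//; last exact: F_le.
    by have := c0; lra.
by exists s0 => //; have -> : s0 = s1 by exact: (cvg_unique _ cs0 cs1).
Qed.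

End BoxIsometry.

(** * The isometry for unbounded integrands, by truncation *)

Section RintegralLimits.
Context d (T : measurableType d) (R : realType) (mu : {measure set T -> \bar R}).

Lemma Rintegral_dominated_integrable (f_ : nat -> T -> R) (f h : T -> R) :
  (forall n, measurable_fun setT (f_ n)) -> measurable_fun setT f ->
  (forall z, (fun n => f_ n z) @ \oo --> f z) ->
  mu.-integrable setT (EFin \o h) ->
  (forall n z, `|f_ n z| <= h z) ->
  (fun n => \int[mu]_z f_ n z) @ \oo --> \int[mu]_z f z.
Proof.
move=> mf_ mf cf ih fC.
have [| | | | |if_ _ cI] := @dominated_convergence _ T R mu setT measurableT
  (fun n z => (f_ n z)%:E) (fun z => (f z)%:E) (EFin \o h).
- by move=> n; exact/measurable_EFinP.
- exact/measurable_EFinP.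
- by apply: aeW => z Dz; apply: cvg_EFin; [exact: nearW|exact: cf].
- exact: ih.
- by apply: aeW => z n Dz; rewrite lee_fin fC.
suff /fine_cvgP[_] : (fun n => \int[mu]_z (f_ n z)%:E)%E @ \oo -->
  (fine (\int[mu]_z (f z)%:E))%:E by [].
by rewrite fineK// integrable_fin_num.
Qed.

Lemma Rintegral_support (D : set T) (h : T -> R) :
  (forall z, ~ D z -> h z = 0) -> \int[mu]_(z in D) h z = \int[mu]_z h z.
Proof.
move=> h0; rewrite Rintegral_mkcond; congr (Rintegral _ _ _).
by apply/funext => z; rewrite patchE; case: ifPn => // /negP; rewrite inE => /h0 ->.
Qed.

Lemma integrable_support (D : set T) (h : T -> R) C : measurable D ->
  (mu D < +oo)%E -> measurable_fun setT h ->
  (forall z, ~ D z -> h z = 0) -> (forall z, `|h z| <= C) ->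
  mu.-integrable setT (EFin \o h).
Proof.
move=> mD muD mh h0 hC.
rewrite (_ : EFin \o h = (EFin \o h) \_ D); last first.
  by apply/funext => z; rewrite patchE; case: ifPn => // /negP; rewrite inE => /h0 /= ->.
apply/(integrable_mkcond _ mD); apply: bounded_integrable => //.
exact: measurable_funTS.
Qed.

End RintegralLimits.

Section Isometry.
Context {R : realType} {d : measure_display} {Omega : measurableType d}.
Variables (P : probability Omega R) (Z : nat -> Omega -> R * R).
Variable Lambda : {measure set (R * R) -> \bar R}.
Hypothesis ppp : poisson_point_process P Z Lambda.
Hypothesis LG : forall M, (Lambda (box M) < +oo)%E.
Variable M0 : nat.
Hypothesis aeG : {ae P, forall om, forall j,
  0 <= (Z j om).1 <= 1 /\ - M0%:R <= (Z j om).2}.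

(** The integral of [phi] over the region on or under the staircase against the compensated point
    process, the analogue of a stochastic integral with integrand [phi * corner]. *)
Definition innovation (phi : R * R -> R) om : R :=
  \int[point_measure Z om]_z (phi z * corner Z om z) -
  \int[Lambda]_z (phi z * corner Z om z).

Lemma innovation_bounded (phi : R * R -> R) c M : (M0 <= M)%N -> measurable_fun setT phi ->
  (forall z, `|phi z| <= c) -> (forall z, ~ box M z -> phi z = 0) ->
  has_mean P (innovation phi) 0 /\
  exists2 s, has_mean P (fun om => \int[Lambda]_z (phi z ^+ 2 * corner Z om z)) s &
    has_mean P (fun om => innovation phi om ^+ 2) s.
Proof.
move=> MM mphi phic phi0.
have aeM : {ae P, forall om, forall j, 0 <= (Z j om).1 <= 1 /\ - M%:R <= (Z j om).2}.
  apply: filterS aeG => om H j; have [h1 h2] := H j; split => //.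
  by apply: le_trans h2; rewrite lerN2 ler_nat.
have [h1 [s h2 h3]] := box_isometry ppp (LG M) aeM mphi phic.
have E om : \int[point_measure Z om]_(z in box M) (phi z * corner Z om z) -
   \int[Lambda]_(z in box M) (phi z * corner Z om z) = innovation phi om.
  by rewrite !(@Rintegral_support _ _ _ _ (box M))// => z /phi0 ->; rewrite mul0r.
split; first exact: eq_has_mean h1.
exists s; last by apply: eq_has_mean h3 => om; rewrite E.
apply: eq_has_mean h2 => om; rewrite Rintegral_support// => z /phi0 ->.
by rewrite expr0n/= mul0r.
Qed.

Variable phi : R * R -> R.
Hypothesis mphi : measurable_fun setT phi.
Hypothesis phi0 : forall z, ~ (0 <= z.1 <= 1) -> phi z = 0.
Hypothesis iN : {ae P, forall om,
  (point_measure Z om).-integrable setT (fun z => (phi z * corner Z om z)%:E)}.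
Hypothesis iL : {ae P, forall om,
  Lambda.-integrable setT (fun z => (phi z * corner Z om z)%:E)}.
Hypothesis iL2 : {ae P, forall om,
  Lambda.-integrable setT (fun z => (phi z ^+ 2 * corner Z om z)%:E)}.
Variable s : R.
Hypothesis hs : has_mean P (fun om => \int[Lambda]_z (phi z ^+ 2 * corner Z om z)) s.

Let D k : set (R * R) := box (k + M0) `&` [set z | `|phi z| <= k%:R].
Let phi_ k z : R := phi z * \1_(D k) z.

Let mD k : measurable (D k).
Proof.
apply: measurableI; first exact: measurable_box.
rewrite (_ : [set _ | _] = (fun z => `|phi z|) @^-1` `]-oo, k%:R]%classic).
  by rewrite -[X in measurable X]setTI; apply: measurableT_comp.
by apply/seteqP; split => z /=; rewrite in_itv.
Qed.

Let mphi_ k : measurable_fun setT (phi_ k).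
Proof. by apply: measurable_funM => //; exact/measurable_indicP. Qed.

Let phi_E k z : phi_ k z = phi z \/ phi_ k z = 0.
Proof. by rewrite /phi_ indicE; case: (z \in D k); rewrite ?mulr1 ?mulr0; [left|right]. Qed.

Let phi_le k z : `|phi_ k z| <= k%:R.
Proof.
rewrite /phi_ indicE; have [/set_mem[_]|_] := boolP (z \in D k); first by rewrite mulr1.
by rewrite mulr0 normr0.
Qed.

Let phi_le_phi k z : `|phi_ k z| <= `|phi z|.
Proof. by case: (phi_E k z) => ->; rewrite ?normr0. Qed.

Let phi_supp k z : ~ box (k + M0) z -> phi_ k z = 0.
Proof. by move=> h; rewrite /phi_ indicE memNset ?mulr0// => -[]. Qed.

Let D_mono k l : (k <= l)%N -> D k `<=` D l.
Proof.
move=> kl z [[h1 /andP[h2 h3]] h4]; split; last by rewrite /= (le_trans h4)// ler_nat.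
have H : ((k + M0)%:R : R) <= (l + M0)%:R by rewrite ler_nat leq_add2r.
split => //; apply/andP; split; first by rewrite (le_trans _ h2)// lerN2.
exact: lt_le_trans h3 H.
Qed.

Let phi_cvg z : \forall k \near \oo, phi_ k z = phi z.
Proof.
have [zin|/phi0 z0] := pselect (0 <= z.1 <= 1); last first.
  by apply: nearW => k; rewrite /phi_ z0 mul0r.
pose K := (Num.truncn (`|phi z| + `|z.2|)).+1.
exists K => // k /= Kk.
have : `|phi z| + `|z.2| < K%:R by rewrite /K truncnS_gt.
have : (K%:R : R) <= k%:R by rewrite ler_nat.
have := normr_ge0 (phi z); have := normr_ge0 z.2; move=> h1 h2 h3 h4.
have : (M0%:R : R) >= 0 by [].
move=> h5.
rewrite /phi_ indicE mem_set ?mulr1//; split; last by rewrite /=; lra.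
split => //; rewrite natrD.
have /andP[h7 h8] : - `|z.2| <= z.2 <= `|z.2| by rewrite -ler_norml.
apply/andP; split; lra.
Qed.

Let cvgE (a b : R * R -> R) om z : (forall x y, a x = b y -> True) ->
  (fun k => phi_ k z * corner Z om z) @ \oo --> phi z * corner Z om z.
Proof.
move=> _; apply: cvg_near_cst; apply: filterS (phi_cvg z) => k ->//.
Qed.

Let mcorner om : measurable_fun setT (corner Z om).
Proof. exact: (measurable_cornerr (ppp_measurable ppp)). Qed.

Let normM_corner (x : R) om z : `|x * corner Z om z| = `|x| * corner Z om z.
Proof. by rewrite normrM (ger0_norm (corner_ge0 _ _ _)). Qed.

Let corner_bound (x C : R) om z : `|x| <= C -> `|x * corner Z om z| <= C.
Proof.
by move=> xC; rewrite normM_corner (le_trans _ xC)// ler_piMr// corner_le1.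
Qed.

Let int_cvg (nu : {measure set (R * R) -> \bar R}) om :
  nu.-integrable setT (fun z => (phi z * corner Z om z)%:E) ->
  (fun k => \int[nu]_z (phi_ k z * corner Z om z)) @ \oo -->
  \int[nu]_z (phi z * corner Z om z).
Proof.
move=> inu; apply: (Rintegral_dominated_integrable
  (h := fun z => `|phi z * corner Z om z|)).
- by move=> k; apply: measurable_funM.
- exact: measurable_funM.
- by move=> z; exact: (@cvgE phi phi).
- exact: integrable_norm.
- by move=> k z; rewrite !normM_corner ler_wpM2r// corner_ge0.
Qed.

Let int_sq_cvg om :
  Lambda.-integrable setT (fun z => (phi z ^+ 2 * corner Z om z)%:E) ->
  (fun k => \int[Lambda]_z (phi_ k z ^+ 2 * corner Z om z)) @ \oo -->
  \int[Lambda]_z (phi z ^+ 2 * corner Z om z).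
Proof.
move=> inu; apply: (Rintegral_dominated_integrable
  (h := fun z => phi z ^+ 2 * corner Z om z)) => //.
- by move=> k; apply: measurable_funM => //; exact: measurable_funX.
- by apply: measurable_funM => //; exact: measurable_funX.
- by move=> z; apply: cvg_near_cst; apply: filterS (phi_cvg z) => k ->.
- move=> k z; rewrite normM_corner ler_wpM2r ?corner_ge0//.
  by case: (phi_E k z) => ->; rewrite ?expr0n/= ?normr0 ?ger0_norm ?sqr_ge0.
Qed.

Let Ik k om : R := \int[Lambda]_z (phi_ k z ^+ 2 * corner Z om z).

Let int_phi_sq k om :
  Lambda.-integrable setT (EFin \o (fun z => phi_ k z ^+ 2 * corner Z om z)).
Proof.
apply: (@integrable_support _ _ _ _ (box (k + M0)) _ (k%:R ^+ 2)) => //.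
- exact: measurable_box.
- by apply: measurable_funM => //; exact: measurable_funX.
- by move=> z /phi_supp ->; rewrite expr0n/= mul0r.
- by move=> z; apply: corner_bound; rewrite normrX lerXn2r ?nnegrE.
Qed.

Let int_phi (nu : {measure set (R * R) -> \bar R}) k om : (nu (box (k + M0)) < +oo)%E ->
  nu.-integrable setT (EFin \o (fun z => phi_ k z * corner Z om z)).
Proof.
move=> nuB; apply: (@integrable_support _ _ _ _ (box (k + M0)) _ k%:R) => //.
- exact: measurable_box.
- by apply: measurable_funM.
- by move=> z /phi_supp ->; rewrite mul0r.
- by move=> z; apply: corner_bound.
Qed.

(** The truncated integrands [phi_ k] are bounded and live in boxes. As the truncation sets
    increase, [(phi_ l - phi_ k)^2 <= phi^2 - phi_ k^2] for [k <= l]; so the second moment of an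
    increment of the innovations is at most [s - s_ k], which tends to 0, and [has_mean_L2_limit]
    applies. *)
Lemma innovation_isometry : has_mean P (innovation phi) 0 /\
  has_mean P (fun om => innovation phi om ^+ 2) s.
Proof.
have B k := innovation_bounded (leq_addl k M0) (@mphi_ k) (@phi_le k) (@phi_supp k).
have /choice [s_ Hs] : forall k, exists s, has_mean P (Ik k) s /\
    has_mean P (fun om => innovation (phi_ k) om ^+ 2) s.
  by move=> k; have [_ [s' ? ?]] := B k; exists s'.
have Ik_le k : {ae P, forall om, Ik k om <= \int[Lambda]_z (phi z ^+ 2 * corner Z om z)}.
  apply: filterS iL2 => om i2; rewrite /Ik; apply: le_Rintegral => //.
  move=> z _; rewrite ler_wpM2r ?corner_ge0//.
  by case: (phi_E k z) => ->; rewrite ?expr0n/= ?sqr_ge0.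
have Ik_ge0 k om : 0 <= Ik k om.
  by apply: Rintegral_ge0 => z _; rewrite mulr_ge0 ?sqr_ge0 ?corner_ge0.
have cs : s_ @ \oo --> s.
  have [m0 hm0 cm0] : exists2 m0, has_mean P
      (fun om => \int[Lambda]_z (phi z ^+ 2 * corner Z om z)) m0 & s_ @ \oo --> m0.
    apply: (has_mean_dominated (f := Ik) _ _ hs).
    + by move=> k; case: (Hs k).
    + by apply: filterS iL2 => om; exact: int_sq_cvg.
    + apply: ae_foralln => k.
      by apply: filterS (Ik_le k) => om; rewrite ger0_norm.
  by rewrite (has_mean_unique hs hm0).
have one_mean : has_mean P (fun=> 1) 1.
  by apply: ge0_has_mean => //; rewrite integral_cst// mul1e; exact: probability_setT.
have [| | |hm [s0 hs0 cs0]] := @has_mean_L2_limit _ _ _ P (innovation phi)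
  (fun k => innovation (phi_ k)) s_ (fun k => s - s_ k) 1 one_mean
  (fun k => (B k).1) (fun k => (Hs k).2).
- apply: filterS2 iN iL => om h1 h2.
  by apply: cvgB; apply: int_cvg.
- move=> k l kl.
  have md : measurable_fun setT (fun z => phi_ l z - phi_ k z) by exact: measurable_funB.
  have dle z : `|phi_ l z - phi_ k z| <= (l%:R + k%:R).
    by rewrite (le_trans (ler_normB _ _))// lerD.
  have dsupp z : ~ box (l + M0) z -> phi_ l z - phi_ k z = 0.
    move=> nz; rewrite phi_supp// phi_supp ?subrr// => -[h1 /andP[h2 h3]]; apply: nz.
    have H : ((k + M0)%:R : R) <= (l + M0)%:R by rewrite ler_nat leq_add2r.
    split => //; apply/andP; split; first by rewrite (le_trans _ h2)// lerN2.
    exact: lt_le_trans h3 H.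
  have [_ [a ha1 ha2]] := innovation_bounded (leq_addl l M0) md dle dsupp.
  exists a.
    apply: has_mean_ae ha2.
    have fin (m : nat) : {ae P, forall om, (point_measure Z om (box (m + M0)) < +oo)%E}.
      have := point_count_lty ppp (measurable_box _) (LG (m + M0)).
      by apply: filterS => om; rewrite point_countE.
    apply: filterS2 (fin k) (fin l) => om fk fl; congr (_ ^+ 2).
    have sub (nu : {measure set (R * R) -> \bar R}) :
        (nu (box (k + M0)) < +oo)%E -> (nu (box (l + M0)) < +oo)%E ->
        \int[nu]_z ((phi_ l z - phi_ k z) * corner Z om z) =
        \int[nu]_z (phi_ l z * corner Z om z) - \int[nu]_z (phi_ k z * corner Z om z).
      move=> nk nl; rewrite -RintegralB//; try exact: int_phi.
      by congr (Rintegral _ _ _); apply/funext => z; rewrite mulrBl.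
    rewrite /innovation (sub (point_measure Z om))// sub//; lra.
  apply: has_mean_le ha1 (has_meanB hs (Hs k).1).
  apply: filterS iL2 => om i2; rewrite -RintegralB//.
  apply: le_Rintegral => //.
  - apply: (@integrable_support _ _ _ _ (box (l + M0)) _ ((l%:R + k%:R) ^+ 2)) => //.
    + exact: measurable_box.
    + by apply: measurable_funM => //; exact: measurable_funX.
    + by move=> z /dsupp ->; rewrite expr0n/= mul0r.
    + by move=> z; apply: corner_bound; rewrite normrX lerXn2r ?nnegrE// addr_ge0.
  - have := integrableB measurableT i2 (int_phi_sq k om).
    by apply: eq_integrable.
  move=> z _; rewrite -mulrBl ler_wpM2r ?corner_ge0//.
  rewrite /phi_ !indicE; have [/set_mem zk|_] := boolP (z \in D k).
    by rewrite (mem_set (D_mono kl zk)) !mulr1 !subrr expr0n.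
  rewrite mulr0 subr0 expr0n/= subr0; case: (z \in D l); rewrite ?mulr1// mulr0 expr0n/=.
  exact: sqr_ge0.
- by rewrite -(subrr s); apply: cvgB => //; exact: cvg_cst.
split => //.
by rewrite (_ : s = s0) //; exact: (cvg_unique _ cs cs0).
Qed.

End Isometry.

(** * The intensity as a measure, and the masses that matter *)

Section Mrestr.
Context d (T : measurableType d) (R : realType) (mu : {measure set T -> \bar R}).
Variables (D : set T) (mD : measurable D).

Lemma ge0_integral_mrestr (f : T -> \bar R) : measurable_fun setT f ->
  (forall x, (0 <= f x)%E) ->
  (\int[mrestr mu mD]_x f x = \int[mu]_(x in D) f x)%E.
Proof.
move=> mf f0; rewrite (@ge0_negligible_integral _ _ _ _ setT (~` D))//.
- rewrite setTD setCK; apply: eq_measure_integral => A mA AD.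
  rewrite /= /mrestr; congr (mu _); apply/seteqP; split => [x []//|x Ax].
  by split => //; exact: AD.
- exact: measurableC.
- by rewrite /= /mrestr setICl measure0.
Qed.

End Mrestr.

Section Intensity.
Context {R : realType}.
Implicit Types (g : R -> R) (z : R * R) (B : set (R * R)).
Local Notation mu := (@lebesgue_measure R).
Local Notation mu2 := (mu \x mu)%E.

Definition epigraph g : set (R * R) := [set z | 0 <= z.1 <= 1 /\ g z.1 <= z.2].

(** Preimages of rays under a monotone function are intervals. The class says nothing about the
    value at 1, so that point is split off. *)
Lemma monotone_measurable g : monotone_class g ->
  measurable_fun (`[0, 1]%classic : set R) g.
Proof.
move=> [gmono _].
rewrite (_ : `[0, 1]%classic = `[0, 1[%classic `|` [set 1]); last first.
  apply/seteqP; split => x /=; rewrite !in_itv/=.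
    move=> /andP[x0]; rewrite le_eqVlt => /orP[/eqP ->|x1]; [by right|left].
    by rewrite x0.
  by move=> [/andP[-> /ltW]//|->]; rewrite ler01 lexx.
apply/measurable_funU => //; split; last exact: measurable_fun_set1.
apply: (measurability (@RGenCInfty.G R)) => [|/= _ [_] [r] -> <-].
  exact: RGenCInfty.measurableE.
apply: is_interval_measurable => s t/= [] s01 rs [] t01 rt u /andP[su ut].
have u01 : u \in `[0, 1[.
  move: s01 t01; rewrite !in_itv/= => /andP[s0 _] /andP[_ t1].
  by rewrite (le_trans s0 su) (le_lt_trans ut t1).
split => //=; move: rs; rewrite !in_itv/= !andbT => rs.
by rewrite (le_trans rs)//; apply: gmono.
Qed.

Lemma measurable_epigraph g : monotone_class g -> measurable (epigraph g).
Proof.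
move=> Mg; have mg : measurable_fun setT (g \_ `[0, 1]).
  by apply/(measurable_restrictT _ _).1 => //; exact: monotone_measurable.
have mle : measurable_fun setT (fun z : R * R => (g \_ `[0, 1]) z.1 <= z.2).
  apply: measurable_fun_ler; last exact: measurable_snd.
  by apply: measurableT_comp mg _; exact: measurable_fst.
rewrite (_ : epigraph g = (`[0, 1]%classic `*` setT) `&`
    ((fun z : R * R => (g \_ `[0, 1]) z.1 <= z.2) @^-1` [set true])); last first.
  apply/seteqP; split => z; rewrite /epigraph/= in_itv/=.
    by move=> [z01 gz]; split => //; rewrite patchE mem_set//= in_itv.
  by move=> [[z01 _]]; rewrite patchE mem_set//= in_itv.
apply: measurableI; first exact: measurableX.
by rewrite -[X in measurable X]setTI; exact: mle.
Qed.

(* [lebesgue_measure] lives on [measurableTypeR R], whose measurable structure is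
   convertible to the one of [R] but not syntactically equal to it: the measure
   is transported along the identity. *)
Local Notation plane := (measurableTypeR R * measurableTypeR R)%type.

Lemma measurable_plane_id : measurable_fun setT (fun z : plane => z : (R * R)%type).
Proof. by move=> _ A mA; rewrite setTI. Qed.

Definition plane_measure := [the {measure set plane -> \bar R} of mu2].

Section Measure.
Variables (n : nat) (g : R -> R).
Hypothesis Mg : monotone_class g.

Definition intensity_plane : {measure set plane -> \bar R} :=
  mscale (n%:R%:nng) (mrestr plane_measure (measurable_epigraph Mg)).

Definition Intensity : {measure set (R * R) -> \bar R} :=
  measure_function_pushforward__canonical__measure_function_Measure intensity_plane measurable_plane_id.

Lemma IntensityE B : Intensity B = (n%:R%:E * mu2 (B `&` epigraph g))%E.
Proof. by []. Qed.

Lemma intensity_measureE B : measurable B -> intensity_measure n g B = Intensity B.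
Proof.
move=> mB; rewrite IntensityE /intensity_measure.
have mE := measurable_epigraph Mg.
rewrite (@eq_integral _ plane R plane_measure _
  (fun z => n%:R%:E * (\1_(epigraph g) z)%:E)%E); last first.
  move=> z /set_mem [_ [/= z1 _]]; rewrite in_itv/= in z1.
  rewrite /intensity EFinM; congr (_ * _%:R%:E)%E.
  congr nat_of_bool; apply/idP/idP => [h|/set_mem[]//].
  by apply/mem_set; split.
have mD : measurable (B `&` (`[0, 1] `*` setT) : set (R * R)).
  by apply: measurableI => //; exact: measurableX.
rewrite ge0_integralZl_EFin//; last by apply/measurable_EFinP; apply: measurable_funTS.
rewrite integral_indic//; congr (_ * mu2 _)%E.
apply/seteqP; split => z /=; rewrite in_itv/=.
  by move=> [? [? _]].
by move=> [Bz [z01 gz]].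
Qed.

End Measure.

Lemma plane_measureX (A B : set R) : measurable A -> measurable B ->
  mu2 (A `*` B) = (mu A * mu B)%E.
Proof. exact: (@product_measure1E _ _ (measurableTypeR R) (measurableTypeR R) R mu mu A B). Qed.

Lemma lebesgue_measure_ray (a : R) : mu `[a, +oo[%classic = +oo%E.
Proof. by rewrite lebesgue_measure_itv/= ltry. Qed.

Section Properties.
Variables (n : nat) (g : R -> R).
Hypothesis Mg : monotone_class g.
Hypothesis n0 : (0 < n)%N.
Local Notation Lam := (Intensity n Mg).

Lemma Intensity_le B C : measurable B -> measurable C ->
  B `&` epigraph g `<=` C -> (Lam B <= n%:R%:E * mu2 C)%E.
Proof.
move=> mB mC BC; rewrite IntensityE lee_pmul2l//; last by rewrite lte_fin ltr0n.
have mE := measurable_epigraph Mg.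
by apply: le_measure; rewrite ?inE//; exact: measurableI.
Qed.

Lemma Intensity_strip (a b : R) : a <= b ->
  (Lam [set z | (a <= z.2 < b)%R] <= (n%:R * (b - a))%:E)%E.
Proof.
move=> ab; apply: (le_trans (@Intensity_le _ (`[0, 1]%classic `*` `[a, b[%classic) _ _ _)).
- exact: measurable_strip.
- exact: measurableX.
- by move=> z [/= h1 [h2 _]]; rewrite !in_itv.
rewrite plane_measureX// !lebesgue_measure_itv/= lte_fin ltr01 EFinM.
rewrite oppr0 adde0 mul1e; case: ifPn; first by rewrite EFinB.
by rewrite -leNgt lee_fin => ba; rewrite (_ : b = a) ?subrr//; apply/le_anti; rewrite ab ba.
Qed.

Lemma Intensity_box M : (Lam (box M) < +oo)%E.
Proof.
have := @Intensity_strip (- M%:R) M%:R; rewrite -subr_ge0 opprK addr_ge0// => /(_ isT) H.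
apply: le_lt_trans (ltry _); apply: le_trans H.
apply: le_measure; rewrite ?inE; [exact: measurable_box|exact: measurable_strip|].
by move=> z [].
Qed.

Lemma Intensity_outside : Lam (~` epigraph g) = 0%E.
Proof. by rewrite IntensityE setICl measure0 mule0. Qed.

Lemma Intensity_edge : Lam ([set 1] `*` setT) = 0%E.
Proof.
apply/le_anti/andP; split; last exact: measure_ge0.
apply: (le_trans (@Intensity_le _ ([set 1] `*` setT) _ _ _)).
- exact: measurableX.
- exact: measurableX.
- by move=> z [].
by rewrite plane_measureX// lebesgue_measure_set1 mul0e mule0.
Qed.

(** Over the left half of the column, up to its midpoint [y], everything above the level [g y]
    belongs to the epigraph; stopping at [y < 1] keeps this level finite. It follows that there are
    points to the right of every [x < 1], as the definition of [g_hat] needs. *)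
Lemma Intensity_column (x : R) : 0 <= x < 1 -> Lam (`[x, 1]%classic `*` setT) = +oo%E.
Proof.
move=> /andP[x0 x1].
pose y := (x + 1) / 2.
have [xy y1] : x < y /\ y < 1 by rewrite /y; split; lra.
rewrite IntensityE.
have mE := measurable_epigraph Mg.
have mC : measurable (`[x, 1]%classic `*` setT : set (R * R)) by exact: measurableX.
pose A : set (R * R) := `[x, y]%classic `*` `[g y, +oo[%classic.
pose C : set (R * R) := `[x, 1]%classic `*` setT.
have : (mu2 A <= mu2 (C `&` epigraph g))%E.
  apply: le_measure; rewrite ?inE; [exact: measurableX|exact: measurableI|].
  move=> z; rewrite /A/C/= !in_itv/= andbT => -[/andP[xz zy] gz].
  have z1 : z.1 < 1 by exact: le_lt_trans zy y1.
  split; first by rewrite xz ltW.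
  split; first by rewrite (le_trans x0 xz) ltW.
  by apply: le_trans gz; case: Mg => gm _; apply: gm => //; rewrite in_itv/=; apply/andP; split; lra.
rewrite /A plane_measureX// lebesgue_measure_ray lebesgue_measure_itv/= lte_fin xy.
rewrite -EFinB gt0_muley ?lte_fin ?subr_gt0// leye_eq => /eqP ->.
by rewrite gt0_muley// lte_fin ltr0n.
Qed.

End Properties.
End Intensity.

(** * Regular configurations and the staircase *)

Lemma argmin_lt {R : realType} (f : nat -> R) (J : set nat) N :
  (forall j, J j -> (j < N)%N) -> J !=set0 ->
  exists2 i, J i & forall j, J j -> f i <= f j.
Proof.
elim: N J => [|N IH] J JN [j0 Jj0]; first by have := JN _ Jj0.
have [[i [Ji iN]]|no] := pselect (exists i, J i /\ (i < N)%N); last first.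
  have E j : J j -> j = N.
    move=> Jj; apply/eqP; have := JN _ Jj; rewrite ltnS leq_eqVlt => /orP[//|jN].
    by exfalso; apply: no; exists j.
  by exists j0 => // j Jj; rewrite (E _ Jj) (E _ Jj0).
have [|k [Jk kN] kmin] := IH (J `&` [set j | (j < N)%N]) (fun j => @proj2 _ _).
  by exists i.
have [JNN|JNN] := pselect (J N); last first.
  exists k => // j Jj; apply: kmin; split => //.
  have := JN _ Jj; rewrite ltnS leq_eqVlt => /orP[/eqP e|//].
  by move: Jj; rewrite e.
have [fkN|fNk] := leP (f k) (f N).
  exists k => // j Jj; have := JN _ Jj; rewrite ltnS leq_eqVlt => /orP[/eqP ->//|jN].
  exact: kmin.
exists N => // j Jj; have := JN _ Jj; rewrite ltnS leq_eqVlt => /orP[/eqP ->//|jN].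
by apply: le_trans (ltW fNk) _; exact: kmin.
Qed.

Section Configuration.
Context {R : realType} {d : measure_display} {Omega : measurableType d}.
Variable Z : nat -> Omega -> R * R.

(** The almost sure properties behind all pathwise arguments: with them, the minimum in [g_hat] is
    attained for [x < 1], at a single point, and only finitely many points lie below any level. *)
Definition regular om : Prop :=
  [/\ forall j, 0 <= (Z j om).1 < 1,
      forall L : nat, finite_set [set j | (Z j om).2 < L%:R],
      forall x, x < 1 -> exists j, x <= (Z j om).1 &
      forall i j, (Z i om).2 = (Z j om).2 -> i = j].

Lemma regular_finite om (y : R) : regular om -> finite_set [set j | (Z j om).2 <= y].
Proof.
move=> [_ fin _ _]; apply: sub_finite_set (fin (Num.truncn `|y|).+1) => j /= yj.
by rewrite (le_lt_trans yj)// (le_lt_trans (ler_norm y))// truncnS_gt.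
Qed.

Lemma regular_argmin om (J : set nat) : regular om -> J !=set0 ->
  exists2 i, J i & forall j, J j -> (Z i om).2 <= (Z j om).2.
Proof.
move=> rom [j0 Jj0].
have [N HN] := finite_nat_bounded (regular_finite (Z j0 om).2 rom).
have [||i [Ji i0] imin] := @argmin_lt R (fun j => (Z j om).2)
    (J `&` [set j | (Z j om).2 <= (Z j0 om).2]) N.
- by move=> j [_] /HN.
- by exists j0; split => //=.
exists i => // j Jj; have [jj0|jj0] := leP (Z j om).2 (Z j0 om).2.
  exact: imin.
exact: le_trans i0 (ltW jj0).
Qed.

Lemma g_hatP om x : regular om -> x < 1 -> exists i,
  [/\ x <= (Z i om).1, g_hat Z om x = (Z i om).2 &
      forall j, x <= (Z j om).1 -> g_hat Z om x <= (Z j om).2].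
Proof.
move=> rom x1; have [_ _ ex _] := rom.
have [i xi imin] := @regular_argmin om [set j | x <= (Z j om).1] rom (ex x x1).
exists i; suff -> : g_hat Z om x = (Z i om).2 by split.
rewrite /g_hat; set A := [set (Z i om).2 | i in _].
have Ai : A (Z i om).2 by exists i.
have lAi : lbound A (Z i om).2 by move=> _ [j xj <-]; exact: imin.
case: xgetP => [y _ [[j xj <-] lb]|/(_ (Z i om).2)[]//].
by apply/le_anti; rewrite lb//= imin.
Qed.

Lemma g_hat_le om i x : regular om -> x <= (Z i om).1 -> g_hat Z om x <= (Z i om).2.
Proof.
move=> rom xi; have [X01 _ _ _] := rom.
have x1 : x < 1 by apply: le_lt_trans xi _; have /andP[] := X01 i.
by have [k [_ _]] := g_hatP rom x1; apply.
Qed.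

Lemma g_hat_mono om x y : regular om -> x <= y -> y < 1 -> g_hat Z om x <= g_hat Z om y.
Proof.
move=> rom xy y1; have [i [yi -> _]] := g_hatP rom y1.
exact: g_hat_le (le_trans xy yi).
Qed.

Lemma le_g_hat om x y : regular om -> x < 1 ->
  (y <= g_hat Z om x) <-> (forall j, x <= (Z j om).1 -> y <= (Z j om).2).
Proof.
move=> rom x1; have [i [xi e lb]] := g_hatP rom x1; split => [yg j xj|H].
  exact: le_trans (lb j xj).
by rewrite e; exact: H.
Qed.

Lemma cornerE om z : regular om -> z.1 < 1 ->
  corner Z om z = (z.2 <= g_hat Z om z.1)%R%:R.
Proof.
move=> rom z1; rewrite /corner indicE; congr (_%:R); congr nat_of_bool.
apply/idP/idP => [/set_mem H|/(le_g_hat _ rom z1) H].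
  apply/(le_g_hat _ rom z1) => j xj; rewrite leNgt; apply/negP => yj.
  by apply: (H j); split.
by apply/mem_set => j [h1]; rewrite ltNge H.
Qed.

Lemma corner_point om j : regular om ->
  corner Z om (Z j om) = (g_hat Z om (Z j om).1 == (Z j om).2)%:R.
Proof.
move=> rom; have [X01 _ _ _] := rom; have /andP[_ x1] := X01 j.
rewrite cornerE//; congr (_%:R); congr nat_of_bool.
apply/idP/eqP => [h|->//]; apply/le_anti; rewrite h andbT.
exact: g_hat_le.
Qed.

End Configuration.

Section Regular.
Context {R : realType} {d : measure_display} {Omega : measurableType d}.
Variables (n : nat) (g : R -> R) (Z : nat -> Omega -> R * R) (P : probability Omega R).
Hypothesis Mg : monotone_class g.
Hypothesis n0 : (0 < n)%N.
Hypothesis X01 : forall j om, (Z j om).1 \in `[0, 1].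
Hypothesis pppg : poisson_point_process P Z (intensity_measure n g).
Local Notation Lam := (Intensity n Mg).

Lemma ppp_Intensity : poisson_point_process P Z Lam.
Proof.
case: pppg => h1 h2 h3 h4; split => //.
- by move=> B k mB; rewrite -(intensity_measureE n Mg mB); exact: h2.
- by move=> B mB; rewrite -(intensity_measureE n Mg mB); exact: h3.
Qed.
Local Notation ppp := ppp_Intensity.
Local Notation mZ := (ppp_measurable ppp).

Lemma ae_void B : measurable B -> Lam B = 0%E -> {ae P, forall om, void Z B om}.
Proof.
move=> mB LB; have mv := measurable_void mZ mB.
exists (~` void Z B); split => //; first exact: measurableC.
by rewrite probability_setC// (prob_void ppp mB) LB oppe0 expeR0 subee.
Qed.

Lemma ae_not_void B : measurable B -> Lam B = +oo%E ->
  {ae P, forall om, exists j, B (Z j om)}.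
Proof.
move=> mB LB; have mv := measurable_void mZ mB.
exists (void Z B); split => //; first by rewrite (prob_void ppp mB) LB.
by move=> om /= nex j Bj; apply: nex; exists j.
Qed.

Definition regular_above om : Prop :=
  regular Z om /\ forall j, g (Z j om).1 <= (Z j om).2.

(** Null regions (the line [x = 1] and the complement of the epigraph) carry no point, boxes carry
    finitely many, and the columns from [1 - 1/(k+1)] to 1 have infinite mass and so carry at least
    one. *)
Lemma ae_regular_above : {ae P, forall om, regular_above om}.
Proof.
have mE := measurable_epigraph Mg.
have ae_edge := ae_void (measurableX (measurable_set1 (1 : R)) measurableT) (Intensity_edge Mg n0).
have ae_epi := ae_void (measurableC mE) (Intensity_outside n Mg).
have ae_box : {ae P, forall om, forall M : nat, (point_count Z (box M) om < +oo)%E}.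
  apply: ae_foralln => M.
  exact: (point_count_lty ppp (measurable_box M) (Intensity_box Mg n0 M)).
have ae_col : {ae P, forall om, forall k : nat,
    exists j, (`[1 - k.+1%:R^-1, 1]%classic `*` setT : set (R * R)) (Z j om)}.
  apply: ae_foralln => k; apply: ae_not_void; first exact: measurableX.
  apply: Intensity_column => //.
  have k1 : (k.+1%:R^-1 : R) <= 1 by rewrite invf_le1// ler1n.
  have k0 : (0 : R) < k.+1%:R^-1 by rewrite invr_gt0.
  by move: (k.+1%:R^-1) k0 k1 => q *; apply/andP; split; lra.
have ae_ties := ae_no_ties ppp (Intensity_strip Mg n0).
apply: filterS3 (filterI ae_edge ae_epi) (filterI ae_box ae_col) ae_ties.
move=> om [vedge vepi] [box_fin col] ties.
have above j : g (Z j om).1 <= (Z j om).2.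
  have [_ //] : epigraph g (Z j om) by apply: contrapT; exact: vepi.
have x01 j : 0 <= (Z j om).1 < 1.
  have := X01 j om; rewrite in_itv/= => /andP[-> ]; rewrite le_eqVlt => /orP[/eqP e|//].
  by exfalso; apply: (vedge j); split.
split => //; split => //.
(* All points lie above [g 0], so those below level [L] fall into the box of size [M]. *)
- move=> L; pose M := (L + (Num.truncn `|g 0|).+1)%N.
  apply: sub_finite_set (point_count_finite (box_fin M)) => j /= jL.
  have /andP[x0 x1] := x01 j.
  have gm : g 0 <= g (Z j om).1.
    by case: Mg => gm _; apply: gm; rewrite ?in_itv/= ?lexx ?ltr01 ?x0.
  have t : `|g 0| < (Num.truncn `|g 0|).+1%:R by rewrite truncnS_gt.
  have := ler_norm (- g 0); rewrite normrN => g0.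
  have L0 : (0 : R) <= L%:R by [].
  split; first by rewrite x0 ltW.
  rewrite /M natrD; have aj := above j; have n_g0 := normr_ge0 (g 0).
  move: (_.+1%:R) t => K t; apply/andP; split; lra.
- move=> x x1; pose k := Num.truncn (1 - x)^-1.
  have [j [/=]] := col k; rewrite in_itv/= => /andP[h _] _; exists j; apply: le_trans h.
  have x10 : 0 < 1 - x by rewrite subr_gt0.
  rewrite lerBrDl -lerBrDr -[leRHS]invrK lef_pV2 ?posrE ?invr_gt0//.
  by rewrite ltW// truncnS_gt.
Qed.

End Regular.

Section MeasurableGhat.
Context {R : realType} {d : measure_display} {Omega : measurableType d}.
Variable Z : nat -> Omega -> R * R.
Hypothesis mZ : forall j, measurable_fun setT (Z j).

(** The space is covered by the countably many sets on which the point with index [i] attains the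
    minimum, where [g_hat] is its height, and the set without minimizer, where [g_hat] has the
    default value 0. *)
Lemma measurable_g_hat :
  measurable_fun setT (fun p : Omega * R => g_hat Z p.1 p.2).
Proof.
pose isarg i : set (Omega * R) := [set p | p.2 <= (Z i p.1).1 /\
  forall j, p.2 <= (Z j p.1).1 -> (Z i p.1).2 <= (Z j p.1).2].
have mX j : measurable_fun setT (fun p : Omega * R => (Z j p.1).1).
  exact: (measurableT_comp measurable_fst (measurableT_comp (mZ j) measurable_fst)).
have mY j : measurable_fun setT (fun p : Omega * R => (Z j p.1).2).
  exact: (measurableT_comp measurable_snd (measurableT_comp (mZ j) measurable_fst)).
have m2 : measurable_fun setT (fun p : Omega * R => p.2) by exact: measurable_snd.
have mb (b : Omega * R -> bool) : measurable_fun setT b -> measurable [set p | b p].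
  move=> mb; rewrite (_ : [set _ | _] = b @^-1` [set true]).
    by rewrite -[X in measurable X]setTI; exact: mb.
  by apply/seteqP; split => p.
have mi i : measurable (isarg i).
  rewrite (_ : isarg i = [set p | p.2 <= (Z i p.1).1] `&`
    \bigcap_j [set p | ((Z j p.1).1 < p.2) || ((Z i p.1).2 <= (Z j p.1).2)]).
    apply: measurableI; first by apply: mb; exact: measurable_fun_ler.
    apply: bigcapT_measurable => j; apply: mb; apply: measurable_or.
      exact: measurable_fun_ltr.
    exact: measurable_fun_ler.
  apply/seteqP; split => p [h1 h2]; split => // j.
    by move=> _ /=; case: ltP => //= /h2.
  by move=> h3; have /= := h2 j Logic.I; rewrite ltNge h3.
have argE i p : isarg i p -> g_hat Z p.1 p.2 = (Z i p.1).2.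
  move=> [pi lb]; rewrite /g_hat; case: xgetP => [y _ [[j pj <-] lb']|/(_ (Z i p.1).2)[]].
    by apply/le_anti; rewrite lb ?lb'//; exists i.
  by split; [exists i|move=> _ [j pj <-]; exact: lb].
have noarg p : (forall i, ~ isarg i p) -> g_hat Z p.1 p.2 = 0.
  move=> no; rewrite /g_hat; case: xgetP => // y _ [[j pj <-] lb].
  by exfalso; apply: (no j); split => // k pk; apply: lb; exists k.
move=> _ C mC; rewrite setTI.
rewrite (_ : _ @^-1` _ = \bigcup_i (isarg i `&` ((fun p => (Z i p.1).2) @^-1` C)) `|`
   (\bigcap_i (~` isarg i) `&` [set p | C 0])).
  apply: measurableU.
    apply: bigcupT_measurable => i; apply: measurableI => //.
    by rewrite -[X in measurable X]setTI; exact: mY.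
  apply: measurableI; first by apply: bigcapT_measurable => i; exact: measurableC.
  have [c0|c0] := pselect (C 0).
    by rewrite (_ : [set _ | _] = setT)//; apply/seteqP; split.
  by rewrite (_ : [set _ | _] = set0)//; apply/seteqP; split.
apply/seteqP; split => p /=.
  have [[i ip]|no] := pselect (exists i, isarg i p).
    by rewrite (argE i p ip) => Ci; left; exists i.
  have no' i : ~ isarg i p by move=> ip; apply: no; exists i.
  by rewrite noarg// => C0; right; split => // i _; exact: no'.
by move=> [[i _ [ip /=]]|[no c0]]; [rewrite (argE i p ip)|rewrite noarg// => i; exact: no i Logic.I].
Qed.

End MeasurableGhat.

(** * The mean error of [g_hat] *)

Section IntensityIntegral.
Context {R : realType}.
Local Notation mu := (@lebesgue_measure R).
Local Notation plane := (measurableTypeR R * measurableTypeR R)%type.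

Lemma ge0_integral_Intensity n g (Mg : monotone_class g) (f : R * R -> \bar R) :
  measurable_fun setT f -> (forall z, (0 <= f z)%E) ->
  (\int[Intensity n Mg]_z f z =
   n%:R%:E * \int[mu]_x \int[mu]_y ((\1_(epigraph g) (x, y))%:E * f (x, y)))%E.
Proof.
move=> mf f0; rewrite [LHS](@ge0_integral_pushforward _ _ plane (R * R)%type R _
  (@measurable_plane_id R) (intensity_plane n Mg) setT f measurableT mf (fun y _ => f0 y)).
rewrite preimage_setT ge0_integral_mscale//.
rewrite ge0_integral_mrestr// integral_mkcond; congr (_ * _)%E.
have mE := measurable_epigraph Mg.
have mind : measurable_fun setT (\1_(epigraph g) : R * R -> R) by exact/measurable_indicP.
rewrite (_ : _ \_ _ = (fun z : plane => ((\1_(epigraph g) z)%:E * f z)%E)); last first.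
  by apply/funext => z; rewrite patchE indicE; case: ifPn => _; rewrite ?mul1e ?mul0e.
rewrite (fubini_tonelli1 (m1 := mu) (m2 := mu)
  (fun z : plane => ((\1_(epigraph g) z)%:E * f z)%E))//.
- apply: (@emeasurable_funM _ plane) => //; exact/measurable_EFinP.
- by move=> z; rewrite mule_ge0// lee_fin.
Qed.

Lemma integral_segment (a b : R) : a <= b ->
  (\int[mu]_y ((a <= y <= b)%R%:R)%:E = (b - a)%:E)%E.
Proof.
move=> ab; rewrite (@eq_integral _ (measurableTypeR R) R mu setT
  (fun y => (\1_(`[a, b]%classic : set R) y)%:E)); last first.
  move=> y _; rewrite indicE; congr (_%:R%:E); congr nat_of_bool.
  by apply/idP/idP => [h|/set_mem]; [apply/mem_set|]; rewrite /= in_itv.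
rewrite integral_indic// setIT -[LHS]/(mu `[a, b]%classic) lebesgue_measure_itv/= lte_fin.
case: ifPn => //; rewrite -leNgt => ba.
by rewrite (_ : b = a) ?subrr//; apply/le_anti; rewrite ab ba.
Qed.

End IntensityIntegral.

Section Exponential.
Context {R : realType}.
Local Notation mu := (@lebesgue_measure R).

Lemma integral_exp_tail (c b : R) : 0 < c ->
  (\int[mu]_(y in `[b, +oo[) (expR (- (c * (y - b))))%:E = (c^-1)%:E)%E.
Proof.
move=> c0; pose k := expR (c * b); pose F y : R := (- c^-1 * k) * expR (- (c * y)).
pose f y : R := k * expR (- (c * y)).
have fE y : expR (- (c * (y - b))) = f y.
  by rewrite /f /k -expRD; congr expR; lra.
under eq_integral do rewrite fE.
have dF (y : R) : is_derive y 1 F (f y).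
  rewrite /F/f; apply: is_derive_eq.
  rewrite /GRing.scale/=.
  transitivity ((c^-1 * c) * (k * expR (- (c * y)))); last by rewrite mulVf ?gt_eqF// mul1r.
  by move: (c^-1) (expR _) => u v; lra.
rewrite (@ge0_continuous_FTC2y _ f F _ 0).
- rewrite -EFinB sub0r /F !mulNr opprK -mulrA /k -expRD subrr expR0 mulr1//.
- by move=> y _; rewrite mulr_ge0 ?expR_ge0.
- apply: continuous_subspaceT => y.
  rewrite /f; apply: cvgM; first exact: cvg_cst.
  apply: (@continuous_comp _ _ _ (fun y : R => - (c * y)) expR); last exact: continuous_expR.
  by apply: cvgN; apply: cvgM; [exact: cvg_cst|exact: cvg_id].
- rewrite -(mulr0 (- c^-1 * k)); apply: cvgM; first exact: cvg_cst.
  apply: (@cvg_comp _ _ _ (fun y : R => c * y) (fun z : R => expR (- z)) _ (pinfty_nbhs R)); last exact: cvgr_expR.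
  exact: gt0_cvgMry.
- by move=> y _; exact: ex_derive.
- apply: cvg_at_right_filter.
  by apply/differentiable_continuous/derivable1_diffP; exact: ex_derive.
- by move=> y _; rewrite derive1E; exact: derive_val.
Qed.

End Exponential.

Section Risk.
Context {R : realType} {d : measure_display} {Omega : measurableType d}.
Variables (n : nat) (g : R -> R) (Z : nat -> Omega -> R * R) (P : probability Omega R).
Hypothesis Mg : monotone_class g.
Hypothesis n0 : (0 < n)%N.
Hypothesis X01 : forall j om, (Z j om).1 \in `[0, 1].
Hypothesis pppg : poisson_point_process P Z (intensity_measure n g).
Local Notation Lam := (Intensity n Mg).
Local Notation mu := (@lebesgue_measure R).
Local Notation ppp := (ppp_Intensity Mg pppg).
Local Notation mZ := (ppp_measurable ppp).

Lemma measurable_below (z : R * R) : measurable (below z).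
Proof.
rewrite (_ : below z = `[z.1, +oo[%classic `*` `]-oo, z.2[%classic).
  exact: measurableX.
by apply/seteqP; split => y; rewrite /below/= !in_itv/= andbT.
Qed.

Lemma measurable_natr_bool d' (T : measurableType d') (b : T -> bool) :
  measurable_fun setT b -> measurable_fun setT (fun x => (b x)%:R : R).
Proof.
move=> mb; rewrite (_ : (fun _ => _) = (fun x => if b x then 1 else 0 : R)).
  exact: measurable_fun_ifT.
by apply/funext => x; case: (b x).
Qed.

Lemma regular_above_le_g_hat om x : regular_above g Z om -> 0 <= x < 1 -> g x <= g_hat Z om x.
Proof.
move=> [rom above] /andP[x0 x1]; apply/(le_g_hat _ rom x1) => j xj.
have [X _ _ _] := rom; have /andP[Xj0 Xj1] := X j.
apply: le_trans (above j); case: Mg => gm _; apply: gm => //; rewrite in_itv/=.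
  by rewrite x0.
by rewrite Xj0.
Qed.

(** The layer cake formula for the mean of [g_hat x - g x]: the event [void Z (below (x, y))] says
    that [g_hat x] is at least [y]. As an extended real it is available before finiteness is
    known. *)
Definition risk x : \bar R :=
  (\int[mu]_y (((g x <= y)%R%:R)%:E * P (void Z (below (x, y)))))%E.

Lemma risk_ge0 x : (0 <= risk x)%E.
Proof. by apply: integral_ge0 => y _; rewrite mule_ge0// lee_fin. Qed.

Lemma measurable_g_hat_section x : measurable_fun setT (fun om => g_hat Z om x).
Proof. exact: (measurableT_comp (measurable_g_hat mZ) (pair2_measurable x)). Qed.

Lemma measurable_corner_section x :
  measurable_fun setT (fun p : Omega * measurableTypeR R => corner Z p.1 (x, p.2)).
Proof.
apply: (measurableT_comp (measurable_corner mZ)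
  (g := fun p : Omega * measurableTypeR R => (p.1, (x, p.2 : R)))).
apply: measurable_fun_pair; first exact: measurable_fst.
by apply: measurable_fun_pair => //; exact: measurable_snd.
Qed.

Lemma integral_corner z : (\int[P]_om (corner Z om z)%:E = P (void Z (below z)))%E.
Proof.
rewrite integral_indic ?setIT//.
exact: (measurable_void mZ (measurable_below _)).
Qed.

Lemma measurable_prob_below x :
  measurable_fun setT (fun y : measurableTypeR R => P (void Z (below (x, y)))).
Proof.
rewrite (_ : (fun _ => _) = fubini_G P (fun p : Omega * measurableTypeR R => (corner Z p.1 (x, p.2))%:E)).
  apply: measurable_fun_fubini_tonelli_G.
    by apply/measurable_EFinP; exact: measurable_corner_section.
  by move=> p; rewrite lee_fin corner_ge0.
by apply/funext => y; rewrite /fubini_G/= integral_corner.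
Qed.

Lemma mean_g_hat x : 0 <= x < 1 ->
  (\int[P]_om (`|g_hat Z om x - g x|)%:E = risk x)%E.
Proof.
move=> x01; have /andP[x0 x1] := x01.
pose f (p : Omega * measurableTypeR R) : \bar R :=
  (((g x <= p.2)%R%:R) * corner Z p.1 (x, p.2))%:E.
have mf : measurable_fun setT f.
  apply/measurable_EFinP; apply: measurable_funM; last exact: measurable_corner_section.
  by apply: measurable_natr_bool; apply: measurable_fun_ler.
have f0 p : (0 <= f p)%E by rewrite lee_fin mulr_ge0// corner_ge0.
transitivity (\int[P]_om \int[mu]_y f (om, y))%E.
  apply: ge0_ae_eq_integral => //.
  - apply/measurable_EFinP; apply: measurableT_comp => //.
    by apply: measurable_funB => //; exact: measurable_g_hat_section.
  - exact: (measurable_fun_fubini_tonelli_F (m2 := mu)).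
  - by move=> om _; apply: integral_ge0 => y _; exact: f0.
  apply: filterS (ae_regular_above Mg n0 X01 pppg) => om rom _.
  have gh := regular_above_le_g_hat rom x01.
  rewrite ger0_norm ?subr_ge0// -(integral_segment gh).
  apply: eq_integral => y _; rewrite /f/= cornerE//; last by case: rom.
  by rewrite -natrM mulnb.
rewrite (fubini_tonelli (m1 := P) (m2 := mu) f)//.
apply: eq_integral => y _.
rewrite /f/=; under eq_integral do rewrite EFinM.
rewrite ge0_integralZl_EFin//.
- by rewrite integral_corner.
- by move=> om _; rewrite lee_fin corner_ge0.
- by apply/measurable_EFinP; exact: (measurable_cornerl mZ).
Qed.

(** By monotonicity the rectangle over [[x, x + de]] between the heights [g (x + de)] and [y] lies
    in the epigraph, and it is part of [below (x, y)]; its intensity is the exponent. *)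
Lemma prob_below_le x y de : 0 <= x -> 0 < de -> x + de < 1 -> g (x + de) <= y ->
  (P (void Z (below (x, y))) <= (expR (- (n%:R * de * (y - g (x + de)))))%:E)%E.
Proof.
move=> x0 de0 xde by_; set b := g (x + de).
have mB := measurable_below (x, y).
rewrite (prob_void ppp mB).
suff : ((n%:R * de * (y - b))%:E <= Lam (below (x, y)))%E.
  by move=> H; rewrite -[leRHS]/(expeR (- (n%:R * de * (y - b))%:E)) lee_expeR leeN2.
rewrite IntensityE -mulrA EFinM lee_pmul2l ?lte_fin ?ltr0n//.
have mE := measurable_epigraph Mg.
pose A : set (R * R) := `[x, x + de]%classic `*` `[b, y[%classic.
have mA : measurable A by exact: measurableX.
apply: (@le_trans _ _ ((mu \x mu)%E A)).
  rewrite /A plane_measureX// !lebesgue_measure_itv/= !lte_fin ltrDl de0.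
  rewrite -EFinB addrAC subrr add0r EFinM lee_pmul2l ?lte_fin//.
  case: ifPn; first by rewrite EFinB.
  by rewrite -leNgt => yb; rewrite lee_fin subr_le0.
apply: le_measure; rewrite ?inE//; first exact: measurableI.
move=> z; rewrite /A/= !in_itv/= => -[/andP[xz zx] /andP[bz zy]].
have z1 : z.1 < 1 by exact: le_lt_trans zx xde.
split => //; split; first by rewrite (le_trans x0 xz) ltW.
apply: le_trans bz; case: Mg => gm _; apply: gm => //; rewrite in_itv/=.
  by rewrite (le_trans x0 xz).
by rewrite xde andbT addr_ge0// ltW.
Qed.

(** Split the layer cake at [b = g (x + de)]. Below [b] the probability is bounded by 1, which costs
    [b - g x]; above [b] the exponential tail integrates to [1/(n de)]. *)
Lemma risk_le x de : 0 <= x -> 0 < de -> x + de < 1 ->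
  (risk x <= (g (x + de) - g x + (n%:R * de)^-1)%:E)%E.
Proof.
move=> x0 de0 xde; set b := g (x + de).
have gb : g x <= b.
  have xd1 : x < 1 by apply: lt_trans xde; rewrite ltrDl.
  have xd0 : 0 <= x + de by rewrite addr_ge0// ltW.
  case: Mg => gm _; apply: gm; rewrite ?in_itv/= ?x0 ?xd0//.
  by rewrite lerDl ltW.
have c0 : 0 < n%:R * de by rewrite mulr_gt0// ltr0n.
pose e (y : R) := expR (- (n%:R * de * (y - b))).
have me : measurable_fun setT (fun y : measurableTypeR R => e y).
  apply: (measurableT_comp (@measurable_expR R)).
  apply: measurableT_comp => //; apply: measurable_funM => //.
  exact: measurable_funB.
have m1 : measurable_fun setT (fun y : measurableTypeR R => ((g x <= y <= b)%R%:R : R)).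
  apply: measurable_natr_bool; apply: measurable_and; exact: measurable_fun_ler.
have m2 : measurable_fun setT (fun y : measurableTypeR R => ((b <= y)%R%:R : R)).
  by apply: measurable_natr_bool; exact: measurable_fun_ler.
have m3 : measurable_fun setT (fun y : measurableTypeR R => ((g x <= y)%R%:R : R)).
  by apply: measurable_natr_bool; exact: measurable_fun_ler.
rewrite EFinD -(integral_segment gb) -(integral_exp_tail b c0).
rewrite [X in (_ + X)%E]integral_mkcond.
set f1 := fun y : measurableTypeR R => ((g x <= y <= b)%R%:R)%:E.
set f2 := _ \_ _.
have f1_ge0 y : [set: measurableTypeR R] y -> (0 <= f1 y)%E by rewrite lee_fin.
have f2_ge0 y : [set: measurableTypeR R] y -> (0 <= f2 y)%E.
  by move=> _; rewrite /f2 patchE; case: ifPn => // _; rewrite lee_fin expR_ge0.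
have mf1 : measurable_fun setT f1 by exact/measurable_EFinP.
have mf2 : measurable_fun setT f2.
  apply/(measurable_restrictT _ _).1 => //.
  by apply: measurable_funTS; exact/measurable_EFinP.
rewrite -(ge0_integralD mu measurableT f1_ge0 mf1 f2_ge0 mf2).
apply: ge0_le_integral => //.
- by move=> y _; rewrite mule_ge0// lee_fin.
- apply: emeasurable_funM; first exact/measurable_EFinP.
  exact: measurable_prob_below.
- exact: emeasurable_funD.
rewrite /f1 /f2.
move=> y _; rewrite patchE; case: (ltP y b) => yb.
  rewrite (_ : (y \in _) = false); last by apply/negP => /set_mem/=; rewrite in_itv/= andbT leNgt yb.
  rewrite adde0 (ltW yb) andbT.
  case: (g x <= y); last by rewrite mul0e.
  rewrite mul1e; apply: probability_le1.
  exact: (measurable_void mZ (measurable_below _)).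
rewrite mem_set; last by rewrite /= in_itv/= yb.
apply: le_trans (leeDr _ _); last by rewrite lee_fin.
apply: le_trans (prob_below_le x0 de0 xde yb).
by case: (g x <= y); rewrite ?mul1e ?mul0e.
Qed.

(** Over a fixed [x], the part of the epigraph on or under the staircase is the segment from [g x]
    to [g_hat x]. *)
Lemma integral_corner_Intensity (h : R -> R) om : measurable_fun setT h ->
  (forall x, 0 <= h x) -> (forall x, ~~ (0 <= x < 1) -> h x = 0) ->
  regular_above g Z om ->
  (\int[Lam]_z (h z.1 * corner Z om z)%:E =
   n%:R%:E * \int[mu]_x (h x * `|g_hat Z om x - g x|)%:E)%E.
Proof.
move=> mh h0 hout rom; rewrite ge0_integral_Intensity; last 2 first.
- apply/measurable_EFinP; apply: measurable_funM.
    exact: measurableT_comp mh measurable_fst.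
  exact: (measurable_cornerr mZ).
- by move=> z; rewrite lee_fin mulr_ge0// corner_ge0.
congr (_ * _)%E; apply: eq_integral => x _.
have [x01|x01] := boolP (0 <= x < 1); last first.
  rewrite hout// mul0r; apply: integral0_eq => y _.
  by rewrite /= mul0r mule0.
have /andP[x0 x1] := x01.
have gh := regular_above_le_g_hat rom x01.
rewrite ger0_norm ?subr_ge0// EFinM -(integral_segment gh).
rewrite -ge0_integralZl_EFin//; last first.
  apply/measurable_EFinP; apply: (@measurable_natr_bool _ (measurableTypeR R)).
  by apply: measurable_and; exact: measurable_fun_ler.
apply: eq_integral => y _ /=; rewrite cornerE//=; last by case: rom.
rewrite indicE -!EFinM; congr EFin; rewrite mulrCA; congr (_ * _).
rewrite -natrM mulnb; congr (_%:R); congr nat_of_bool; congr andb.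
apply/idP/idP => [/set_mem[]//|gxy]; apply/mem_set; split => //=.
by rewrite x0 ltW.
Qed.

Lemma measurable_weighted_dist (h : R -> R) : measurable_fun setT h ->
  (forall x, ~~ (0 <= x < 1) -> h x = 0) ->
  measurable_fun setT (fun p : Omega * measurableTypeR R => h p.2 * `|g_hat Z p.1 p.2 - g p.2|).
Proof.
move=> mh hout; pose gb : R -> R := g \_ (`[0, 1]%classic : set R).
have mgb : measurable_fun setT gb.
  by apply/(measurable_restrictT _ _).1 => //; exact: monotone_measurable.
rewrite (_ : (fun p => _) = (fun p => h p.2 * `|g_hat Z p.1 p.2 - gb p.2|)); last first.
  apply/funext => p; have [/andP[x0 x1]|/hout ->] := boolP (0 <= p.2 < 1); last by rewrite !mul0r.
  by rewrite /gb patchE mem_set//= in_itv/= x0 ltW.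
apply: measurable_funM; first exact: (measurableT_comp mh measurable_snd).
apply: measurableT_comp => //; apply: measurable_funB; first exact: (measurable_g_hat mZ).
exact: (measurableT_comp mgb measurable_snd).
Qed.

Lemma weighted_riskE (h : R -> R) x : (forall x, 0 <= h x) ->
  (forall x, ~~ (0 <= x < 1) -> h x = 0) ->
  (\int[P]_om (h x * `|g_hat Z om x - g x|)%:E = (h x)%:E * risk x)%E.
Proof.
move=> h0 hout; under eq_integral do rewrite EFinM.
rewrite ge0_integralZl_EFin//; last first.
  apply/measurable_EFinP; apply: measurableT_comp => //.
  by apply: measurable_funB => //; exact: measurable_g_hat_section.
have [x01|/hout ->] := boolP (0 <= x < 1); last by rewrite !mul0e.
by rewrite mean_g_hat.
Qed.

Lemma measurable_weighted_risk (h : R -> R) : measurable_fun setT h ->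
  (forall x, 0 <= h x) -> (forall x, ~~ (0 <= x < 1) -> h x = 0) ->
  measurable_fun setT (fun x : measurableTypeR R => ((h x)%:E * risk x)%E).
Proof.
move=> mh h0 hout; rewrite (_ : (fun x => _) = fubini_G P
    (fun p : Omega * measurableTypeR R => (h p.2 * `|g_hat Z p.1 p.2 - g p.2|)%:E)); last first.
  by apply/funext => x; rewrite -weighted_riskE.
apply: measurable_fun_fubini_tonelli_G.
  by apply/measurable_EFinP; exact: measurable_weighted_dist.
by move=> p; rewrite lee_fin mulr_ge0.
Qed.

Lemma mean_integral_corner (h : R -> R) : measurable_fun setT h ->
  (forall x, 0 <= h x) -> (forall x, ~~ (0 <= x < 1) -> h x = 0) ->
  (\int[P]_om \int[mu]_x (h x * `|g_hat Z om x - g x|)%:E =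
   \int[mu]_x ((h x)%:E * risk x))%E.
Proof.
move=> mh h0 hout.
rewrite (fubini_tonelli (m1 := P) (m2 := mu)
  (fun p : Omega * measurableTypeR R => (h p.2 * `|g_hat Z p.1 p.2 - g p.2|)%:E))//.
- by apply: eq_integral => x _; exact: weighted_riskE.
- by apply/measurable_EFinP; exact: measurable_weighted_dist.
- by move=> p; rewrite lee_fin mulr_ge0.
Qed.

End Risk.

(** * Mean and variance of [theta_hat] *)

Section MeasurableLimn.
Context d (T : measurableType d) (R : realType).

Lemma limn_einf_sup_cvg (u : nat -> \bar R) (l : \bar R) :
  limn_einf u = l -> limn_esup u = l -> u @ \oo --> l.
Proof.
move=> ui us; apply: (@squeeze_cvge _ _ _ _ (einfs u) _ (esups u)).
- apply: nearW => k; apply/andP; split.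
    by apply: ereal_inf_lbound; exists k => /=.
  by apply: ereal_sup_ubound; exists k => /=.
- by rewrite -ui limn_einf_lim; exact: is_cvg_einfs.
- by rewrite -us limn_esup_lim; exact: is_cvg_esups.
Qed.

(* [limn] returns [0] at the points where the sequence does not converge. *)
Lemma measurable_limn (u : nat -> T -> R) : (forall k, measurable_fun setT (u k)) ->
  measurable_fun setT (fun x => limn (fun k => u k x)).
Proof.
move=> mu; pose s x := limn_esup (fun k => (u k x)%:E).
pose i x := limn_einf (fun k => (u k x)%:E).
have ms : measurable_fun setT s.
  by apply: measurable_fun_limn_esup => k; apply/measurable_EFinP.
have mi : measurable_fun setT i.
  rewrite /i /limn_einf; apply: measurableT_comp => //.
  apply: measurable_fun_limn_esup => k; apply: measurableT_comp => //.
  exact/measurable_EFinP.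
rewrite (_ : (fun _ => _) = (fun x => if s x == i x then fine (s x) else 0)).
  apply: measurable_fun_ifT => //; first exact: measurable_fun_eqe.
  exact: measurableT_comp.
apply/funext => x.
have [cu|ncu] := pselect (cvgn (fun k => u k x)).
  have c0 : (fun k => (u k x)%:E) @ \oo --> (limn (fun k => u k x))%:E.
    by apply: cvg_EFin => //; exact: nearW.
  by have [ei es] := cvg_limn_einf_sup c0; rewrite /s /i ei es eqxx.
have lim0 : limn (fun k => u k x) = 0.
  by rewrite /lim /lim_in/=; apply: getPN => l cl; apply: ncu; apply/cvg_ex; exists l.
rewrite lim0; case: eqP => // si.
case E : (s x) => [r| |]//; exfalso; apply: ncu; apply/cvg_ex; exists r.
have /fine_cvgP[_] : (fun k => (u k x)%:E) @ \oo --> r%:E.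
  by apply: limn_einf_sup_cvg; rewrite -?E// -si.
by apply: cvg_trans; apply: near_eq_cvg; exact: nearW.
Qed.

End MeasurableLimn.

Section Weight.
Context {R : realType}.
Variable w : R -> R.
Hypothesis hw : L2_unit_interval w.
Hypothesis hsupp : support_unit_interval w `<=` `[0, 1[.
Local Notation mu := (@lebesgue_measure R).

Definition weight : R -> R := w \_ (`[0, 1]%classic : set R).

Lemma weight_in x : 0 <= x <= 1 -> weight x = w x.
Proof. by move=> x01; rewrite /weight patchE mem_set//= in_itv. Qed.

Lemma measurable_weight : measurable_fun setT weight.
Proof. by move: hw => /andP[]; rewrite inE. Qed.

(** Since 1 is outside the closed support, some ball around it contains no zero-free argument of
    [w]. The margin [e] keeps all integrals away from 1, where [g] may be unbounded. *)
Lemma weight_vanish : exists2 e, 0 < e < 1 & forall x, ~~ (0 <= x <= 1 - e) -> weight x = 0.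
Proof.
have n1 : ~ support_unit_interval w 1.
  by move=> /hsupp/=; rewrite in_itv/= ltxx andbF.
have [B nB AB] : exists2 B, nbhs (1 : R) B & ~ ([set x | x \in `[0, 1] /\ w x != 0] `&` B !=set0).
  by apply: contrapT => H; apply: n1 => B nB; apply: contrapT => H2; apply: H; exists B.
have /nbhs_ballP[e /= e0 eB] := nB.
exists (Num.min e 2^-1); first by apply/andP; split; [rewrite lt_min e0/= invr_gt0 ltr0n|rewrite gt_min invf_lt1// ltr1n orbT].
move=> x; rewrite /weight patchE; case: ifPn => // /set_mem/=; rewrite in_itv/= => /andP[x0 x1].
rewrite x0/= -ltNge => xe; apply/eqP/negPn/negP => wx; apply: AB; exists x; split.
  by split => //; rewrite in_itv/= x0.
apply: eB; rewrite /ball/= ger0_norm ?subr_ge0//.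
have : Num.min e 2^-1 <= e by rewrite ge_min lexx.
move: (Num.min _ _) xe => m xe me; lra.
Qed.

Lemma weight_out x : ~~ (0 <= x < 1) -> weight x = 0.
Proof.
have [e /andP[e0 e1] we] := weight_vanish => x01; apply: we; apply: contra x01 => /andP[-> h]/=; lra.
Qed.

Lemma integrable_weight_sq : mu.-integrable setT (fun x => (weight x ^+ 2)%:E).
Proof. exact: Lfun2_integrable_sqr hw. Qed.

Lemma integrable_weight : mu.-integrable setT (fun x => (weight x)%:E).
Proof.
(* The majorant comes from [|w| <= 1 + w^2] on the unit interval. *)
have i1 : mu.-integrable setT (fun x => (\1_(`[0, 1]%classic : set R) x + weight x ^+ 2)%:E).
  have := integrableD measurableT (integrable_indic_itv (0 : R) 1 true false) integrable_weight_sq.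
  by apply: eq_integrable.
apply: le_integrable i1 => //.
  by apply/measurable_EFinP; exact: measurable_weight.
move=> x _; rewrite lee_fin [leRHS]ger0_norm; last by rewrite addr_ge0// sqr_ge0.
rewrite /weight patchE indicE; case: ifPn => [/set_mem/= x01|_]; last by rewrite normr0 expr0n/= addr0 ?add0r.
rewrite -[X in _ + X]real_normK ?num_real//.
by have := sqr_ge0 (`|w x| - 1); have := normr_ge0 (w x); rewrite /=; nra.
Qed.

End Weight.

Section PointIntegral.
Context {R : realType} {d : measure_display} {Omega : measurableType d}.
Variable Z : nat -> Omega -> R * R.

Lemma point_integral (f : R * R -> R) om N : measurable_fun setT f ->
  (forall j, (N <= j)%N -> f (Z j om) = 0) ->
  (point_measure Z om).-integrable setT (EFin \o f) /\
  \int[point_measure Z om]_z f z = \sum_(0 <= j < N) f (Z j om).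
Proof.
have H (h : R * R -> R) : measurable_fun setT h -> (forall z, 0 <= h z) ->
  (forall j, (N <= j)%N -> h (Z j om) = 0) ->
  (\int[point_measure Z om]_z (h z)%:E = (\sum_(0 <= j < N) h (Z j om))%:E)%E.
  move=> mh h0 hN; rewrite ge0_integral_measure_series//; last 2 first.
  - by move=> z _; rewrite lee_fin.
  - exact/measurable_EFinP.
  rewrite (eq_eseriesr (g := fun j => (h (Z j om))%:E)); last first.
    move=> j _; rewrite integral_dirac//; last exact/measurable_EFinP.
    by rewrite diracT mul1e.
  rewrite (nneseries_split 0 N); last by move=> k _; rewrite lee_fin.
  rewrite add0n eseries0 ?adde0 ?sumEFin// => j /= Nj _.
  by rewrite hN.
move=> mf fN; pose fp z := Num.max (f z) 0; pose fn z := Num.max (- f z) 0.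
have mfp : measurable_fun setT fp by exact: measurable_maxr.
have mfn : measurable_fun setT fn.
  by apply: measurable_maxr => //; exact: measurableT_comp.
have fp0 z : 0 <= fp z by rewrite le_max lexx orbT.
have fn0 z : 0 <= fn z by rewrite le_max lexx orbT.
have fE z : f z = fp z - fn z.
  by rewrite /fp /fn !maxEle; do 2!case: ifPn; lra.
have Hint (h : R * R -> R) : measurable_fun setT h -> (forall z, 0 <= h z) ->
  (forall j, (N <= j)%N -> h (Z j om) = 0) ->
  (point_measure Z om).-integrable setT (EFin \o h).
  move=> mh h0 hN; apply/integrableP; split; first exact/measurable_EFinP.
  by under eq_integral do rewrite /= ger0_norm//; rewrite H// ltry.
have fpN j : (N <= j)%N -> fp (Z j om) = 0 by move=> /fN e; rewrite /fp e maxxx.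
have fnN j : (N <= j)%N -> fn (Z j om) = 0 by move=> /fN e; rewrite /fn e oppr0 maxxx.
have ip := Hint _ mfp fp0 fpN; have ineg := Hint _ mfn fn0 fnN.
rewrite (_ : f = fun z => fp z - fn z); last by apply/funext.
split.
  by have := integrableB measurableT ip ineg; apply: eq_integrable.
by rewrite RintegralB// /Rintegral !H//= -sumrB.
Qed.

End PointIntegral.

Section IntensityIntegral2.
Context {R : realType} {d : measure_display} {Omega : measurableType d}.
Variables (n : nat) (g : R -> R) (Z : nat -> Omega -> R * R) (P : probability Omega R).
Hypothesis Mg : monotone_class g.
Hypothesis pppg : poisson_point_process P Z (intensity_measure n g).
Local Notation Lam := (Intensity n Mg).
Local Notation mu := (@lebesgue_measure R).
Local Notation ppp := (ppp_Intensity Mg pppg).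
Local Notation mZ := (ppp_measurable ppp).
Variables (om : Omega) (e : R).
Hypothesis rom : regular_above g Z om.
Hypothesis e01 : 0 < e < 1.

Let dist x := `|g_hat Z om x - g x|.

Let dist_le x : 0 <= x <= 1 - e -> dist x <= g_hat Z om (1 - e) - g 0.
Proof.
move: e01 => /andP[e0 e1] /andP[x0 x1].
have x1' : x < 1 by lra.
have x01 : 0 <= x < 1 by rewrite x0.
have h1 := regular_above_le_g_hat Mg rom x01.
have h2 : g_hat Z om x <= g_hat Z om (1 - e).
  by case: rom => r _; apply: g_hat_mono => //; lra.
have h3 : g 0 <= g x by case: Mg => gm _; apply: gm; rewrite // in_itv/= ?lexx ?ltr01.
rewrite /dist ger0_norm ?subr_ge0//; lra.
Qed.

Lemma measurable_dist (h : R -> R) : measurable_fun setT h ->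
  (forall x, ~~ (0 <= x <= 1 - e) -> h x = 0) ->
  measurable_fun setT (fun x => h x * (g_hat Z om x - g x)).
Proof.
move=> mh hout; pose gb : R -> R := g \_ (`[0, 1]%classic : set R).
have mgb : measurable_fun setT gb.
  by apply/(measurable_restrictT _ _).1 => //; exact: monotone_measurable.
rewrite (_ : (fun x => _) = fun x => h x * (g_hat Z om x - gb x)).
  apply: measurable_funM => //; apply: measurable_funB => //.
  exact: (measurableT_comp (measurable_g_hat mZ) (pair1_measurable om)).
apply/funext => x; have [/andP[x0 x1]|/hout ->] := boolP (0 <= x <= 1 - e); last by rewrite !mul0r.
rewrite /gb patchE mem_set//= in_itv/= x0 (le_trans x1)//.
by move: e01 => /andP[]; lra.
Qed.

Lemma integral_corner_Intensity_ge0 (h : R -> R) :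
  (forall x, 0 <= h x) -> mu.-integrable setT (EFin \o h) ->
  (forall x, ~~ (0 <= x <= 1 - e) -> h x = 0) ->
  [/\ Lam.-integrable setT (fun z => (h z.1 * corner Z om z)%:E),
      mu.-integrable setT (fun x => (h x * (g_hat Z om x - g x))%:E) &
      \int[Lam]_z (h z.1 * corner Z om z) =
      n%:R * \int[mu]_x (h x * (g_hat Z om x - g x))].
Proof.
move=> h0 ih hout.
have mh : measurable_fun setT h by case/integrableP: ih => /measurable_EFinP.
have hout1 x : ~~ (0 <= x < 1) -> h x = 0.
  move=> x01; apply: hout; apply: contra x01 => /andP[-> h1]/=.
  by move: e01 => /andP[]; lra.
have E x : h x * `|g_hat Z om x - g x| = h x * (g_hat Z om x - g x).
  have [x01|/hout1 ->] := boolP (0 <= x < 1); last by rewrite !mul0r.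
  by rewrite ger0_norm// subr_ge0; exact: (regular_above_le_g_hat Mg).
have md := measurable_dist mh hout.
have iE : (\int[Lam]_z (h z.1 * corner Z om z)%:E =
    n%:R%:E * \int[mu]_x (h x * (g_hat Z om x - g x))%:E)%E.
  rewrite (integral_corner_Intensity Mg pppg mh h0 hout1 rom); congr (_ * _)%E.
  by apply: eq_integral => x _; congr EFin; exact: E.
have i2 : mu.-integrable setT (fun x => (h x * (g_hat Z om x - g x))%:E).
  have iC := integrableZl measurableT (g_hat Z om (1 - e) - g 0) ih.
  apply: le_integrable iC => //; first exact/measurable_EFinP.
  move=> x _ /=; rewrite lee_fin.
  have [/dist_le x01|/hout ->] := boolP (0 <= x <= 1 - e); last by rewrite mul0r mulr0.
  rewrite normrM [leRHS]normrM mulrC ler_wpM2r//.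
  by apply: le_trans (ler_norm _).
split => //.
- apply/integrableP; split.
    apply/measurable_EFinP; apply: measurable_funM.
      exact: measurableT_comp mh measurable_fst.
    exact: (measurable_cornerr mZ).
  under eq_integral do rewrite /= ger0_norm ?mulr_ge0 ?corner_ge0//.
  rewrite iE.
  by rewrite -(fineK (integrable_fin_num measurableT i2)) -EFinM ltry.
- rewrite /Rintegral iE.
  by rewrite fineM// integrable_fin_num.
Qed.

(** The weight may change sign whereas Tonelli needs nonnegative integrands; positive and negative
    parts are treated separately. *)
Lemma integral_corner_Intensity_signed (h : R -> R) :
  mu.-integrable setT (EFin \o h) ->
  (forall x, ~~ (0 <= x <= 1 - e) -> h x = 0) ->
  [/\ Lam.-integrable setT (fun z => (h z.1 * corner Z om z)%:E),
      mu.-integrable setT (fun x => (h x * (g_hat Z om x - g x))%:E) &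
      \int[Lam]_z (h z.1 * corner Z om z) =
      n%:R * \int[mu]_x (h x * (g_hat Z om x - g x))].
Proof.
move=> ih hout.
have mh : measurable_fun setT h by case/integrableP: ih => /measurable_EFinP.
pose hp x := Num.max (h x) 0; pose hn x := Num.max (- h x) 0.
have hp0 x : 0 <= hp x by rewrite le_max lexx orbT.
have hn0 x : 0 <= hn x by rewrite le_max lexx orbT.
have hE x : h x = hp x - hn x.
  by rewrite /hp /hn !maxEle; do 2!case: ifPn; lra.
have hple x : hp x <= `|h x| by rewrite ge_max ler_norm normr_ge0.
have hnle x : hn x <= `|h x| by rewrite ge_max ler_normr lexx orbT normr_ge0.
have ihp : mu.-integrable setT (EFin \o hp).
  apply: le_integrable ih => //; first by apply/measurable_EFinP; exact: measurable_maxr.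
  by move=> x _; rewrite /= lee_fin ger0_norm.
have ihn : mu.-integrable setT (EFin \o hn).
  apply: le_integrable ih => //.
    by apply/measurable_EFinP; apply: measurable_maxr => //; exact: measurableT_comp.
  by move=> x _; rewrite /= lee_fin ger0_norm.
have [|i1 i2 i3] := integral_corner_Intensity_ge0 hp0 ihp.
  by move=> x /hout; rewrite /hp => ->; rewrite maxxx.
have [|j1 j2 j3] := integral_corner_Intensity_ge0 hn0 ihn.
  by move=> x /hout; rewrite /hn => ->; rewrite oppr0 maxxx.
have E1 : (fun z => h z.1 * corner Z om z) =
    (fun z => hp z.1 * corner Z om z - hn z.1 * corner Z om z).
  by apply/funext => z; rewrite hE mulrBl.
have E2 : (fun x => h x * (g_hat Z om x - g x)) =
    (fun x => hp x * (g_hat Z om x - g x) - hn x * (g_hat Z om x - g x)).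
  by apply/funext => x; rewrite hE mulrBl.
split.
- have := integrableB measurableT i1 j1; apply: eq_integrable => // z _.
  by rewrite /= -EFinB -mulrBl -hE.
- have := integrableB measurableT i2 j2; apply: eq_integrable => // z _.
  by rewrite /= -EFinB -mulrBl -hE.
- by rewrite E1 E2 RintegralB// RintegralB// i3 j3 mulrBr.
Qed.

End IntensityIntegral2.

Lemma has_mean_cst d (T : measurableType d) (R : realType) (P : probability T R) (c : R) :
  has_mean P (fun=> c) c.
Proof.
have := @integrable_has_mean _ _ _ P (cst c) (finite_measure_integrable_cst P c measurableT).
by rewrite (integral_cst P measurableT c%:E) -[X in (_ * X)%E]/(P setT) probability_setT mule1.
Qed.

Section MeasurableThetaHat.
Context {R : realType} {d : measure_display} {Omega : measurableType d}.
Variables (n : nat) (w : R -> R) (Z : nat -> Omega -> R * R).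
Hypothesis hw : L2_unit_interval w.
Hypothesis X01 : forall j om, (Z j om).1 \in `[0, 1].
Hypothesis mZ : forall j, measurable_fun setT (Z j).
Local Notation mu := (@lebesgue_measure R).

Lemma theta_hat_weight om : theta_hat n Z w om =
  \int[mu]_x (g_hat Z om x * weight w x) -
  n%:R^-1 * limn (fun N => \sum_(0 <= j < N)
    (g_hat Z om (Z j om).1 == (Z j om).2)%R%:R * weight w (Z j om).1).
Proof.
rewrite /theta_hat; congr (_ - _ * _).
  rewrite Rintegral_mkcond; congr (Rintegral _ _ _); apply/funext => x.
  by rewrite /weight !patchE; case: ifPn; rewrite ?mulr0.
congr (lim (_ @ \oo)); apply/funext => N; apply: eq_bigr => j _; congr (_ * _).
by rewrite weight_in//; have := X01 j om; rewrite in_itv.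
Qed.

Lemma measurable_theta_hat : measurable_fun setT (theta_hat n Z w).
Proof.
rewrite (funext theta_hat_weight).
have mg := measurable_g_hat mZ; have mw := measurable_weight hw.
pose f (p : Omega * measurableTypeR R) := (g_hat Z p.1 p.2 * weight w p.2)%:E.
have mf : measurable_fun setT f.
  apply/measurable_EFinP; apply: measurable_funM => //.
  exact: (measurableT_comp mw measurable_snd).
have mI : measurable_fun setT (fun om => (\int[mu]_x f (om, x))%E).
  rewrite (_ : (fun om => _) = (fun om => fubini_F mu (f^\+)%E om - fubini_F mu (f^\-)%E om)%E); last first.
    apply/funext => om; rewrite [LHS](@integralE _ (measurableTypeR R) R mu setT (fun x => f (om, x))) /fubini_F/=.
    by congr (_ - _)%E; apply: eq_integral => x _; rewrite ?funeposE ?funenegE. 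
  apply: emeasurable_funB; apply: measurable_fun_fubini_tonelli_F => //.
    exact/measurable_funepos.
  exact/measurable_funeneg.
apply: measurable_funB; first exact: (measurableT_comp (f := fine) _ mI).
apply: measurable_funM => //; apply: (@measurable_limn _ _ R (fun N om => \sum_(0 <= j < N)
    (g_hat Z om (Z j om).1 == (Z j om).2)%R%:R * weight w (Z j om).1)) => N.
apply: measurable_sum => j.
have mX : measurable_fun setT (fun om => (Z j om).1) by exact: (measurableT_comp measurable_fst (mZ j)).
have mY : measurable_fun setT (fun om => (Z j om).2) by exact: (measurableT_comp measurable_snd (mZ j)).
apply: measurable_funM; last exact: measurableT_comp.
apply: measurable_natr_bool; apply: measurable_fun_eqr => //.
have mp : measurable_fun setT (fun om => (om, (Z j om).1)).
  by apply: measurable_fun_pair => //; exact: measurable_id.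
exact: (measurableT_comp mg mp).
Qed.

End MeasurableThetaHat.

Section Moments.
Context {R : realType} {d : measure_display} {Omega : measurableType d}.
Variables (n : nat) (g w : R -> R) (Z : nat -> Omega -> R * R) (P : probability Omega R).
Hypothesis hw : L2_unit_interval w.
Hypothesis hsupp : support_unit_interval w `<=` `[0, 1[.
Hypothesis Mg : monotone_class g.
Hypothesis n0 : (0 < n)%N.
Hypothesis X01 : forall j om, (Z j om).1 \in `[0, 1].
Hypothesis pppg : poisson_point_process P Z (intensity_measure n g).
Local Notation Lam := (Intensity n Mg).
Local Notation mu := (@lebesgue_measure R).
Local Notation ppp := (ppp_Intensity Mg pppg).
Local Notation mZ := (ppp_measurable ppp).
Local Notation phi := (fun z : R * R => weight w z.1).

Lemma integrable_weight_g e : 0 < e < 1 ->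
  (forall x, ~~ (0 <= x <= 1 - e) -> weight w x = 0) ->
  mu.-integrable setT (fun x => (weight w x * g x)%:E).
Proof.
move=> /andP[e0 e1] we; have mw := measurable_weight hw.
pose gb : R -> R := g \_ (`[0, 1]%classic : set R).
have mgb : measurable_fun setT gb.
  by apply/(measurable_restrictT _ _).1 => //; exact: monotone_measurable.
have E x : weight w x * g x = weight w x * gb x.
  have [/andP[x0 x1]|/we ->] := boolP (0 <= x <= 1 - e); last by rewrite !mul0r.
  by rewrite /gb patchE mem_set//= in_itv/= x0 (le_trans x1)//; lra.
have iw := integrableZl measurableT (`|g 0| + `|g (1 - e)|) (integrable_weight hw).
apply: le_integrable iw => //.
  apply/measurable_EFinP; rewrite (_ : (fun x => _) = fun x => weight w x * gb x).
    exact: measurable_funM.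
  exact/funext.
move=> x _; rewrite /= lee_fin.
have [/andP[x0 x1]|/we ->] := boolP (0 <= x <= 1 - e); last by rewrite mul0r mulr0.
rewrite mulrC !normrM ler_wpM2r// [leRHS]ger0_norm ?addr_ge0//.
have [h1 h2] : g 0 <= g x /\ g x <= g (1 - e).
  by case: Mg => gm _; split; apply: gm => //; rewrite in_itv/=; apply/andP; split; lra.
have := ler_norm (g (1 - e)); have := ler_norm (- g 0); rewrite normrN.
have := normr_ge0 (g (1 - e)); have := normr_ge0 (g 0).
by rewrite ler_norml => *; apply/andP; split; lra.
Qed.

(** With [phi z = w(z.1)], the point integral of [phi * corner] is the correction sum, and the
    intensity integral is [n] times the integral of [w (g_hat - g)]. Their difference, divided by
    [-n], is the error of the estimator. *)
Lemma theta_hat_innovation om : regular_above g Z om ->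
  [/\ (point_measure Z om).-integrable setT (fun z => (phi z * corner Z om z)%:E),
      Lam.-integrable setT (fun z => (phi z * corner Z om z)%:E),
      Lam.-integrable setT (fun z => (phi z ^+ 2 * corner Z om z)%:E),
      \int[Lam]_z (phi z ^+ 2 * corner Z om z) =
        n%:R * \int[mu]_x (weight w x ^+ 2 * `|g_hat Z om x - g x|) &
      theta_hat n Z w om = theta w g - n%:R^-1 * innovation Z Lam phi om].
Proof.
move=> rom; have [r above] := rom.
have [e e01 we] := weight_vanish hsupp; have /andP[e0 e1] := e01.
have mw := measurable_weight hw.
have we2 x : ~~ (0 <= x <= 1 - e) -> weight w x ^+ 2 = 0 by move=> /we ->; rewrite expr0n.
have [i1 i2 i3] := integral_corner_Intensity_signed Mg pppg rom e01 (integrable_weight hw) we.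
have [j1 j2 j3] := integral_corner_Intensity_signed Mg pppg rom e01 (integrable_weight_sq hw) we2.
(* A contributing point is on the staircase with abscissa at most [1 - e], so its height is at most
   [g_hat (1 - e)]; there are finitely many such points. *)
have [N HN] := finite_nat_bounded (regular_finite (g_hat Z om (1 - e)) r).
have zero j : (N <= j)%N -> phi (Z j om) * corner Z om (Z j om) = 0.
  move=> Nj; have [/andP[x0 x1]|/we ->] := boolP (0 <= (Z j om).1 <= 1 - e); last by rewrite mul0r.
  rewrite corner_point//; case: eqP => [h|]; last by rewrite mulr0.
  have : (j < N)%N by apply: HN; rewrite /= -h; apply: g_hat_mono => //; lra.
  by rewrite ltnNge Nj.
have [k1 k2] := @point_integral _ _ _ Z (fun z => phi z * corner Z om z) om N
  (measurable_funM (measurableT_comp mw measurable_fst) (measurable_cornerr mZ om)) zero.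
split => //.
  rewrite j3; congr (_ * _); apply: eq_Rintegral => x _.
  have [/andP[x0 x1]|/we2 ->] := boolP (0 <= x <= 1 - e); last by rewrite !mul0r.
  rewrite ger0_norm// subr_ge0; apply: (regular_above_le_g_hat Mg) => //.
  by rewrite x0; lra.
rewrite (theta_hat_weight _ _ X01) /innovation i3 k2.
set S := limn _; have -> : S = \sum_(0 <= j < N) phi (Z j om) * corner Z om (Z j om).
  apply: cvg_lim => //; apply: cvg_near_cst; exists N => // m /= Nm.
  rewrite (@big_cat_nat _ _ _ N)//= [X in _ + X]big_nat_cond [X in _ + X]big1 ?addr0.
    by apply: eq_bigr => j _; rewrite corner_point// mulrC.
  move=> j /andP[/andP[Nj _] _]; rewrite mulrC -corner_point//; exact: zero.
have ig := integrable_weight_g e01 we.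
have -> : \int[mu]_x (g_hat Z om x * weight w x) =
    theta w g + \int[mu]_x (weight w x * (g_hat Z om x - g x)).
  have -> : theta w g = \int[mu]_x (weight w x * g x).
    rewrite /theta Rintegral_mkcond; apply: eq_Rintegral => x _.
    by rewrite /weight !patchE; case: ifPn; rewrite ?mul0r// mulrC.
  rewrite -RintegralD//; apply: eq_Rintegral => x _.
  by rewrite -mulrDr addrC subrK mulrC.
rewrite mulrBr mulKf ?pnatr_eq0 -?lt0n// opprB.
by rewrite addrAC -!addrA; congr (_ + _); rewrite addrC.
Qed.

Definition variance_value : \bar R :=
  ((n%:R^-1)%:E * \int[mu]_x ((weight w x ^+ 2)%:E * risk g Z P x))%E.

Let w2 x := weight w x ^+ 2.
Let mw2 : measurable_fun setT w2.
Proof. by apply: measurable_funX; exact: measurable_weight. Qed.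
Let w2_ge0 x : 0 <= w2 x. Proof. exact: sqr_ge0. Qed.
Let w2_out x : ~~ (0 <= x < 1) -> w2 x = 0.
Proof. by move=> /(weight_out hsupp) h; rewrite /w2 h expr0n. Qed.

Lemma weighted_risk_lty : (\int[mu]_x ((w2 x)%:E * risk g Z P x) < +oo)%E.
Proof.
have [e /andP[e0 e1] we] := weight_vanish hsupp.
(* A uniform bound for the risk on [[0, 1 - e]]: take [de = e / 2] in [risk_le], where
   [x + de <= 1 - e / 2]. *)
pose C := g (1 - e / 2) - g 0 + (n%:R * (e / 2))^-1.
have iw := integrableZl measurableT C (integrable_weight_sq hw).
apply: (@le_lt_trans _ _ (\int[mu]_x (C * w2 x)%:E)%E); last first.
  by rewrite -(fineK (integrable_fin_num measurableT iw)) ltry.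
have C0 : 0 <= C.
  rewrite /C addr_ge0//; last by rewrite invr_ge0 mulr_ge0//; lra.
  rewrite subr_ge0; case: Mg => gm _; apply: gm; rewrite ?in_itv/= ?lexx ?ltr01//; last lra.
  by apply/andP; split; lra.
apply: ge0_le_integral => //.
- by move=> x _; rewrite mule_ge0 ?risk_ge0// lee_fin.
- exact: (measurable_weighted_risk Mg n0 X01 pppg).
- by apply/measurable_EFinP; exact: measurable_funM.
move=> x _; have [/andP[x0 x1]|/we h] := boolP (0 <= x <= 1 - e); last first.
  by rewrite /w2 h expr0n/= mul0e mulr0.
rewrite [leRHS]EFinM muleC; apply: lee_wpmul2r; first by rewrite lee_fin.
have [d0 d1] : 0 < e / 2 /\ x + e / 2 < 1 by split; lra.
apply: le_trans (risk_le Mg n0 pppg x0 d0 d1) _.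
rewrite lee_fin /C lerD2r lerB//; case: Mg => gm _; apply: gm; rewrite ?in_itv/=; try (apply/andP; split; lra).
all: lra.
Qed.

Let var_ge0 : (0 <= variance_value)%E.
Proof.
rewrite /variance_value mule_ge0 ?lee_fin ?invr_ge0//.
by apply: integral_ge0 => x _; rewrite mule_ge0 ?risk_ge0// lee_fin sqr_ge0.
Qed.

Lemma variance_value_fin : variance_value \is a fin_num.
Proof.
rewrite ge0_fin_numE// /variance_value lte_mul_pinfty ?lee_fin ?invr_ge0//.
exact: weighted_risk_lty.
Qed.

(** One factor [n] comes from the density of the intensity, the other undoes the factor [1/n] inside
    [variance_value]. *)
Lemma has_mean_compensator :
  has_mean P (fun om => \int[Lam]_z (phi z ^+ 2 * corner Z om z)) (n%:R ^+ 2 * fine variance_value).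
Proof.
pose F om := (\int[mu]_x (w2 x * `|g_hat Z om x - g x|)%:E)%E.
have mF : measurable_fun setT F.
  apply: (@measurable_fun_fubini_tonelli_F _ _ Omega (measurableTypeR R) R mu
    (fun p : Omega * measurableTypeR R => (w2 p.2 * `|g_hat Z p.1 p.2 - g p.2|)%:E)).
    by apply/measurable_EFinP; exact: (measurable_weighted_dist Mg pppg).
  by move=> p; rewrite lee_fin mulr_ge0.
have F0 om : (0 <= F om)%E.
  by apply: integral_ge0 => x _; rewrite lee_fin mulr_ge0.
have aeF := ae_regular_above Mg n0 X01 pppg.
have iF := mean_integral_corner Mg n0 X01 pppg mw2 w2_ge0 w2_out.
have fF om : regular_above g Z om -> F om \is a fin_num.
  move=> rom; have [e e01 we] := weight_vanish hsupp.
  have we2 x : ~~ (0 <= x <= 1 - e) -> w2 x = 0 by move=> /we h; rewrite /w2 h expr0n.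
  have [_ j2 _] := integral_corner_Intensity_signed Mg pppg rom e01 (integrable_weight_sq hw) we2.
  rewrite (_ : F om = (\int[mu]_x (w2 x * (g_hat Z om x - g x))%:E)%E); first exact: integrable_fin_num.
  apply: eq_integral => x _; congr EFin.
  have [/andP[x0 x1]|/we2 ->] := boolP (0 <= x <= 1 - e); last by rewrite !mul0r.
  rewrite ger0_norm// subr_ge0; apply: (regular_above_le_g_hat Mg) => //.
  by rewrite x0; move: e01 => /andP[]; lra.
have hF : has_mean P (fine \o F) (n%:R * fine variance_value).
  apply: ge0_has_mean.
  - exact: measurableT_comp.
  - by move=> om; apply: fine_ge0.
  rewrite (@ge0_ae_eq_integral _ _ _ P setT _ F)//; last 3 first.
  - by apply/measurable_EFinP; exact: measurableT_comp.
  - by move=> om _; rewrite lee_fin; exact: fine_ge0.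
  - by apply: filterS aeF => om rom _ /=; rewrite fineK// fF.
  rewrite [LHS]iF EFinM fineK ?variance_value_fin// /variance_value muleA -EFinM.
  by rewrite divff ?mul1e// pnatr_eq0 -lt0n.
have := has_meanZ n%:R hF; rewrite mulrA -expr2.
apply: has_mean_ae; apply: filterS aeF => om rom.
by have [_ _ _ -> _] := theta_hat_innovation rom.
Qed.

(** The isometry with [phi z = w(z.1)]: the error of [theta_hat] is [-1/n] times the innovation, so
    its second moment is the mean compensator divided by [n^2]. *)
Lemma theta_hat_mean : has_mean P (theta_hat n Z w) (theta w g) /\
  has_mean P (fun om => (theta_hat n Z w om - theta w g) ^+ 2) (fine variance_value).
Proof.
have aeF := ae_regular_above Mg n0 X01 pppg.
have mphi : measurable_fun setT phi by exact: (measurableT_comp (measurable_weight hw) measurable_fst).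
have [|||||h1 h2] := @innovation_isometry _ _ _ P Z Lam ppp (Intensity_box Mg n0)
    (Num.truncn `|g 0|).+1 _ phi mphi _ _ _ _ _ has_mean_compensator.
- apply: filterS aeF => om [[X _ _ _] above] j; have /andP[x0 x1] := X j.
  rewrite x0 ltW//; split => //; apply: le_trans (above j).
  apply: (@le_trans _ _ (g 0)).
    have : `|g 0| < (Num.truncn `|g 0|).+1%:R by rewrite truncnS_gt.
    move: (_.+1%:R) => K; have := ler_norm (- g 0); rewrite normrN; lra.
  by case: Mg => gm _; apply: gm; rewrite // in_itv/= ?lexx ?ltr01 ?x0.
- move=> z z01; apply: (weight_out hsupp); apply/negP => /andP[a b]; apply: z01.
  by rewrite a ltW.
- by apply: filterS aeF => om /theta_hat_innovation[].
- by apply: filterS aeF => om /theta_hat_innovation[].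
- by apply: filterS aeF => om /theta_hat_innovation[].
split.
  have := has_meanB (has_mean_cst P (theta w g)) (has_meanZ n%:R^-1 h1); rewrite mulr0 subr0.
  by apply: has_mean_ae; apply: filterS aeF => om /theta_hat_innovation[_ _ _ _ ->].
have := has_meanZ (n%:R^-1 ^+ 2) h2.
rewrite mulrA -exprMn mulVf ?pnatr_eq0 -?lt0n// expr1n mul1r.
apply: has_mean_ae; apply: filterS aeF => om /theta_hat_innovation[_ _ _ _ ->].
by rewrite addrAC subrr add0r sqrrN exprMn.
Qed.

End Moments.

Lemma has_mean_expectation d (T : measurableType d) (R : realType) (P : probability T R)
    (X : T -> R) m : measurable_fun setT X -> has_mean P X m ->
  P.-integrable setT (EFin \o X) /\ ('E_P[X] = m%:E)%E.
Proof.
move=> mX /(has_mean_integral mX)[iX eX]; split => //.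
by rewrite unlock.
Qed.

Lemma has_mean_variance d (T : measurableType d) (R : realType) (P : probability T R)
    (X : T -> R) m v : measurable_fun setT X -> has_mean P X m ->
  has_mean P (fun x => (X x - m) ^+ 2) v -> ('V_P[X] = v%:E)%E.
Proof.
move=> mX /(has_mean_expectation mX)[iX eX] hv.
rewrite /variance unlock eX/=.
have [_] := has_mean_expectation (measurable_funX 2 (measurable_funB mX (measurable_cst m))) hv.
by move=> <-; congr expectation.body; apply/funext => x; rewrite /= expr2.
Qed.

Section Variance.
Context {R : realType} {d : measure_display} {Omega : measurableType d}.
Variables (n : nat) (g w : R -> R) (Z : nat -> Omega -> R * R) (P : probability Omega R).
Hypothesis hw : L2_unit_interval w.
Hypothesis hsupp : support_unit_interval w `<=` `[0, 1[.
Hypothesis Mg : monotone_class g.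
Hypothesis n0 : (0 < n)%N.
Hypothesis X01 : forall j om, (Z j om).1 \in `[0, 1].
Hypothesis pppg : poisson_point_process P Z (intensity_measure n g).
Local Notation mu := (@lebesgue_measure R).
Local Notation mZ := (ppp_measurable (ppp_Intensity Mg pppg)).
Local Notation mth := (measurable_theta_hat n hw X01 mZ).

Lemma theta_hat_unbiased :
  P.-integrable setT (EFin \o theta_hat n Z w) /\ ('E_P[theta_hat n Z w] = (theta w g)%:E)%E.
Proof. by apply: has_mean_expectation mth _; case: (theta_hat_mean hw hsupp Mg n0 X01 pppg). Qed.

Lemma theta_hat_variance : ('V_P[theta_hat n Z w] = variance_value n g w Z P)%E.
Proof.
have [h1 h2] := theta_hat_mean hw hsupp Mg n0 X01 pppg.
by rewrite (has_mean_variance mth h1 h2) fineK// variance_value_fin.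
Qed.

Lemma expectation_g_hat x : 0 <= x < 1 -> ('E_P[fun om => (g_hat Z om x - g x)%R] = risk g Z P x)%E.
Proof.
move=> x01; rewrite -(mean_g_hat Mg n0 X01 pppg x01) unlock.
have md : measurable_fun setT (fun om => g_hat Z om x - g x).
  by apply: measurable_funB => //; exact: (measurable_g_hat_section Mg pppg).
apply: ae_eq_integral => //.
- exact/measurable_EFinP.
- by apply/measurable_EFinP; exact: measurableT_comp.
apply: filterS (ae_regular_above Mg n0 X01 pppg) => om rom _ /=.
by rewrite ger0_norm// subr_ge0; exact: (regular_above_le_g_hat Mg).
Qed.

Lemma variance_valueE : variance_value n g w Z P =
  ((n%:R^-1)%:E * \int[mu]_(x in `[0%R, 1%R])
     ('E_P[fun om => (g_hat Z om x - g x)%R] * (w x ^+ 2)%:E))%E.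
Proof.
rewrite /variance_value [in RHS]integral_mkcond; congr (_ * _)%E.
apply: eq_integral => x _; rewrite patchE; case: ifPn => [/set_mem/=|]; last first.
  by move=> x01; rewrite /weight patchE (negbTE x01) expr0n/= mul0e.
rewrite in_itv/= => x01; rewrite weight_in// muleC.
have [xx|h] := boolP (0 <= x < 1); first by rewrite expectation_g_hat.
by have := weight_out hsupp h; rewrite weight_in// => ->; rewrite expr0n/= !mule0.
Qed.

End Variance.

(** * The bound of order [n^(-3/2)] *)

Section RealFacts.
Context {R : realType}.
Local Notation mu := (@lebesgue_measure R).

(* [1 / 2 = sin (pi / 4) ^+ 2 <= (pi / 4) ^+ 2], i.e. [pi >= 2 sqrt 2]. *)
Lemma pi_ge_8_3 : (8 / 3 : R) <= pi.
Proof.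
have p0 := @pi_gt0 R; set y : R := pi / 4.
have y0 : 0 < y by rewrite divr_gt0.
have piE : pi = 4 * y by rewrite /y mulrC divfK.
clearbody y.
have siny : sin y <= y.
  have [|c cI e] := @MVT R sin cos 0 y y0.
  - by apply: continuous_subspaceT => x; exact: continuous_sin.
  by move: e; rewrite sin0 !subr0 => ->; rewrite ler_piMl ?cos_le1// ltW.
have siny0 : 0 <= sin y by apply: sin_ge0_pi; rewrite (ltW y0)/= piE; lra.
have : cos (pi / 2) = 0 :> R by exact: cos_pihalf.
have -> : pi / 2 = y *+ 2 by rewrite piE -[RHS]mulr_natr; lra.
rewrite cos_mulr2n cos2sin2 => h.
have h2 : 2^-1 <= y ^+ 2.
  have : sin y ^+ 2 <= y ^+ 2 by rewrite lerXn2r// nnegrE// ltW.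
  by move: h; rewrite -mulr_natr; lra.
rewrite leNgt; apply/negP => pl.
have yl : y < 2 / 3 by move: pl; rewrite piE; lra.
by move: h2; rewrite expr2; nra.
Qed.

(** The image of Lebesgue measure under a translation agrees with it on half-open intervals, hence
    everywhere. *)
Lemma ge0_integral_shift (f : R -> \bar R) (c : R) : measurable_fun setT f ->
  (forall x, (0 <= f x)%E) -> (\int[mu]_x f (x + c)%R = \int[mu]_x f x)%E.
Proof.
move=> mf f0.
pose phi (x : measurableTypeR R) : measurableTypeR R := x + c.
have mphi : measurable_fun setT phi by exact: measurable_funD.
have := @ge0_integral_pushforward _ _ (measurableTypeR R) (measurableTypeR R) R phi mphi mu
  setT f measurableT mf (fun y _ => f0 y).
rewrite preimage_setT => <-; apply: eq_measure_integral => A mA _.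
apply/esym; pose nu := measure_function_pushforward__canonical__measure_function_Measure mu mphi.
apply: (@lebesgue_measure_unique R nu) => //= X [[a b] /= ab <-].
rewrite /pushforward.
have -> : phi @^-1` `]a, b]%classic = `](a - c), (b - c)]%classic.
  by apply/seteqP; split => x; rewrite /phi/= !in_itv/= ltrBlDr lerBrDr.
rewrite !lebesgue_measure_itv/= !lte_fin ltrD2r; case: ifPn => // _.
by rewrite -!EFinB; congr EFin; lra.
Qed.

(** The two cases in which the extended real limit [g(1)] exists: an unbounded [g] makes the
    asymptotic bound infinite, a bounded one provides a real upper bound [l]. *)
Lemma monotone_limit (g : R -> R) : monotone_class g ->
  lim ((g x)%:E @[x --> 1%R^'-]) = +oo%E \/
  exists2 l, lim ((g x)%:E @[x --> 1%R^'-]) = l%:E & forall x, 0 <= x < 1 -> g x <= l.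
Proof.
move=> [gm _].
have [[C gC]|nb] := pselect (exists C, forall x, 0 <= x < 1 -> g x <= C); [right|left].
  have cg : cvg (g x @[x --> 1^'-]).
    apply: nondecreasing_at_left_is_cvgr.
      apply: filterS (nbhs_left_gt (@ltr01 R)) => x x0 y z.
      rewrite !in_itv/= => /andP[xy y1] /andP[xz z1].
      by apply: gm; rewrite in_itv/= ?y1 ?z1 andbT ltW// (lt_trans x0).
    apply: filterS (nbhs_left_gt (@ltr01 R)) => x x0.
    exists C => z [y /=]; rewrite in_itv/= => /andP[xy y1] <-.
    by apply: gC; rewrite y1 andbT ltW// (lt_trans x0).
  exists (lim (g x @[x --> 1^'-])).
    by apply/cvg_lim => //; apply: cvg_EFin => //; exact: nearW.
  move=> x /andP[x0 x1]; apply: limr_ge => //.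
  apply: filterS2 (nbhs_left_gt x1) (nbhs_left_lt 1); move=> y xy y1.
  by apply: gm; rewrite ?in_itv/= ?x0 ?x1 ?y1 ?(le_trans x0 (ltW xy))// ltW.
apply/cvg_lim => //; apply/cvgeyPge => M.
have [x [/andP[x0 x1] Mx]] : exists x, 0 <= x < 1 /\ M < g x.
  apply: contrapT => H; apply: nb; exists M => x x01; rewrite leNgt; apply/negP => Mx.
  by apply: H; exists x.
apply: filterS2 (nbhs_left_gt x1) (nbhs_left_lt 1); move=> y xy y1.
rewrite lee_fin (le_trans (ltW Mx))//.
by apply: gm; rewrite ?in_itv/= ?x0 ?x1 ?y1 ?(le_trans x0 (ltW xy))// ltW.
Qed.

End RealFacts.

Section VarianceBound.
Context {R : realType} {d : measure_display} {Omega : measurableType d}.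
Variables (n : nat) (g w : R -> R) (Z : nat -> Omega -> R * R) (P : probability Omega R).
Hypothesis hw : L2_unit_interval w.
Hypothesis hsupp : support_unit_interval w `<=` `[0, 1[.
Hypothesis Mg : monotone_class g.
Hypothesis n0 : (0 < n)%N.
Hypothesis X01 : forall j om, (Z j om).1 \in `[0, 1].
Hypothesis pppg : poisson_point_process P Z (intensity_measure n g).
Local Notation mu := (@lebesgue_measure R).

(** Integrate [risk_le] over [[0, 1 - e]]. After a translation by [de], the integrals of
    [g (x + de)] and of [g x] overlap except on stretches of length [de], which leaves at most
    [de (l - g 0)]. *)
Lemma variance_value_le (e S l de : R) : 0 < de < e -> e < 1 ->
  (forall x, ~~ (0 <= x <= 1 - e) -> weight w x = 0) ->
  (forall x, `|weight w x| <= S) -> (forall x, 0 <= x < 1 -> g x <= l) ->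
  (variance_value n g w Z P <= (n%:R^-1 * (S ^+ 2 * (de * (l - g 0) + (n%:R * de)^-1)))%:E)%E.
Proof.
move=> /andP[d0 de_e] e1 we wS gl; have mw := measurable_weight hw.
have gm x y : 0 <= x -> x <= y -> y < 1 -> g x <= g y.
  by case: Mg => gm _ x0 xy y1; apply: gm; rewrite // in_itv/= ?x0 ?y1 ?(le_lt_trans xy)// (le_trans x0).
have gl0 : 0 <= l - g 0 by rewrite subr_ge0 gl// lexx ltr01.
have c0 : 0 <= (n%:R * de)^-1 by rewrite invr_ge0 mulr_ge0// ltW.
set c := (n%:R * de)^-1 in c0 *.
pose gb : R -> R := g \_ (`[0, 1]%classic : set R).
have mgb : measurable_fun setT gb.
  by apply/(measurable_restrictT _ _).1 => //; exact: monotone_measurable.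
have gbE x : 0 <= x < 1 -> gb x = g x.
  by move=> /andP[x0 x1]; rewrite /gb patchE mem_set//= in_itv/= x0 ltW.
(* Subtracting [g 0] makes the integrand nonnegative on [[a, b]], so that integrals add up without
   integrability conditions. *)
pose H (a b x : R) : R := (a <= x <= b)%R%:R * (gb x - g 0).
have mH a b : measurable_fun setT (H a b).
  apply: measurable_funM; last exact: measurable_funB.
  by apply: measurable_natr_bool; apply: measurable_and; exact: measurable_fun_ler.
have H0 a b x : 0 <= a -> b < 1 -> 0 <= H a b x.
  move=> a0 b1; rewrite /H; case: andP => [[ax xb]|]; last by rewrite mul0r.
  rewrite mul1r gbE ?subr_ge0 ?gm// ?(le_trans a0 ax) ?(le_lt_trans xb b1)//.
have S0 : 0 <= S by apply: le_trans (wS 0).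
pose I01 (a b x : R) : R := (a <= x <= b)%R%:R.
have mI01 a b : measurable_fun setT (I01 a b).
  by apply: measurable_natr_bool; apply: measurable_and; exact: measurable_fun_ler.
have iI01 a b : a <= b -> (\int[mu]_x (I01 a b x)%:E = (b - a)%:E)%E.
  by move=> ab; rewrite -(integral_segment ab).
have iZI01 a b k : 0 <= k -> a <= b -> (\int[mu]_x (k * I01 a b x)%:E = (k * (b - a))%:E)%E.
  move=> k0 ab; under eq_integral do rewrite EFinM.
  rewrite ge0_integralZl_EFin ?iI01//; first by move=> x _; rewrite lee_fin.
  by apply/measurable_EFinP; exact: mI01.
pose f x := ((weight w x ^+ 2)%:E * risk g Z P x)%E.
have mf : measurable_fun setT f.
  apply: (measurable_weighted_risk Mg n0 X01 pppg).
  - exact: measurable_funX.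
  - by move=> x; exact: sqr_ge0.
  - by move=> x h; rewrite (weight_out hsupp h) expr0n.
have f0 x : (0 <= f x)%E by rewrite mule_ge0 ?risk_ge0// lee_fin sqr_ge0.
have H1 : (\int[mu]_x (H 0 (1 - e) x)%:E < +oo)%E.
  apply: (@le_lt_trans _ _ (\int[mu]_x ((l - g 0) * I01 0 (1 - e) x)%:E)%E).
    apply: ge0_le_integral => //.
    - by move=> x _; rewrite lee_fin H0//; lra.
    - by apply/measurable_EFinP; (exact: mH || exact: mI01).
    - by apply/measurable_EFinP; apply: measurable_funM => //; (exact: mH || exact: mI01).
    move=> x _; rewrite lee_fin /H /I01; case: andP => [[ax xb]|]; last by rewrite mul0r mulr0.
    have x1 : x < 1 by lra.
    by rewrite mul1r mulr1 gbE ?ax// lerB// gl// ax.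
  by rewrite iZI01 ?ltry//; lra.
(* The integral of [g - g 0] over [[0, 1 - e]] is added to both sides instead of being subtracted
   from one; it is finite and is cancelled at the end. *)
have key : (\int[mu]_x f x + (S ^+ 2)%:E * \int[mu]_x (H 0 (1 - e) x)%:E <=
    (S ^+ 2)%:E * (\int[mu]_x (H 0 (1 - e) x)%:E + (de * (l - g 0) + c)%:E))%E.
  apply: (@le_trans _ _ (\int[mu]_x ((S ^+ 2) * (H de (1 - e + de) (x + de) + c * I01 0 1 x))%:E)%E).
    rewrite -ge0_integralZl_EFin ?sqr_ge0//; last 2 first.
    - by move=> x _; rewrite lee_fin H0//; lra.
    - by apply/measurable_EFinP; (exact: mH || exact: mI01).
    rewrite -ge0_integralD//; last 2 first.
    - move=> x _; rewrite mule_ge0// lee_fin; first exact: sqr_ge0.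
      by rewrite H0//; lra.
    - by apply/measurable_EFinP; apply: measurable_funM => //; (exact: mH || exact: mI01).
    apply: ge0_le_integral => //.
    - move=> x _; rewrite adde_ge0// mule_ge0// lee_fin; first exact: sqr_ge0.
      by rewrite H0//; lra.
    - apply: emeasurable_funD => //; apply/measurable_EFinP.
      by apply: measurable_funM => //; (exact: mH || exact: mI01).
    - apply/measurable_EFinP; apply: measurable_funM => //; apply: measurable_funD.
        by apply: (measurableT_comp (mH _ _)); exact: measurable_funD.
      by apply: measurable_funM => //; (exact: mH || exact: mI01).
    move=> x _; rewrite /f.
    have [x01|x01] := boolP (0 <= x <= 1 - e); last first.
      rewrite we// expr0n/= mul0e add0e -EFinM lee_fin ler_wpM2l ?sqr_ge0//.
      rewrite {1}/H (negbTE x01) mul0r.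
      by apply: addr_ge0; [apply: H0; lra|rewrite mulr_ge0].
    have /andP[x0 x1] := x01; have [xd x1'] : x + de < 1 /\ x < 1 by split; lra.
    have := risk_le Mg n0 pppg x0 d0 xd; rewrite -/c => rl.
    apply: (@le_trans _ _ ((S ^+ 2)%:E * (g (x + de) - g x + c)%:E + (S ^+ 2)%:E * (H 0 (1 - e) x)%:E)%E).
      rewrite leeD2r//; apply: lee_pmul => //; rewrite ?lee_fin ?sqr_ge0 ?risk_ge0//.
      by rewrite -real_normK ?num_real// lerXn2r ?nnegrE// wS.
    rewrite -!EFinM -EFinD lee_fin -mulrDr ler_wpM2l ?sqr_ge0//.
    have -> : H 0 (1 - e) x = g x - g 0 by rewrite /H x01 mul1r gbE// x0.
    have -> : H de (1 - e + de) (x + de) = g (x + de) - g 0.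
      rewrite /H gbE ?xd ?addr_ge0// ?(ltW d0)//.
      by rewrite (_ : _ && _ = true) ?mul1r//; apply/andP; split; lra.
    have -> : I01 0 1 x = 1 by rewrite /I01 x0 ltW.
    lra.
  under eq_integral do rewrite EFinM.
  rewrite ge0_integralZl_EFin ?sqr_ge0//; last 2 first.
  - move=> x _; rewrite lee_fin; apply: addr_ge0; first by apply: H0; lra.
    by rewrite mulr_ge0.
  - apply/measurable_EFinP; apply: measurable_funD; last by apply: measurable_funM => //; exact: mI01.
    by apply: (measurableT_comp (mH _ _)); exact: measurable_funD.
  apply: lee_wpmul2l; first by rewrite lee_fin sqr_ge0.
  under eq_integral do rewrite EFinD.
  rewrite ge0_integralD//; last 4 first.
  - by move=> x _; rewrite lee_fin H0//; lra.
  - apply/measurable_EFinP.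
    by apply: (measurableT_comp (mH _ _)); exact: measurable_funD.
  - by move=> x _; rewrite lee_fin mulr_ge0.
  - by apply/measurable_EFinP; apply: measurable_funM => //; exact: mI01.
  rewrite iZI01// subr0 mulr1 EFinD addeA leeD2r//.
  rewrite (@ge0_integral_shift _ (fun x => (H de (1 - e + de) x)%:E)); last 2 first.
  - by apply/measurable_EFinP; (exact: mH || exact: mI01).
  - by move=> x; rewrite lee_fin H0//; lra.
  (* The shifted integral protrudes beyond [1 - e] by a stretch of length [de], on which [g - g 0]
     is at most [l - g 0]. *)
  have dE : (de * (l - g 0))%:E = (\int[mu]_x ((l - g 0) * I01 (1 - e) (1 - e + de) x)%:E)%E.
    by rewrite iZI01//; [congr EFin; lra|lra].
  rewrite dE -ge0_integralD//; last 4 first.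
  - by move=> x _; rewrite lee_fin H0//; lra.
  - by apply/measurable_EFinP; (exact: mH || exact: mI01).
  - by move=> x _; rewrite lee_fin mulr_ge0.
  - by apply/measurable_EFinP; apply: measurable_funM => //; (exact: mH || exact: mI01).
  apply: ge0_le_integral => //.
  - by move=> x _; rewrite lee_fin H0//; lra.
  - by apply/measurable_EFinP; (exact: mH || exact: mI01).
  - apply: emeasurable_funD; apply/measurable_EFinP; first exact: mH.
    by apply: measurable_funM => //; exact: mI01.
  move=> x _; rewrite -EFinD lee_fin {1}/H.
  have [/andP[x0 x1]|_] := boolP (de <= x <= 1 - e + de); last first.
    rewrite mul0r; apply: addr_ge0; first by apply: H0; lra.
    by rewrite mulr_ge0.
  have x01 : 0 <= x < 1 by apply/andP; split; lra.
  rewrite mul1r gbE// /I01; have [xe|xe] := leP x (1 - e).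
    rewrite /H xe andbT (le_trans (ltW d0) x0) mul1r gbE// lerDl mulr_ge0//.
  rewrite (ltW xe) x1/= mulr1 -[leLHS]add0r lerD// ?H0//; [lra|].
  by rewrite lerB// gl.
have hfin : ((S ^+ 2)%:E * \int[mu]_x (H 0 (1 - e) x)%:E)%E \is a fin_num.
  rewrite fin_numM// ge0_fin_numE//; apply: integral_ge0 => x _.
  by rewrite lee_fin H0//; lra.
rewrite /variance_value EFinM lee_pmul2l ?lte_fin ?invr_gt0 ?ltr0n// EFinM.
rewrite -(leeD2rE _ _ hfin) -[X in (_ <= X)%E]muleDr ?fin_num_adde_defr//.
by apply: le_trans key _; rewrite addeC.
Qed.

End VarianceBound.

Section Asymptotics.
Context {R : realType} {d : measure_display}.
Variables (w g : R -> R).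
Hypothesis hw : L2_unit_interval w.
Hypothesis hsupp : support_unit_interval w `<=` `[0, 1[.
Hypothesis wbnd : exists C : R, forall x, x \in `[0, 1] -> `|w x| <= C.
Hypothesis Mg : monotone_class g.
Variables (Omega : nat -> measurableType d) (Z : forall n, nat -> Omega n -> R * R)
  (P : forall n, probability (Omega n) R).
Hypothesis X01 : forall n, (0 < n)%N -> forall j om, (@Z n j om).1 \in `[0, 1].
Hypothesis pppg : forall n, (0 < n)%N ->
  poisson_point_process (P n) (@Z n) (intensity_measure n g).

Lemma sup_norm_weight x : `|weight w x| <= sup_norm w.
Proof.
have [C wC] := wbnd.
have hub : has_ubound [set `|w x| | x in `[0, 1]] by exists C => _ [y y01 <-]; exact: wC.
rewrite /weight patchE; case: ifPn => [/set_mem x01|_].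
  by apply: ub_le_sup => //; exists x.
rewrite normr0; apply: (@le_trans _ _ `|w 0|) => //.
by apply: ub_le_sup => //; exists 0 => //; rewrite /= in_itv/= lexx ler01.
Qed.

(** Write [V = g(1) - g(0)]. The shift [de = (n V)^(-1/2)] balances the two terms of
    [variance_value_le] and gives [2 sqrt V S^2 n^(-3/2)], where [2 <= sqrt (3 pi / 2)]. The cases
    [S = 0], [V] infinite and [V = 0] are separated off; only the last one uses the remainder of
    order [n^(-2)]. *)
Lemma variance_asymptotics : exists K : R, \forall n \near \oo,
  (variance_value n g w (@Z n) (P n) <=
      poweR ((3 * pi / 2)%:E * (lim ((g x)%:E @[x --> 1%R^'-]) - (g 0)%:E)) 2^-1
        * (sup_norm w ^+ 2 * n%:R `^ (- (3 / 2)))%:E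
      + (K * n%:R ^- 2)%:E)%E.
Proof.
have [e /andP[e0 e1] we] := weight_vanish hsupp.
have wS := sup_norm_weight; set S := sup_norm w in wS *.
have S0 : 0 <= S by apply: le_trans (wS 0).
have p0 : 0 < 3 * pi / 2 :> R by rewrite divr_gt0// mulr_gt0// pi_gt0.
(* This case comes before the infinite limit: there the right side is infinite only if [S] is
   nonzero, as zero times infinity is 0. *)
have [S_eq0|S_neq0] := eqVneq S 0.
  exists 0; exists 1%N => // n /= n0.
  rewrite S_eq0 expr0n/= !mul0r mule0 adde0.
  rewrite /variance_value integral0_eq ?mule0// => x _.
  have : `|weight w x| <= 0 by rewrite -S_eq0.
  by rewrite normr_le0 => /eqP ->; rewrite expr0n/= mul0e.
have [->|[l -> gl]] := monotone_limit Mg.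
  exists 0; exists 1%N => // n /= n0.
  rewrite addye// gt0_muley ?lte_fin// poweRyr ?invr_eq0 ?pnatr_eq0//.
  rewrite gt0_mulye ?lte_fin ?mulr_gt0 ?exprn_gt0 ?powR_gt0 ?ltr0n ?lt0r ?S_neq0//.
  by rewrite mul0r adde0 leey.
rewrite -EFinB -EFinM poweR_EFin.
set V := l - g 0.
have V0 : 0 <= V by rewrite subr_ge0 gl// lexx ltr01.
have [V_eq0|V_neq0] := eqVneq V 0.
  (* For constant [g] a fixed shift [e / 2] already gives order [n^(-2)], and this is the constant
     in front. *)
  exists (S ^+ 2 * (e / 2)^-1); exists 1%N => // n /= n0.
  have de : 0 < e / 2 < e by apply/andP; split; lra.
  apply: le_trans (variance_value_le hw hsupp Mg n0 (X01 n0) (pppg n0) de e1 we wS gl) _.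
  rewrite -/V V_eq0 mulr0 add0r -EFinM -EFinD lee_fin.
  rewrite mulr0 powR0 ?invr_eq0 ?pnatr_eq0// mul0r add0r invfM.
  rewrite -exprVn expr2; move: (n%:R^-1) (_ / 2)^-1 => q k; lra.
exists 0; have Vgt0 : 0 < V by rewrite lt0r V_neq0.
(* From here on [n V (e / 2)^2 >= 1], so the shift [(r v)^(-1) = (n V)^(-1/2)] is at most [e / 2]
   and thus admissible. *)
have [N _ HN] := near_natr_mul_ge (mulr_gt0 Vgt0 (exprn_gt0 2 (divr_gt0 e0 (@ltr0n R 2)))).
exists N.+1 => // -[//|m] /= Nm; have := HN _ Nm.
set n := m.+1; move=> nV.
have n0 : (0 < n)%N by [].
pose r : R := Num.sqrt n%:R; pose v := Num.sqrt V.
have r0 : 0 < r by rewrite sqrtr_gt0 ltr0n.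
have v0 : 0 < v by rewrite sqrtr_gt0.
have rE : n%:R = r ^+ 2 by rewrite sqr_sqrtr.
have vE : V = v ^+ 2 by rewrite sqr_sqrtr.
have rv0 : 0 < r * v by rewrite mulr_gt0.
have rve : 1 <= r * v * (e / 2).
  have rve0 : 0 <= r * v * (e / 2) by apply/ltW; rewrite mulr_gt0// divr_gt0.
  rewrite leNgt; apply/negP => h.
  have : (r * v * (e / 2)) ^+ 2 < 1 by rewrite exprn_ilt1.
  by rewrite 2!exprMn -rE -vE -mulrA ltNge nV.
have de : 0 < (r * v)^-1 < e.
  rewrite invr_gt0 rv0/= -[ltLHS]mulr1 -[ltRHS](mulKf (lt0r_neq0 rv0)).
  rewrite ltr_pM2l ?invr_gt0// (lt_le_trans (ltr1n _ 2))//.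
  by move: rve; rewrite mulrA ler_pdivlMr// mul1r.
apply: le_trans (variance_value_le hw hsupp Mg n0 (X01 n0) (pppg n0) de e1 we wS gl) _.
rewrite -/V -EFinM -EFinD lee_fin mul0r addr0.
have -> : (n%:R : R) `^ (- (3 / 2)) = n%:R^-1 * r^-1.
  rewrite (_ : 3 / 2 = 1 + 2^-1); last lra.
  rewrite powRN powRD; last by rewrite implybE pnatr_eq0 orbT.
  by rewrite powRr1// powR12_sqrt// invfM.
rewrite powR12_sqrt; last by rewrite mulr_ge0// ltW.
rewrite sqrtrM ?(ltW p0)// -/v.
have h : 2 <= Num.sqrt (3 * pi / 2 : R).
  rewrite -[leLHS]ger0_norm// -sqrtr_sqr ler_sqrt ?(ltW p0)//.
  have := @pi_ge_8_3 R; rewrite -natrX (_ : (2 ^ 2 = 4)%N)//; move: pi => p; lra.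
have -> : (r * v)^-1 * V + (n%:R * (r * v)^-1)^-1 = 2 * v * r^-1.
  rewrite vE rE !invfM !invrK.
  have := mulVf (lt0r_neq0 r0); have := mulVf (lt0r_neq0 v0).
  move: (r^-1) (v^-1) => a b bv ar.
  transitivity (a * v * (b * v) + a * v * (a * r)); first by rewrite !expr2; lra.
  by rewrite bv ar; lra.
have c0 : 0 <= S ^+ 2 * (n%:R^-1 / r) by rewrite mulr_ge0 ?sqr_ge0// divr_ge0// ltW.
apply: le_trans (ler_wpM2r c0 (ler_wpM2r (ltW v0) h)).
by move: (n%:R^-1) (r^-1) => q a; lra.
Qed.

End Asymptotics.

(** * Void events determine the observation *)

Section AtLeast.
Context {R : realType} {d : measure_display} {Omega : measurableType d}.
Variable Z : nat -> Omega -> R * R.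
Implicit Types (B : set (R * R)) (om : Omega).

Lemma counting_geP (J : set nat) k : (k%:R%:E <= counting J :> \bar R)%E <->
  exists s : seq nat, [/\ uniq s, size s = k & forall j, j \in s -> J j].
Proof.
split=> [|[s [us <- sJ]]].
  rewrite /counting; case: ifPn => [/asboolP fJ|/asboolPn/infinite_set_fset nJ _].
    rewrite lee_fin ler_nat => kJ; exists (take k (enum_fset (fset_set J))).
    split; first by rewrite take_uniq// fset_uniq.
      by rewrite size_takel.
    by move=> j /mem_take jJ; have : j \in fset_set J by []; rewrite in_fset_set// => /set_mem.
  have [A AJ kA] := nJ k; exists (take k (enum_fset A)).
  split; first by rewrite take_uniq// fset_uniq.
    by rewrite size_takel.
  by move=> j /mem_take jA; exact: AJ.
have sJ' : [set` s] `<=` J by move=> j /= /sJ.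
have -> : (size s)%:R%:E = counting [set` s] :> \bar R.
  rewrite /counting asboolT//; last exact: finite_seq.
  congr (_%:R%:E); have <- : [set` [fset j | j in s]%fset] = [set` s].
    by apply/seteqP; split => j /=; rewrite inE.
  by rewrite set_fsetK card_fseq undup_id.
by apply: le_measure; rewrite ?inE.
Qed.

Lemma seq_lt_bound (f : nat -> R) (s : seq nat) y : (forall j, j \in s -> f j < y) ->
  exists2 q : rat, ratr q < y & forall j, j \in s -> f j < ratr q.
Proof.
move=> fy.
have [r ry rs] : exists2 r, r < y & forall j, j \in s -> f j <= r.
  elim: s fy => [_|j s IH fy]; first by exists (y - 1) => //; rewrite ltrBlDr ltrDl.
  have [|r ry rs] := IH; first by move=> i si; apply: fy; rewrite inE si orbT.
  exists (Num.max (f j) r); first by rewrite gt_max ry fy// mem_head.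
  move=> i; rewrite inE => /orP[/eqP ->|/rs ri]; first by rewrite le_max lexx.
  by rewrite le_max ri orbT.
have [q] := rat_in_itvoo ry; rewrite in_itv/= => /andP[rq qy].
by exists q => // j /rs h; exact: le_lt_trans h rq.
Qed.

(** Among [k + 1] points of distinct heights, a rational height separates the highest one from the
    others. Rational levels make the existential a countable union. *)
Lemma point_count_geS B k om : (forall i j, (Z i om).2 = (Z j om).2 -> i = j) ->
  (k.+1%:R%:E <= point_count Z B om)%E <->
  exists q : rat, (k%:R%:E <= point_count Z (B `&` [set z | (z.2 < ratr q)%R]) om)%E /\
    ~ void Z (B `&` [set z | (ratr q : R) <= z.2]) om.
Proof.
move=> ties; split=> [/counting_geP[s [us sk sB]]|[q [/counting_geP[s [us <- sB]] nv]]].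
  have [||i /= si imax] := @argmin_lt R (fun j => - (Z j om).2) [set` s] (\max_(j <- s) j).+1.
  - by move=> j /= sj; rewrite ltnS; exact: (leq_bigmax_seq (F := id)).
  - by case: s sk {us sB} => // j s _; exists j; rewrite /= mem_head.
  have [|q qi qs] := @seq_lt_bound (fun j => (Z j om).2) (rem i s) (Z i om).2.
    move=> j; rewrite mem_rem_uniq// inE => /andP[ji sj].
    rewrite lt_neqAle -lerN2 imax//= andbT; apply: contra ji => /eqP/ties/eqP//.
  exists q; split.
    apply/counting_geP; exists (rem i s); split; first exact: rem_uniq.
      by rewrite size_rem// sk.
    by move=> j sj; split; [apply: sB; exact: mem_rem sj|exact: qs].
  by move=> /(_ i); apply; split; [exact: sB|exact: ltW].
have [j [Bj qj]] : exists j, B (Z j om) /\ (ratr q : R) <= (Z j om).2.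
  by apply: contrapT => H; apply: nv => j [Bj qj]; apply: H; exists j.
apply/counting_geP; exists (j :: s); split => //=.
  rewrite us andbT; apply/negP => /sB[_ /=]; by rewrite ltNge qj.
by move=> i; rewrite inE => /orP[/eqP -> //|/sB[]].
Qed.

Definition void_events : set (set Omega) := [set void Z B | B in measurable].

Lemma void_eventsI : setI_closed void_events.
Proof.
move=> _ _ [A mA <-] [B mB <-]; exists (A `|` B); first exact: measurableU.
exact: voidU.
Qed.

(** Induction on [k] through [point_count_geS]: each step adds one void event per rational level.
    This is the core of the fact that void probabilities determine a point process without multiple
    points. *)
Lemma point_count_ge_void B k : measurable B -> exists2 A, <<s void_events >> A &
  forall om, (forall i j, (Z i om).2 = (Z j om).2 -> i = j) ->
    ((k%:R%:E <= point_count Z B om)%E <-> A om).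
Proof.
have sV B' : measurable B' -> <<s void_events >> (void Z B').
  by move=> mB; apply: sub_sigma_algebra; exists B'.
have my (q : R) : measurable [set z : R * R | z.2 < q].
  rewrite (_ : [set _ | _] = setT `*` `]-oo, q[%classic); first exact: measurableX.
  by apply/seteqP; split => z /=; rewrite in_itv/=; [split|case].
have my' (q : R) : measurable [set z : R * R | q <= z.2].
  rewrite (_ : [set _ | _] = ~` [set z | z.2 < q]); first exact: measurableC.
  by apply/seteqP; split => z /=; [rewrite leNgt => /negP|move=> /negP; rewrite -leNgt].
elim: k B => [|k IH] B mB.
  exists setT; last by move=> om _; split=> // _; rewrite point_countE; exact: measure_ge0.
  have := sV set0 measurable0; congr (<<s _ >> _).
  by apply/seteqP; split => // om _ j.
have /choice[A HA] : forall q : rat, exists A, <<s void_events >> A /\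
  forall om, (forall i j, (Z i om).2 = (Z j om).2 -> i = j) ->
    ((k%:R%:E <= point_count Z (B `&` [set z | (z.2 < ratr q)%R]) om)%E <-> A om).
  by move=> q; have [|A h1 h2] := IH (B `&` [set z | z.2 < ratr q]);
    [exact: measurableI|exists A].
pose C q := A q `&` ~` void Z (B `&` [set z | (ratr q : R) <= z.2]).
have sCq q : @measurable _ (g_sigma_algebraType void_events) (C q).
  apply: measurableI; first by case: (HA q).
  by apply: measurableC; apply: sV; exact: measurableI.
pose q_ (i : nat) : rat := odflt 0 (@choice.unpickle rat i).
exists (\bigcup_i C (q_ i)); first exact: (@bigcupT_measurable _ (g_sigma_algebraType void_events)).
move=> om ties; rewrite (point_count_geS _ _ ties); split.
  move=> [q [h1 h2]]; exists (choice.pickle q) => //; rewrite /q_ choice.pickleK/=.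
  by split => //; apply/(HA q).2.
by move=> [i _ [h1 h2]]; exists (q_ i); split => //; apply/((HA _).2 om ties).
Qed.

(** The events with this property form a sigma-algebra, and it contains the generators: each value
    of a count is described by the events that there are at least [k] points. *)
Lemma observation_void A : observation_sigma_algebra Z A -> exists2 A', <<s void_events >> A' &
  forall om, (forall i j, (Z i om).2 = (Z j om).2 -> i = j) -> (A om <-> A' om).
Proof.
pose H := [set A : set Omega | exists2 A', <<s void_events >> A' &
  forall om, (forall i j, (Z i om).2 = (Z j om).2 -> i = j) -> (A om <-> A' om)].
have HC F : H F -> H (~` F).
  move=> [F' sF' FF']; exists (~` F'); first exact: (@measurableC _ (g_sigma_algebraType void_events)).
  by move=> om /FF'[h1 h2]; split => h3 h4; apply: h3; [exact: h2|exact: h1].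
have HU F : (forall i : nat, H (F i)) -> H (\bigcup_i F i).
  move=> HF; have /choice[F' HF'] : forall i, exists F', <<s void_events >> F' /\
    forall om, (forall i j, (Z i om).2 = (Z j om).2 -> i = j) -> (F i om <-> F' om).
    by move=> i; have [F' h1 h2] := HF i; exists F'.
  exists (\bigcup_i F' i).
    by apply: (@bigcupT_measurable _ (g_sigma_algebraType void_events)) => i; case: (HF' i).
  move=> om ties; split=> -[i _ h]; exists i => //.
    exact/((HF' i).2 om ties).
  exact/((HF' i).2 om ties).
have H0 : H set0.
  by exists set0 => //; exact: (@measurable0 _ (g_sigma_algebraType void_events)).
have HI F G : H F -> H G -> H (F `&` G).
  move=> HF HG; rewrite -[F `&` G]setCK setCI.
  apply: (HC); rewrite (_ : _ `|` _ = \bigcup_i (if i is 0%N then ~` F else ~` G)).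
    by apply: HU => -[|i]; exact: HC.
  apply/seteqP; split => om; first by move=> [h|h]; [exists 0%N|exists 1%N].
  by move=> [[|i] _ h]; [left|right].
move: A; apply: smallest_sub.
  by split => // F HF; rewrite setTD; exact: HC.
move=> _ [B [C [mB mC ->]]].
have Hge k : H [set om | (k%:R%:E <= point_count Z B om)%E].
  by have [A' h1 h2] := point_count_ge_void k mB; exists A'.
(* In this union the index 0 stands for an infinite count and the index [k + 1] for the count
   [k]. *)
rewrite (_ : _ @^-1` _ = \bigcup_i (if i is k.+1 then
    if `[< C k%:R%:E >] then [set om | (k%:R%:E <= point_count Z B om)%E] `&`
       ~` [set om | (k.+1%:R%:E <= point_count Z B om)%E] else set0
  else if `[< C +oo%E >] then ~` (\bigcup_k ~` [set om | (k%:R%:E <= point_count Z B om)%E]) else set0)).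
  apply: (HU) => -[|k]; case: asboolP => // _.
    by apply: (HC); apply: (HU) => k; exact: HC.
  by apply: HI => //; exact: HC.
apply/seteqP; split => om /=.
  have [e|[k e]] := point_count_cases Z B om; rewrite e => Ck.
    by exists 0%N => //; rewrite asboolT// => -[k _]; apply; rewrite /= e leey.
  exists k.+1 => //; rewrite asboolT//; split; rewrite /= e lee_fin ?lexx// ler_nat ltnn//.
move=> [[|k] _]; case: asboolP => // Ck.
  move=> h; have [->//|[k e]] := point_count_cases Z B om.
  exfalso; apply: h; exists k.+1 => //=; by rewrite e lee_fin ler_nat ltnn.
move=> [/= h1 h2]; have [e|[l e]] := point_count_cases Z B om.
  by exfalso; apply: h2; rewrite e leey.
move: h1 h2; rewrite e !lee_fin !ler_nat => kl /negP; rewrite -leqNgt => lk.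
by rewrite (_ : l = k)//; apply/eqP; rewrite eqn_leq kl lk.
Qed.

End AtLeast.

(** * Conditioning on a void quadrant is a change of boundary *)

Section Tilt.
Context {R : realType}.
Implicit Types (g : R -> R) (z : R * R).

Definition ahead z : set (R * R) := [set z' | z.1 < z'.1 /\ z'.2 < z.2].

(** The boundary whose epigraph is that of [g] without [ahead z]. The jump takes effect strictly to
    the right of [z.1], which preserves left-continuity; this is why [ahead], unlike [below], is
    strict in the abscissa. *)
Definition tilt g z : R -> R := fun t => if z.1 < t then Num.max (g t) z.2 else g t.

Lemma measurable_ahead z : measurable (ahead z).
Proof.
rewrite (_ : ahead z = `]z.1, +oo[%classic `*` `]-oo, z.2[%classic); first exact: measurableX.
by apply/seteqP; split => y; rewrite /ahead/= !in_itv/= andbT.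
Qed.

Lemma le_tilt g z t : g t <= tilt g z t.
Proof. by rewrite /tilt; case: ifP => // _; rewrite le_max lexx. Qed.

Lemma tilt_monotone g z : monotone_class g -> monotone_class (tilt g z).
Proof.
move=> [gm gl]; split=> [s t s01 t01 st|t t01].
  rewrite /tilt; case: ifPn => zs.
    rewrite (lt_le_trans zs st) ge_max !le_max lexx orbT andbT; apply/orP; left; exact: gm.
  by apply: le_trans (gm s t s01 t01 st) _; case: ifP => // _; rewrite le_max lexx.
have [zt|tz] := ltP z.1 t.
  rewrite /tilt zt.
  have h : (fun s => Num.max (g s) z.2) @ t^'- --> Num.max (g t) z.2.
    apply: (@cvg_comp _ _ _ g (fun u : R => Num.max u z.2) _ (nbhs (g t))); first exact: gl.
    apply: (@continuous_max R R idfun (cst z.2)) => //; exact: cst_continuous.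
  apply: cvg_trans h; apply: near_eq_cvg.
  by apply: filterS (nbhs_left_gt zt) => s ->.
have -> : tilt g z t = g t by rewrite /tilt ltNge tz.
apply: cvg_trans (gl t t01); apply: near_eq_cvg.
by apply: filterS (nbhs_left_lt t) => s st; rewrite /tilt ltNge (le_trans (ltW st) tz).
Qed.

Lemma epigraph_tilt g z : epigraph (tilt g z) = epigraph g `\` ahead z.
Proof.
apply/seteqP; split => y; rewrite /epigraph/ahead/tilt/=; case: ifPn => zy.
- by rewrite ge_max => -[y01 /andP[gy zy2]]; split=> // -[_]; rewrite ltNge zy2.
- by move=> [y01 gy]; split => // -[zy'].
- move=> [[y01 gy] nz]; split => //; rewrite ge_max gy/= leNgt; apply/negP => h.
  by apply: nz.
- by move=> [].
Qed.

Lemma Intensity_tilt n g z (Mg : monotone_class g) B : measurable B ->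
  Intensity n Mg (B `|` ahead z) =
  (Intensity n Mg (ahead z) + Intensity n (tilt_monotone z Mg) B)%E.
Proof.
move=> mB; have ma := measurable_ahead z.
have -> : B `|` ahead z = ahead z `|` (B `\` ahead z).
  apply/seteqP; split => y; last by move=> [|[]]; [right|left].
  by move=> H; have [ay|ay] := pselect (ahead z y); [left|right; case: H].
rewrite measureU//; first last.
- by apply/seteqP; split => // y [h []].
- exact: measurableD.
congr (_ + _)%E.
have E : (B `\` ahead z) `&` epigraph g = B `&` epigraph (tilt g z).
  by rewrite epigraph_tilt !setDE setIAC -setIA.
exact: (congr1 (fun S : set (R * R) => n%:R%:E * (lebesgue_measure \x lebesgue_measure) S)%E E).
Qed.

End Tilt.

Section TiltedModel.
Context {R : realType} {d : measure_display} {Omega : measurableType d}.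
Variables (n : nat) (Z : nat -> Omega -> R * R) (P : (R -> R) -> probability Omega R).
Hypothesis n0 : (0 < n)%N.
Hypothesis hmodel : boundary_model n Z P.
Local Notation ppp Mg := (ppp_Intensity Mg (hmodel.2 _ Mg)).

Lemma model_measurable j : measurable_fun setT (Z j).
Proof.
have M0 : monotone_class (fun=> 0 : R) by split => // x _; exact: cvg_cst.
by case: (hmodel.2 _ M0).
Qed.
Local Notation mZ := (@model_measurable).

Definition observable (F : Omega -> R) : Prop :=
  forall C : set R, measurable C -> observation_sigma_algebra Z (F @^-1` C).

Lemma observation_measurable A : observation_sigma_algebra Z A -> measurable A.
Proof.
move: A; apply: smallest_sub; first exact: sigma_algebra_measurable.
by move=> _ [B [C [mB mC ->]]]; exact: (measurable_point_count_preimage mZ mB mC).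
Qed.

Lemma tilt_void g z B : monotone_class g -> measurable B ->
  P g (void Z B `&` void Z (ahead z)) = (P g (void Z (ahead z)) * P (tilt g z) (void Z B))%E.
Proof.
move=> Mg mB; have ma := measurable_ahead z; have Mh := tilt_monotone z Mg.
rewrite -voidU (prob_void (ppp Mg) (measurableU _ _ mB ma)) (prob_void (ppp Mg) ma).
rewrite (prob_void (ppp Mh) mB) Intensity_tilt// -expeRD; congr expeR.
by rewrite oppeD// ge0_adde_def// inE.
Qed.

(** Both sides are finite measures in the event [A]. They agree on void events by [tilt_void], void
    events are closed under intersection, and an observable event differs from one generated by void
    events only on ties, which are null for both boundaries. *)
Lemma tilt_observation g z A : monotone_class g -> observation_sigma_algebra Z A ->
  P g (A `&` void Z (ahead z)) = (P g (void Z (ahead z)) * P (tilt g z) A)%E.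
Proof.
move=> Mg oA; have Mh := tilt_monotone z Mg.
have ma := measurable_ahead z; have mW := measurable_void mZ ma.
have [A' sA' AA'] := observation_void oA.
have mA := observation_measurable oA.
have mA' : measurable A'.
  move: A' sA' {AA'}; apply: smallest_sub; first exact: sigma_algebra_measurable.
  by move=> _ [B mB <-]; exact: (measurable_void mZ mB).
have PE h C C' (Mh' : monotone_class h) : measurable C -> measurable C' ->
    (forall om, (forall i j, (Z i om).2 = (Z j om).2 -> i = j) -> (C om <-> C' om)) ->
    P h C = P h C'.
  move=> mC mC' CC'.
  have E D : measurable D -> P h D = (\int[P h]_om (\1_D om)%:E)%E.
    by move=> mD; rewrite integral_indic// setIT.
  rewrite (E _ mC) (E _ mC'); apply: ae_eq_integral => //.
  - exact/measurable_EFinP/measurable_indicP.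
  - exact/measurable_EFinP/measurable_indicP.
  apply: filterS (ae_no_ties (ppp Mh') (Intensity_strip Mh' n0)) => om /CC' CCom _.
  by rewrite !indicE; congr (_%:R%:E); congr nat_of_bool; apply/idP/idP => /set_mem/CCom/mem_set.
rewrite (PE g _ (A' `&` void Z (ahead z)))//; [|exact: measurableI|exact: measurableI|]; last first.
  by move=> om ties; split=> -[h1 h2]; split=> //; apply/(AA' om ties).
rewrite (PE _ A A')//.
pose p : {nonneg R} := NngNum (fine_ge0 (measure_ge0 (P g) (void Z (ahead z)))).
have pE : P g (void Z (ahead z)) = (p%:num)%:E by rewrite /= fineK// fin_num_measure.
pose m1 := mrestr (P g) mW.
pose m2 := mscale p (P (tilt g z)).
rewrite pE; apply: (@g_sigma_algebra_measure_unique _ R Omega (void_events Z) _ (fun=> setT) _ _ m1 m2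
  (@void_eventsI _ _ _ Z) _ _ A' sA').
- by move=> _ [B mB <-]; exact: (measurable_void mZ mB).
- by move=> _; exists set0 => //; apply/seteqP; split => // om _ j.
- by rewrite bigcup_const//; exists 0%N.
- move=> _ [B mB <-]; rewrite /m1 /m2 /= /mrestr /mscale/= -[X in (_ = X * _)%E]pE.
  exact: tilt_void.
- by move=> _; rewrite /m1 /= /mrestr setTI -ge0_fin_numE// fin_num_measure.
Qed.

Lemma observable_measurable F : observable F -> measurable_fun setT F.
Proof. by move=> oF _ C mC; rewrite setTI; apply: observation_measurable; exact: oF. Qed.

(** The two measures are known to agree on observable events only, so both integrals are transported
    to the line by [F], where the image measures are equal. *)
Lemma tilt_ge0_integral g z F : monotone_class g -> observable F -> (forall om, 0 <= F om) ->
  (\int[P g]_om (F om * \1_(void Z (ahead z)) om)%:E =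
   P g (void Z (ahead z)) * \int[P (tilt g z)]_om (F om)%:E)%E.
Proof.
move=> Mg oF F0; have Mh := tilt_monotone z Mg.
have mF := observable_measurable oF.
have mW := measurable_void mZ (measurable_ahead z).
pose p : {nonneg R} := NngNum (fine_ge0 (measure_ge0 (P g) (void Z (ahead z)))).
have pE : P g (void Z (ahead z)) = (p%:num)%:E by rewrite /= fineK// fin_num_measure.
have E1 : (\int[P g]_om (F om * \1_(void Z (ahead z)) om)%:E = \int[mrestr (P g) mW]_om (F om)%:E)%E.
  rewrite ge0_integral_mrestr//; [|exact/measurable_EFinP].
  rewrite [RHS]integral_mkcond; apply: eq_integral => om _.
  by rewrite patchE indicE; case: ifPn => h; rewrite ?mulr1 ?mulr0.
have E2 : (P g (void Z (ahead z)) * \int[P (tilt g z)]_om (F om)%:E =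
    \int[mscale p (P (tilt g z))]_om (F om)%:E)%E.
  rewrite ge0_integral_mscale ?pE//.
    exact/measurable_EFinP.
  by move=> om _; rewrite lee_fin.
rewrite E1 E2; pose pos (y : R) := (Num.max y 0)%:E.
have mpos : measurable_fun setT pos.
  by apply/measurable_EFinP; apply: measurable_maxr => //; exact: measurable_id.
have pos0 y : y \in [set: R] -> (0 <= pos y)%E by rewrite lee_fin le_max lexx orbT.
have push (nu : {measure set Omega -> \bar R}) :
    (\int[nu]_om (F om)%:E = \int[pushforward nu F]_y pos y)%E.
  rewrite (ge0_integral_pushforward mF nu measurableT mpos pos0) preimage_setT.
  by apply: eq_integral => om _ /=; rewrite /pos max_l.
rewrite (push [the {measure set _ -> \bar R} of mrestr (P g) mW]).
rewrite (push [the {measure set _ -> \bar R} of mscale p (P (tilt g z))]).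
apply: eq_measure_integral => C mC _.
rewrite /pushforward /= /mrestr /mscale/= -[X in (_ = X * _)%E]pE.
by apply: tilt_observation => //; exact: oF.
Qed.

End TiltedModel.

(** * Unbiased estimators of zero are orthogonal to the void quadrants *)

Section Orthogonality.
Context {R : realType} {d : measure_display} {Omega : measurableType d}.
Variables (n : nat) (Z : nat -> Omega -> R * R) (P : (R -> R) -> probability Omega R).
Hypothesis n0 : (0 < n)%N.
Hypothesis hmodel : boundary_model n Z P.
Local Notation mZ := (model_measurable hmodel).
Local Notation mu := (@lebesgue_measure R).

Definition count_events : set (set Omega) :=
  [set A | exists B (C : set (\bar R)),
    [/\ measurable B, measurable C & A = point_count Z B @^-1` C]].
Local Notation obs := (g_sigma_algebraType count_events).

Lemma observableP (F : Omega -> R) : observable Z F <-> measurable_fun [set: obs] F.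
Proof.
by split=> [oF _ C mC|mF C mC]; [rewrite setTI; exact: oF|rewrite -[_ @^-1` _]setTI; exact: mF].
Qed.

Lemma observation_void_ahead z : observation_sigma_algebra Z (void Z (ahead z)).
Proof.
apply: sub_sigma_algebra; exists (ahead z), [set 0%E].
by split; [exact: measurable_ahead| |exact: voidE].
Qed.

Lemma has_mean_funrpos (Q : probability Omega R) (F : Omega -> R) m : has_mean Q F m ->
  measurable_fun setT F -> exists a b,
  [/\ m = a - b, (\int[Q]_om (Num.max (F om) 0)%:E = a%:E)%E &
      (\int[Q]_om (Num.max (- F om) 0)%:E = b%:E)%E].
Proof.
move=> hF mF; have [iF eF] := has_mean_integral mF hF.
pose Fp om := Num.max (F om) 0; pose Fn om := Num.max (- F om) 0.
have ip : Q.-integrable setT (EFin \o Fp).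
  apply: le_integrable iF => //; first by apply/measurable_EFinP; exact: measurable_maxr.
  by move=> om _; rewrite /= lee_fin ger0_norm ?le_max ?lexx ?orbT// ge_max ler_norm normr_ge0.
have in_ : Q.-integrable setT (EFin \o Fn).
  apply: le_integrable iF => //.
    by apply/measurable_EFinP; apply: measurable_maxr => //; exact: measurableT_comp.
  by move=> om _; rewrite /= lee_fin ger0_norm ?le_max ?lexx ?orbT// ge_max ler_normr lexx orbT normr_ge0.
exists (fine (\int[Q]_om (Fp om)%:E)), (fine (\int[Q]_om (Fn om)%:E)).
rewrite !fineK; try exact: integrable_fin_num.
split => //; apply: EFin_inj; rewrite EFinB !fineK; try exact: integrable_fin_num.
rewrite -eF -integralB//; apply: eq_integral => om _; rewrite -EFinB; congr EFin.
by rewrite /Fp /Fn !maxEle; do 2!case: ifPn; lra.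
Qed.

Lemma tilt_mean g z F m : monotone_class g -> observable Z F -> has_mean (P (tilt g z)) F m ->
  has_mean (P g) (fun om => F om * \1_(void Z (ahead z)) om) (fine (P g (void Z (ahead z))) * m).
Proof.
move=> Mg oF hF.
have mF := observable_measurable hmodel oF.
have mW : measurable_fun setT (\1_(void Z (ahead z)) : Omega -> R).
  by apply/measurable_indicP; exact: (measurable_void mZ (measurable_ahead z)).
have [a [b [-> ea eb]]] := has_mean_funrpos hF mF.
have H F' a' : observable Z F' -> (forall om, 0 <= F' om) -> (\int[P (tilt g z)]_om (F' om)%:E = a'%:E)%E ->
    has_mean (P g) (fun om => F' om * \1_(void Z (ahead z)) om) (fine (P g (void Z (ahead z))) * a').
  move=> oF' F0' ea'; apply: ge0_has_mean.
  - by apply: measurable_funM => //; exact: (observable_measurable hmodel oF').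
  - by move=> om; rewrite mulr_ge0.
  - rewrite (tilt_ge0_integral n0 hmodel)// ea' EFinM fineK// fin_num_measure//.
    exact: (measurable_void mZ (measurable_ahead z)).
have oFp : observable Z (fun om => Num.max (F om) 0).
  by apply/observableP; apply: measurable_maxr => //; exact/observableP.
have oFn : observable Z (fun om => Num.max (- F om) 0).
  apply/observableP; apply: measurable_maxr => //; apply: measurableT_comp => //.
  exact/observableP.
have ge0 (y : R) : 0 <= Num.max y 0 by rewrite le_max lexx orbT.
have := has_meanB (H _ _ oFp (fun=> ge0 _) ea) (H _ _ oFn (fun=> ge0 _) eb).
rewrite -mulrBr; apply: eq_has_mean => om.
by rewrite -mulrBl; congr (_ * _); rewrite !maxEle; do 2!case: ifPn; lra.
Qed.

Definition voids (s : seq (R * R)) : set Omega := [set om | forall z, z \in s -> void Z (ahead z) om].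

Lemma voids_cons z s : voids (z :: s) = void Z (ahead z) `&` voids s.
Proof.
apply/seteqP; split => [om H|om [h1 h2] z']; last by rewrite inE => /orP[/eqP ->|/h2].
by split=> [|z' zs]; apply: H; rewrite inE ?eqxx ?zs ?orbT.
Qed.

Lemma observation_voids s : observation_sigma_algebra Z (voids s).
Proof.
elim: s => [|z s IH].
  rewrite (_ : voids [::] = setT); last by apply/seteqP; split.
  exact: (@measurableT _ obs).
by rewrite voids_cons; apply: (@measurableI _ obs) => //; exact: observation_void_ahead.
Qed.

Section Zero.
Variable U : Omega -> R.
Hypothesis oU : observable Z U.
Hypothesis U0 : forall g, monotone_class g -> has_mean (P g) U 0.
Let mU := observable_measurable hmodel oU.

(** Induction on the list: conditioning on one void quadrant replaces [g] by [tilt g z], which is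
    again in the class, so the induction hypothesis applies to it. *)
Lemma mean_voids s g : monotone_class g -> has_mean (P g) (fun om => U om * \1_(voids s) om) 0.
Proof.
elim: s g => [|z s IH] g Mg.
  apply: eq_has_mean (U0 Mg) => om.
  by rewrite indicE mem_set ?mulr1// => z.
have oUs : observable Z (fun om => U om * \1_(voids s) om).
  apply/observableP; apply: measurable_funM; first exact/observableP.
  by apply/measurable_indicP; exact: observation_voids.
have := tilt_mean Mg oUs (IH _ (tilt_monotone z Mg)); rewrite mulr0.
by apply: eq_has_mean => om; rewrite voids_cons indicI /= mulrA mulrAC.
Qed.

(** Concatenation of lists makes this a system closed under intersection. The sigma-algebra it
    generates is called [front] below and describes the staircase. *)
Definition voids_events : set (set Omega) := [set voids s | s in setT].

Lemma voids_events_observation A : <<s voids_events >> A -> observation_sigma_algebra Z A.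
Proof.
move: A; apply: smallest_sub; first exact: smallest_sigma_algebra.
by move=> _ [s _ <-]; exact: observation_voids.
Qed.

Variable g : R -> R.
Hypothesis Mg : monotone_class g.

(** A monotone class argument from [mean_voids]; increasing unions pass by dominated convergence
    with majorant [|U|]. In effect [U] has conditional mean zero given the front, which plays the
    part of completeness. *)
Lemma mean_voids_events A : <<s voids_events >> A -> has_mean (P g) (fun om => U om * \1_A om) 0.
Proof.
pose H := [set A : set Omega | measurable A /\ has_mean (P g) (fun om => U om * \1_A om) 0].
suff : <<s voids_events >> `<=` H by move=> /[apply] -[].
apply: lambda_system_subset => //.
- move=> _ _ [s _ <-] [t _ <-]; exists (s ++ t) => //; apply/seteqP; split => om.
    by move=> h; split => z zs; apply: h; rewrite mem_cat zs ?orbT.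
  by move=> [h1 h2] z; rewrite mem_cat => /orP[/h1|/h2].
- split => //.
  + split => //; apply: eq_has_mean (U0 Mg) => om; by rewrite indicT mulr1.
  + move=> C B BC [mC hC] [mB hB]; split; first exact: measurableD.
    have := has_meanB hC hB; rewrite subr0; apply: eq_has_mean => om.
    rewrite -mulrBr; congr (_ * _); rewrite !indicE in_setD.
    have [oB|oB] := boolP (om \in B); last by rewrite andbT subr0.
    by rewrite andbF (mem_set (BC om (set_mem oB))) subrr.
  + move=> F Fnd HF; split; first by apply: bigcupT_measurable => i; case: (HF i).
    have [a hU _] : exists2 a, has_mean (P g) (fun om => `|U om|) a & True.
      have [iU _] := has_mean_integral mU (U0 Mg).
      by exists (fine (\int[P g]_om (`|U om|)%:E)) => //; apply: integrable_has_mean; exact: integrable_norm.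
    have [||||m hm cm] := @has_mean_dominated _ _ _ (P g) (fun k om => U om * \1_(F k) om)
      (fun om => U om * \1_(\bigcup_i F i) om) (fun om => `|U om|) (fun=> 0) a.
    * by move=> k; case: (HF k).
    * apply: aeW => om; apply: cvg_near_cst.
      have [[i _ Fi]|nF] := pselect ((\bigcup_i F i) om).
        exists i => // k /= ik; rewrite !indicE !mem_set//; first by exists i.
        by move/subsetPset: (Fnd _ _ ik); exact.
      apply: nearW => k; rewrite !indicE !memNset// => Fk; apply: nF.
      by exists k.
    * exact: hU.
    * by apply: aeW => om k; rewrite normrM ler_piMr// ger0_norm// indicE; case: (_ \in _).
    by rewrite (cvg_unique _ (cvg_cst 0) cm) in hm *.
- move=> _ [s _ <-]; split; last exact: mean_voids.
  exact: (observation_measurable hmodel (observation_voids s)).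
Qed.

Local Notation front := (g_sigma_algebraType voids_events).

Lemma front_measurable (F : Omega -> R) : measurable_fun [set: front] F ->
  measurable_fun [set: Omega] F.
Proof.
move=> mF _ C mC; rewrite setTI; apply: (observation_measurable hmodel).
by apply: voids_events_observation; rewrite -[_ @^-1` _]setTI; exact: mF.
Qed.

(** Layer cake: [F] is the integral over [t >= 0] of the indicators of [t <= F], and [U] has mean
    zero on each of these events. Tonelli is applied to the positive and negative parts of [U]
    separately; for each [t] they have the same mean on the event. *)
Lemma mean_orthogonal_ge0 (F : Omega -> R) a : measurable_fun [set: front] F ->
  (forall om, 0 <= F om) -> has_mean (P g) (fun om => `|U om| * F om) a ->
  has_mean (P g) (fun om => U om * F om) 0.
Proof.
move=> mF F0 hUF; have mF' := front_measurable mF.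
have ge0 (y : R) : 0 <= Num.max y 0 by rewrite le_max lexx orbT.
have mUp : measurable_fun setT (fun om => Num.max (U om) 0) by exact: measurable_maxr.
have mUn : measurable_fun setT (fun om => Num.max (- U om) 0).
  by apply: measurable_maxr => //; exact: measurableT_comp.
have layer (V : Omega -> R) : measurable_fun setT V -> (forall om, 0 <= V om) ->
    (\int[P g]_om (V om * F om)%:E =
     \int[mu]_t (((0 <= t)%R%:R)%:E * \int[P g]_om (V om * \1_[set om | (t <= F om)%R] om)%:E))%E.
  move=> mV V0.
  pose f (p : Omega * measurableTypeR R) : \bar R := (V p.1 * (0 <= p.2 <= F p.1)%R%:R)%:E.
  have mf : measurable_fun setT f.
    apply/measurable_EFinP; apply: measurable_funM; first exact: (measurableT_comp mV measurable_fst).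
    apply: measurable_natr_bool; apply: measurable_and; apply: measurable_fun_ler => //.
    exact: (measurableT_comp mF' measurable_fst).
  have f0 p : (0 <= f p)%E by rewrite lee_fin mulr_ge0.
  transitivity (\int[P g]_om \int[mu]_t f (om, t))%E.
    apply: eq_integral => om _; rewrite /f/=.
    under eq_integral do rewrite EFinM.
    rewrite ge0_integralZl_EFin//; last first.
      apply/measurable_EFinP; apply: (@measurable_natr_bool _ _ (measurableTypeR R)).
      by apply: measurable_and; exact: measurable_fun_ler.
    by rewrite (integral_segment (F0 om)) subr0.
  rewrite (fubini_tonelli (m1 := P g) (m2 := mu) f)//.
  apply: eq_integral => t _; rewrite /f/=; case: (0 <= t) => /=; last first.
    by rewrite mul0e; apply: integral0_eq => om _; rewrite mulr0.
  rewrite mul1e; apply: eq_integral => om _; rewrite indicE; congr (_ * _%:R)%:E.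
  by congr nat_of_bool; apply/idP/idP => [/mem_set//|/set_mem].
have E : (\int[P g]_om (Num.max (U om) 0 * F om)%:E = \int[P g]_om (Num.max (- U om) 0 * F om)%:E)%E.
  rewrite layer// layer//; apply: eq_integral => t _; congr (_ * _)%E.
  pose A := [set om | t <= F om].
  have GA : <<s voids_events >> A.
    rewrite (_ : A = setT `&` F @^-1` `[t, +oo[%classic).
      by apply: mF.
    by apply/seteqP; split => om; rewrite /A/= in_itv/= andbT; [split|case].
  have mA : measurable A by exact: (observation_measurable hmodel (voids_events_observation GA)).
  have [|x [y [/esym/eqP]]] := has_mean_funrpos (mean_voids_events GA).
    by apply: measurable_funM => //; exact/measurable_indicP.
  rewrite subr_eq0 => /eqP -> <-; rewrite -/A => e.
  have I01 om : \1_A om = 0 :> R \/ \1_A om = 1 :> R.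
    by rewrite indicE; case: (_ \in _); [right|left].
  transitivity (\int[P g]_om (Num.max (U om * \1_A om) 0)%:E)%E.
    by apply: eq_integral => om _; case: (I01 om) => ->; rewrite ?mulr0 ?maxxx// !mulr1.
  rewrite -e.
  by apply: eq_integral => om _; case: (I01 om) => ->; rewrite ?mulr0 ?oppr0 ?maxxx// !mulr1.
have [iUF _] := has_mean_integral (measurable_funM (measurableT_comp (@normr_measurable _ setT) mU) mF') hUF.
have sub (V : Omega -> R) : measurable_fun setT V -> (forall om, 0 <= V om) -> (forall om, V om <= `|U om|) ->
    has_mean (P g) (fun om => V om * F om) (fine (\int[P g]_om (V om * F om)%:E)).
  move=> mV V0 VU; apply: integrable_has_mean; apply: le_integrable iUF => //.
    by apply/measurable_EFinP; exact: measurable_funM.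
  move=> om _; rewrite /= lee_fin !normrM normr_id (ger0_norm (F0 om)) (ger0_norm (V0 om)).
  by rewrite ler_wpM2r.
have hp := sub _ mUp (fun om => ge0 _) _; have hn := sub _ mUn (fun om => ge0 _) _.
have := has_meanB (hp _) (hn _); rewrite E subrr => H.
apply: eq_has_mean (H _ _) => om.
- by rewrite -mulrBl; congr (_ * _); rewrite !maxEle; do 2!case: ifPn; lra.
- by rewrite ge_max ler_norm normr_ge0.
- by rewrite ge_max ler_normr lexx orbT normr_ge0.
Qed.

Lemma mean_orthogonal (F : Omega -> R) a : measurable_fun [set: front] F ->
  has_mean (P g) (fun om => `|U om * F om|) a ->
  has_mean (P g) (fun om => U om * F om) 0.
Proof.
move=> mF hUF; have mF' := front_measurable mF.
have ge0 (y : R) : 0 <= Num.max y 0 by rewrite le_max lexx orbT.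
have H (V : Omega -> R) : measurable_fun [set: front] V -> (forall om, 0 <= V om) ->
    (forall om, V om <= `|F om|) -> has_mean (P g) (fun om => U om * V om) 0.
  move=> mV V0 VF; have mV' := front_measurable mV.
  have [iUF _] := has_mean_integral (measurableT_comp (@normr_measurable _ setT) (measurable_funM mU mF')) hUF.
  have iV : (P g).-integrable setT (EFin \o (fun om => `|U om| * V om)).
    apply: le_integrable iUF => //.
      apply/measurable_EFinP; apply: measurable_funM => //; exact: measurableT_comp.
    move=> om _; rewrite /= lee_fin normr_id !normrM normr_id ler_wpM2l//.
    by rewrite (ger0_norm (V0 om)).
  exact: mean_orthogonal_ge0 mV V0 (integrable_has_mean iV).
have hp : has_mean (P g) (fun om => U om * Num.max (F om) 0) 0.
  by apply: H => //; [exact: measurable_maxr|move=> om; rewrite ge_max ler_norm normr_ge0].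
have hn : has_mean (P g) (fun om => U om * Num.max (- F om) 0) 0.
  apply: H => //; last by move=> om; rewrite ge_max ler_normr lexx orbT normr_ge0.
  by apply: measurable_maxr => //; exact: measurableT_comp.
have := has_meanB hp hn; rewrite subr0; apply: eq_has_mean => om.
by rewrite -mulrBr; congr (_ * _); rewrite !maxEle; do 2!case: ifPn; lra.
Qed.

End Zero.
End Orthogonality.

(** * The estimator as a function of the staircase *)

Lemma limn_sum_finite (R : realType) (u : nat -> R) N : (forall j, (N <= j)%N -> u j = 0) ->
  limn (fun M => \sum_(0 <= j < M) u j) = \sum_(0 <= j < N) u j.
Proof.
move=> uN; apply: cvg_lim => //; apply: cvg_near_cst; exists N => // m /= Nm.
rewrite (@big_cat_nat _ _ _ N)//= [X in _ + X]big_nat_cond [X in _ + X]big1 ?addr0//.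
by move=> j /andP[/andP[Nj _] _]; exact: uN.
Qed.

(** Both series run over the same finite set of abscissae with [v] nonzero, and injectivity on the
    selected indices lets each abscissa count once in either of them. *)
Lemma limn_sum_reindex (R : realType) (c c' : nat -> bool) (x x' : nat -> R) (v : R -> R) N :
  (forall j, c j -> v (x j) != 0 -> (j < N)%N) ->
  (forall i j, c i -> c j -> x i = x j -> i = j) ->
  (forall i j, c' i -> c' j -> x' i = x' j -> i = j) ->
  (forall j, c j -> v (x j) != 0 -> exists2 i, c' i & x' i = x j) ->
  (forall i, c' i -> v (x' i) != 0 -> exists2 j, c j & x j = x' i) ->
  limn (fun M => \sum_(0 <= j < M) (c j)%:R * v (x j)) =
  limn (fun M => \sum_(0 <= i < M) (c' i)%:R * v (x' i)).
Proof.
move=> cN cinj cinj' cc' c'c.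
have /choice[h hP] : forall j, exists i, c j -> v (x j) != 0 -> c' i /\ x' i = x j.
  move=> j; have [cj|_] := boolP (c j); last by exists 0%N.
  have [vj|_] := boolP (v (x j) != 0); last by exists 0%N.
  by have [i c'i e] := cc' j cj vj; exists i.
pose M := (\max_(j < N) h j).+1.
have c'M i : c' i -> v (x' i) != 0 -> (i < M)%N.
  move=> c'i vi; have [j cj e] := c'c i c'i vi; rewrite -e in vi.
  have [c'h eh] := hP j cj vi; have jN := cN j cj vi.
  have -> : i = h j by apply: cinj' => //; rewrite eh.
  by rewrite ltnS; exact: (leq_bigmax (Ordinal jN)).
have fin (b : nat -> bool) (y : nat -> R) K : (forall j, b j -> v (y j) != 0 -> (j < K)%N) ->
    limn (fun M => \sum_(0 <= j < M) (b j)%:R * v (y j)) =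
    \sum_(t <- [seq y j | j <- iota 0 K & b j && (v (y j) != 0)]) v t.
  move=> bK; rewrite (@limn_sum_finite _ _ K); last first.
    move=> j Kj; have [bj|] := boolP (b j); last by rewrite mul0r.
    have [/(bK j bj)|/negPn/eqP ->] := boolP (v (y j) != 0); last by rewrite mulr0.
    by rewrite ltnNge Kj.
  rewrite big_map big_filter /index_iota subn0 [RHS]big_mkcond/=; apply: eq_bigr => j _.
  case: (b j) => /=; last by rewrite mul0r.
  by case: ifPn => [|/negPn/eqP ->]; rewrite ?mulr0// mul1r.
rewrite (fin c x N cN) (fin c' x' M c'M); apply: perm_big; apply: uniq_perm.
- rewrite map_inj_in_uniq ?filter_uniq ?iota_uniq// => i j.
  by rewrite !mem_filter => /andP[/andP[ci _] _] /andP[/andP[cj _] _]; exact: cinj.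
- rewrite map_inj_in_uniq ?filter_uniq ?iota_uniq// => i j.
  by rewrite !mem_filter => /andP[/andP[ci _] _] /andP[/andP[cj _] _]; exact: cinj'.
move=> t; apply/mapP/mapP => -[j]; rewrite mem_filter => /andP[/andP[cj vj] _] ->.
  have [i c'i e] := cc' j cj vj; exists i => //.
  by rewrite mem_filter c'i e vj mem_iota/= c'M// e.
have [i ci e] := c'c j cj vj; exists i => //.
by rewrite mem_filter ci e vj mem_iota/= cN// e.
Qed.

Section Front.
Context {R : realType} {d : measure_display} {Omega : measurableType d}.
Variable Z : nat -> Omega -> R * R.
Hypothesis X01 : forall j om, (Z j om).1 \in `[0, 1].
Local Notation front := (g_sigma_algebraType (voids_events Z)).
Local Notation mu := (@lebesgue_measure R).

Let edge_set y om : set R := [set -1] `|` [set (Z i om).1 | i in [set i | (Z i om).2 < y]].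

(* The right end of the region where [g_hat] is known to lie below [y]; the value
   [-1] means that the region is empty. *)
Definition edge y om : R := sup (edge_set y om).

Let edge_has_sup y om : has_sup (edge_set y om).
Proof.
split; first by exists (-1); left.
exists 1 => _ [->|[i _ <-]]; first by rewrite (le_trans _ ler01)// oppr_le0.
by have := X01 i om; rewrite in_itv/= => /andP[].
Qed.

Let le_edge y om i : (Z i om).2 < y -> (Z i om).1 <= edge y om.
Proof.
by move=> iy; apply: ub_le_sup; [case: (edge_has_sup y om)|right; exists i].
Qed.

Lemma edge_le x y om : -1 <= x -> edge y om <= x <-> void Z (ahead (x, y)) om.
Proof.
move=> x1; split=> [ex j [/= xj jy]|H].
  by have := le_trans (le_edge jy) ex; rewrite leNgt xj.
apply: ge_sup; first by case: (edge_has_sup y om).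
move=> _ [->//|[i /= iy <-]]; rewrite leNgt; apply/negP => xi.
by apply: (H i); split.
Qed.

Lemma measurable_edge y : measurable_fun [set: front] (edge y).
Proof.
apply: (measurability (@RGenOInfty.G R)) => [|/= _ [_] [x] -> <-].
  exact: RGenOInfty.measurableE.
rewrite setTI; have [x1|x1] := leP (-1) x.
  rewrite (_ : _ @^-1` _ = ~` voids Z [:: (x, y)]).
    by apply: measurableC; apply: sub_sigma_algebra; exists [:: (x, y)].
  rewrite voids_cons; apply/seteqP; split => om /=; rewrite in_itv/= andbT.
    by move=> xe [/(edge_le _ _ x1)]; rewrite leNgt xe.
  move=> H; rewrite ltNge; apply/negP => /(edge_le _ _ x1) h; apply: H.
  by split => // z.
rewrite (_ : _ @^-1` _ = setT) //; apply/seteqP; split => // om _ /=.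
rewrite in_itv/= andbT (lt_le_trans x1)//; apply: ub_le_sup; last by left.
by case: (edge_has_sup y om).
Qed.

Lemma edge_cases y om : regular Z om -> edge y om = -1 \/
  exists k, [/\ (Z k om).2 < y, edge y om = (Z k om).1 &
    forall j, (Z j om).2 < y -> (Z j om).1 <= (Z k om).1].
Proof.
move=> rom; have [X _ _ _] := rom.
have [N HN] := finite_nat_bounded (regular_finite y rom).
have [[j0 j0y]|no] := pselect (exists j, (Z j om).2 < y); [right|left].
  have [||k ky kmax] := @argmin_lt R (fun j => - (Z j om).1) [set j | (Z j om).2 < y] N.
  - by move=> j /= jy; apply: HN; exact: ltW.
  - by exists j0.
  have kmax' j : (Z j om).2 < y -> (Z j om).1 <= (Z k om).1 by move=> /kmax; rewrite lerN2.
  exists k; split => //; apply/le_anti; rewrite le_edge// andbT.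
  apply: ge_sup; first by case: (edge_has_sup y om).
  move=> _ [->|[i /= iy <-]]; last exact: kmax'.
  by have /andP[h _] := X k; apply: le_trans h; rewrite oppr_le0.
apply/le_anti/andP; split; last by apply: ub_le_sup; [case: (edge_has_sup y om)|left].
apply: ge_sup; first by case: (edge_has_sup y om).
by move=> t [->//|[i /= iy _]]; exfalso; apply: no; exists i.
Qed.

(** Thus [edge] is a generalized inverse of the monotone function [g_hat]. *)
Lemma le_edgeE x y om : regular Z om -> 0 <= x < 1 -> (x <= edge y om) = (g_hat Z om x < y).
Proof.
move=> rom /andP[x0 x1]; apply/idP/idP => [|gy].
  have [->|[k [ky -> _]]] := edge_cases y rom => [h|xk]; first by exfalso; lra.
  exact: le_lt_trans (g_hat_le rom xk) ky.
have [i [xi e _]] := g_hatP rom x1; apply: le_trans xi _.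
by apply: le_edge; rewrite -e.
Qed.

(** Let [k] be the rightmost point below [y]. The point attaining [g_hat] at its abscissa is at
    least as low, hence below [y] too, and so it cannot lie further to the right. *)
Lemma edge_corner y om : regular Z om -> edge y om != -1 ->
  exists2 j, g_hat Z om (Z j om).1 == (Z j om).2 & (Z j om).1 = edge y om.
Proof.
move=> rom; have [->|[k [ky -> kmax]]] := edge_cases y rom; first by rewrite eqxx.
move=> _; have [X _ _ _] := rom; have /andP[_ k1] := X k.
have [j [kj e _]] := g_hatP rom k1.
have jk : (Z j om).1 = (Z k om).1.
  apply/le_anti; rewrite kj andbT; apply: kmax.
  by rewrite -e (le_lt_trans _ ky)//; exact: g_hat_le.
by exists j => //; rewrite jk e.
Qed.

(** All points to the right of a corner are strictly higher, by a positive gap since finitely many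
    compete. For levels inside this gap the edge is the abscissa of the corner, and the gap contains
    a rational. *)
Lemma corner_edge om j : regular Z om -> g_hat Z om (Z j om).1 = (Z j om).2 ->
  exists q : rat, edge (ratr q) om = (Z j om).1.
Proof.
move=> rom e; have [X _ above ties] := rom; have /andP[_ j1] := X j.
have [y jy Hy] : exists2 y, (Z j om).2 < y &
    forall i, (Z j om).1 < (Z i om).1 -> y <= (Z i om).2.
  have [|i /= ji imin] := @regular_argmin _ _ _ Z om [set i | (Z j om).1 < (Z i om).1] rom.
    have [|i hi] := above (((Z j om).1 + 1) / 2); first lra.
    by exists i => /=; lra.
  exists (Z i om).2 => //; rewrite lt_neqAle -{2}e g_hat_le ?ltW// andbT.
  by apply: contraTN ji => /eqP/ties <-; rewrite ltxx.
have [q] := rat_in_itvoo jy; rewrite in_itv/= => /andP[jq qy].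
exists q; apply/le_anti; rewrite (le_edge jq) andbT.
have [->|[k [kq -> _]]] := edge_cases (ratr q) rom.
  by have /andP[h _] := X j; apply: le_trans h; rewrite oppr_le0.
rewrite leNgt; apply/negP => /Hy h.
by have := le_lt_trans h (lt_trans kq qy); rewrite ltxx.
Qed.

End Front.

Section FrontEstimator.
Context {R : realType} {d : measure_display} {Omega : measurableType d}.
Variables (n : nat) (w : R -> R) (Z : nat -> Omega -> R * R).
Hypothesis hw : L2_unit_interval w.
Hypothesis hsupp : support_unit_interval w `<=` `[0, 1[.
Hypothesis X01 : forall j om, (Z j om).1 \in `[0, 1].
Local Notation front := (g_sigma_algebraType (voids_events Z)).
Local Notation mu := (@lebesgue_measure R).

Definition nth_rat (i : nat) : rat := odflt 0 (@choice.unpickle rat i).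

Lemma nth_rat_pickle q : nth_rat (choice.pickle q) = q.
Proof. by rewrite /nth_rat choice.pickleK. Qed.

(** The infimum of the rational levels strictly above [g_hat x], as [le_edgeE] shows. Only countably
    many edges enter, which makes it measurable for the front. *)
Definition front_g_hat om x : R := fine (einfs (fun i =>
  if x <= edge Z (ratr (nth_rat i)) om then (ratr (nth_rat i) : R)%:E else +oo%E) 0).

(** Infinitely many rational levels produce the same corner; only the first in the enumeration is
    retained, so that each corner is counted once. *)
Definition new_edge om i : bool :=
  all (fun k => edge Z (ratr (nth_rat k)) om != edge Z (ratr (nth_rat i)) om) (iota 0 i).

Definition front_theta_hat om : R :=
  \int[mu]_x (front_g_hat om x * weight w x) -
  n%:R^-1 * limn (fun N => \sum_(0 <= i < N)
    (new_edge om i)%:R * weight w (edge Z (ratr (nth_rat i)) om)).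

Lemma front_g_hatE om x : regular Z om -> 0 <= x < 1 -> front_g_hat om x = g_hat Z om x.
Proof.
move=> rom x01; rewrite /front_g_hat.
suff -> : forall u : (\bar R)^nat, u = (fun i => if g_hat Z om x < ratr (nth_rat i) then
    (ratr (nth_rat i) : R)%:E else +oo%E) -> einfs u 0 = (g_hat Z om x)%:E.
- by [].
- by apply/funext => i; rewrite le_edgeE.
move=> u ->; apply/le_anti/andP; split; last first.
  apply: le_ereal_inf_tmp => _ [i _ <-] /=; case: ifPn => [/ltW|_]; rewrite ?leey//.
apply/lee_addgt0Pr => e e0.
have h : g_hat Z om x < g_hat Z om x + e by rewrite ltrDl.
have [q] := rat_in_itvoo h; rewrite in_itv/= => /andP[gq qe].
apply: ge_ereal_inf; exists (ratr q)%:E; last by rewrite -EFinD lee_fin ltW.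
by exists (choice.pickle q) => //=; rewrite nth_rat_pickle gq.
Qed.

Lemma measurable_front_g_hat :
  measurable_fun [set: (front * measurableTypeR R)%type]
    (fun p : front * measurableTypeR R => front_g_hat p.1 p.2).
Proof.
apply: measurableT_comp => //; apply: measurable_fun_einfs => i.
apply: measurable_fun_ifT => //; apply: measurable_fun_ler; first exact: measurable_snd.
exact: (measurableT_comp (measurable_edge X01 _) measurable_fst).
Qed.

Lemma measurable_new_edge i : measurable_fun [set: front] (fun om => new_edge om i).
Proof.
rewrite /new_edge; elim: (iota 0 i) => [|k s IH] //=.
apply: measurable_and => //; apply: measurable_neg.
by apply: measurable_fun_eqr; exact: measurable_edge.
Qed.

Lemma measurable_front_theta_hat : measurable_fun [set: front] front_theta_hat.
Proof.
have mg := measurable_front_g_hat; have mw := measurable_weight hw.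
pose f (p : front * measurableTypeR R) := (front_g_hat p.1 p.2 * weight w p.2)%:E.
have mf : measurable_fun setT f.
  apply/measurable_EFinP; apply: measurable_funM => //.
  exact: (measurableT_comp mw measurable_snd).
have mI : measurable_fun [set: front] (fun om => (\int[mu]_x f (om, x))%E).
  rewrite (_ : (fun om => _) = (fun om => fubini_F mu (f^\+)%E om - fubini_F mu (f^\-)%E om)%E); last first.
    apply/funext => om; rewrite [LHS](@integralE _ (measurableTypeR R) R mu setT (fun x => f (om, x))) /fubini_F/=.
    by congr (_ - _)%E; apply: eq_integral => x _; rewrite ?funeposE ?funenegE.
  apply: emeasurable_funB; apply: measurable_fun_fubini_tonelli_F => //.
    exact/measurable_funepos.
  exact/measurable_funeneg.
apply: measurable_funB; first exact: (measurableT_comp (f := fine) _ mI).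
apply: measurable_funM => //; apply: (@measurable_limn _ front R (fun N om => \sum_(0 <= i < N)
    (new_edge om i)%:R * weight w (edge Z (ratr (nth_rat i)) om))) => N.
apply: measurable_sum => i; apply: measurable_funM.
  by apply: measurable_natr_bool; exact: measurable_new_edge.
by apply: measurableT_comp => //; exact: measurable_edge.
Qed.

(** The estimator depends on the configuration only through the staircase: the integral through its
    height, the sum through the abscissae of its corners, which are the edges other than [-1]. *)
Lemma front_theta_hatE om : regular Z om -> theta_hat n Z w om = front_theta_hat om.
Proof.
move=> rom; have [X _ _ ties] := rom.
have [e /andP[e0 e1] we] := weight_vanish hsupp.
rewrite (theta_hat_weight _ _ X01) /front_theta_hat; congr (_ - _ * _).
  apply: eq_Rintegral => x _; have [x01|/(weight_out hsupp) ->] := boolP (0 <= x < 1).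
    by rewrite front_g_hatE.
  by rewrite !mulr0.
have [N HN] := finite_nat_bounded (regular_finite (g_hat Z om (1 - e)) rom).
apply: (@limn_sum_reindex _ (fun j => g_hat Z om (Z j om).1 == (Z j om).2) _
  (fun j => (Z j om).1) (fun i => edge Z (ratr (nth_rat i)) om) (weight w) N).
- move=> j /eqP h; have [/andP[x0 x1] _|/we ->] := boolP (0 <= (Z j om).1 <= 1 - e); last by rewrite eqxx.
  by apply: HN; rewrite /= -h; apply: g_hat_mono => //; lra.
- by move=> i j /eqP ei /eqP ej eij; apply: ties; rewrite -ei -ej eij.
- move=> i j /allP hi /allP hj eij; case: (ltngtP i j) => // ij.
    by have := hj i; rewrite mem_iota/= ij eij eqxx => /(_ isT).
  by have := hi j; rewrite mem_iota/= ij eij eqxx => /(_ isT).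
- move=> j /eqP ej _; have [q qj] := corner_edge X01 rom ej.
  have ex : exists i, edge Z (ratr (nth_rat i)) om == (Z j om).1.
    by exists (choice.pickle q); rewrite nth_rat_pickle qj.
  case: (ex_minnP ex) => i /eqP ei imin; exists i => //.
  apply/allP => k; rewrite mem_iota/= => ki; rewrite ei; apply/negP => /imin.
  by rewrite leqNgt ki.
(* The conventional value [-1] of an edge is harmless because the weight vanishes there. *)
- move=> i _ v0; apply: (edge_corner X01 rom).
  by apply: contra v0 => /eqP ->; rewrite weight_out//; lra.
Qed.

End FrontEstimator.

(** * Minimality of the variance *)

Lemma variance_lty_has_mean d (T : measurableType d) (R : realType) (P : probability T R)
    (X : T -> R) m : measurable_fun setT X -> ('E_P[X] = m%:E)%E -> ('V_P[X] < +oo)%E ->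
  exists2 v, has_mean P (fun x => (X x - m) ^+ 2) v & 'V_P[X]%E = v%:E.
Proof.
move=> mX eX; rewrite /variance unlock eX/=.
have -> : 'E_P[(X \- cst m) * (X \- cst m)]%E = (\int[P]_x ((X x - m) ^+ 2)%:E)%E.
  by rewrite unlock; apply: eq_integral => x _; rewrite /= expr2.
move=> fin; have := @integral_ge0 _ _ _ P setT (fun x => ((X x - m) ^+ 2)%:E) (fun x _ => _).
move=> /(_ (fun x => sqr_ge0 _)) ge0.
exists (fine (\int[P]_x ((X x - m) ^+ 2)%:E)); last by rewrite fineK// ge0_fin_numE.
apply: ge0_has_mean.
- by apply: measurable_funX; exact: measurable_funB.
- by move=> x; exact: sqr_ge0.
- by rewrite fineK// ge0_fin_numE.
Qed.

Section UniformlyMinimumVariance.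
Context {R : realType} {d : measure_display} {Omega : measurableType d}.
Variables (n : nat) (w : R -> R) (Z : nat -> Omega -> R * R) (P : (R -> R) -> probability Omega R).
Hypothesis hw : L2_unit_interval w.
Hypothesis hsupp : support_unit_interval w `<=` `[0, 1[.
Hypothesis n0 : (0 < n)%N.
Hypothesis hmodel : boundary_model n Z P.
Local Notation X01 := hmodel.1.
Local Notation front := (g_sigma_algebraType (voids_events Z)).
Local Notation S := (front_theta_hat n w Z).

Lemma theta_hat_front g : monotone_class g -> {ae P g, forall om, theta_hat n Z w om = S om}.
Proof.
move=> Mg; apply: filterS (ae_regular_above Mg n0 X01 (hmodel.2 _ Mg)) => om [rom _].
exact: (front_theta_hatE n hsupp X01).
Qed.

Lemma observable_front_theta_hat : observable Z S.
Proof.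
move=> C mC; apply: voids_events_observation.
by rewrite -[_ @^-1` _]setTI; exact: (measurable_front_theta_hat n hw X01).
Qed.

(** For an unbiased competitor, [U], its difference from [theta_hat], has mean zero under every
    boundary, hence is orthogonal to the error [F] of [theta_hat], which is measurable for the
    front. By Pythagoras the competitor has the variance of [theta_hat] plus the second moment of
    [U]. *)
Lemma UMVU_theta_hat : UMVU monotone_class Z P (theta w) (theta_hat n Z w).
Proof.
have oS := observable_front_theta_hat.
split.
- by exists S; split => // g; exact: theta_hat_front.
- by move=> g Mg; exact: (theta_hat_unbiased hw hsupp Mg n0 X01 (hmodel.2 _ Mg)).
move=> T [S' [oS' TS']] uT g Mg.
(* A competitor of infinite variance is trivially no better; all others have square integrable
   errors. *)
have [->|] := eqVneq ('V_(P g)[T])%E +oo%E; first by rewrite leey.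
rewrite -ltey => VT.
have [iT eT] := uT g Mg.
have mT : measurable_fun setT T by case/integrableP: iT => /measurable_EFinP.
have [v' hv' ->] := variance_lty_has_mean mT eT VT.
have pppg := hmodel.2 _ Mg.
have [h1 h2] := theta_hat_mean hw hsupp Mg n0 X01 pppg.
have mth := measurable_theta_hat n hw X01 (model_measurable hmodel).
rewrite (has_mean_variance mth h1 h2) lee_fin.
set v := fine _ in h2 *; set m := theta w g in hv' h1 h2.
pose U om := S' om - S om; pose F om := S om - m.
have oU : observable Z U.
  by apply/observableP; apply: measurable_funB; exact/observableP.
have U0 h : monotone_class h -> has_mean (P h) U 0.
  move=> Mh; have [iTh eTh] := uT h Mh.
  have [h1h _] := theta_hat_mean hw hsupp Mh n0 X01 (hmodel.2 _ Mh).
  have hT : has_mean (P h) T (theta w h).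
    have := integrable_has_mean iTh; congr (has_mean _ _ _).
    by move: eTh; rewrite unlock => ->.
  have := has_meanB hT h1h; rewrite subrr; apply: has_mean_ae.
  by apply: filterS2 (TS' h Mh) (theta_hat_front Mh) => om -> ->.
have hF : has_mean (P g) (fun om => F om ^+ 2) v.
  by apply: has_mean_ae h2; apply: filterS (theta_hat_front Mg) => om ->.
have hS' : has_mean (P g) (fun om => (S' om - m) ^+ 2) v'.
  by apply: has_mean_ae hv'; apply: filterS (TS' g Mg) => om ->.
have mF : measurable_fun [set: front] F.
  by apply: measurable_funB => //; exact: (measurable_front_theta_hat n hw X01).
have mU := observable_measurable hmodel oU.
have mF' := front_measurable hmodel mF.
(* Integrability of the product: with [x] the error of the competitor and [y = F], one has
   [|(x - y) y| <= x^2 + 2 y^2]. *)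
have [a hUF] : exists a, has_mean (P g) (fun om => `|U om * F om|) a.
  apply: (has_mean_bounded _ _ (has_meanD hS' (has_meanZ 2 hF))).
    exists (fun om => `|U om * F om|); last exact: aeW.
    by apply: measurableT_comp => //; exact: measurable_funM.
  apply: aeW => om; rewrite normr_id.
  have -> : U om = (S' om - m) - F om by rewrite /U /F; lra.
  move: (S' om - m) (F om) => x y; rewrite ler_norml; apply/andP; split; nra.
have hUF0 := mean_orthogonal n0 hmodel oU U0 Mg mF hUF.
(* The competitor has error [F + U], so subtracting [2 U F] and [F^2] from its square leaves [U^2],
   whose mean is nonnegative. *)
have hU2 := has_meanB (has_meanB hS' (has_meanZ 2 hUF0)) hF.
rewrite -subr_ge0; have := has_mean_ge0 _ hU2; rewrite mulr0 subr0; apply.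
apply: aeW => om; rewrite (_ : _ - _ = U om ^+ 2) ?sqr_ge0//.
by rewrite /U /F !expr2; lra.
Qed.

End UniformlyMinimumVariance.

Theorem theorem3p9 (R : realType) (w : R -> R)
    (hw : L2_unit_interval w)
    (hsupp : support_unit_interval w `<=` `[0, 1[)
    (d : measure_display) (Omega : nat -> measurableType d)
    (Z : forall n, nat -> Omega n -> R * R)
    (P : forall n, (R -> R) -> probability (Omega n) R)
    (hmodel : forall n, (0 < n)%N -> boundary_model n (Z n) (P n)) :
  (forall n, (0 < n)%N ->
     UMVU monotone_class (Z n) (P n) (theta w) (theta_hat n (Z n) w) /\
     (forall g, monotone_class g ->
        'V_(P n g)[theta_hat n (Z n) w] =
        (n%:R^-1)%:E * \int[lebesgue_measure]_(x in `[0%R, 1%R])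
          ('E_(P n g)[fun om => (g_hat (Z n) om x - g x)%R] * (w x ^+ 2)%:E))%E)
  /\
  ((exists C : R, forall x, x \in `[0, 1] -> `|w x| <= C) ->
   forall g, monotone_class g ->
   exists K : R, \forall n \near \oo,
     ('V_(P n g)[theta_hat n (Z n) w] <=
      poweR ((3 * pi / 2)%:E * (lim ((g x)%:E @[x --> 1%R^'-]) - (g 0)%:E)) 2^-1
        * (sup_norm w ^+ 2 * n%:R `^ (- (3 / 2)))%:E
      + (K * n%:R ^- 2)%:E)%E).
Proof.
split=> [n n0|wbnd g Mg].
  split; first exact: (UMVU_theta_hat hw hsupp n0 (hmodel n n0)).
  move=> g Mg; have pppg := (hmodel n n0).2 g Mg.
  rewrite (theta_hat_variance hw hsupp Mg n0 (hmodel n n0).1 pppg).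
  exact: (variance_valueE hsupp Mg n0 (hmodel n n0).1 pppg).
have [K HK] := variance_asymptotics hw hsupp wbnd Mg
  (fun n n0 => (hmodel n n0).1) (fun n n0 => (hmodel n n0).2 g Mg).
exists K; apply: filterS2 HK (nbhs_infty_gt 0%N) => n HKn n0.
by rewrite (theta_hat_variance hw hsupp Mg n0 (hmodel n n0).1 ((hmodel n n0).2 g Mg)).
Qed.
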